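(* Let $M$ be the Atiyah--Hitchin manifold with its Riemannian metric $ds^2$ (depending on a parameter $m>0$), and let $\Sigma=\{r=0\}\subset M$ be its zero section. Then $\Sigma$ is the only (nonempty) compact minimal $2$-dimensional submanifold without boundary in $M$. Moreover, there exists no (nonempty) compact minimal $3$-dimensional submanifold without boundary in $M$.
   Context: **The Atiyah--Hitchin manifold $M$.** The underlying manifold of $M$ is the total space of the complex line bundle of degree $-4$ over $S^2$. Let $z,w$ be the standard complex charts on $S^2$ with $z=1/w$. Over the $z$-chart the fiber coordinate is $re^{i\psi}$ with $r\ge 0$, $e^{i\psi}\in S^1$; on the other chart the coordinates are $(w,re^{i\varphi})$ with $(w,\varphi)=(1/z,\psi+4\arg z)$. On the unit circle bundle put $$\sigma^1=\tfrac12\Big(d\psi+2i\,\frac{z\,d\bar z-\bar z\,dz}{1+|z|^2}\Big),\quad \sigma^2=\mathrm{Re}\Big[\frac{2e^{i\psi/2}dz}{1+|z|^2}\Big],\quad \sigma^3=\mathrm{Im}\Big[\frac{2e^{i\psi/2}dz}{1+|z|^2}\Big].$$ The forms $\sigma^2,\sigma^3$ are defined only up to a common sign, but $(\sigma^2)^2,(\sigma^3)^2,\sigma^2\wedge\sigma^3$ are well defined; $d\sigma^1=\sigma^2\wedge\sigma^3$ and cyclic permutations hold. The Riemannian metric on $M$ is $$ds^2=dr^2+a^2(\sigma^1)^2+b^2(\sigma^2)^2+c^2(\sigma^3)^2,$$ where $a,b,c$ are the functions of $r\in[0,\infty)$ solving $$a'=\frac{a^2-(b-c)^2}{2bc},\quad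 b'=\frac{b^2-(c-a)^2}{2ca},\quad c'=\frac{c^2-(a-b)^2}{2ab},$$ with initial conditions $a(0)=0$, $b(0)=-m$, $c(0)=m$ for a constant $m>0$ (prime denotes $d/dr$). This is the solution smooth up to $r=0$, defined for all $r\ge0$, with $a,c>0$ and $b<0$ for $r>0$. The metric is smooth across $r=0$ and complete, and $r$ is the geodesic distance to the zero section. $M$ is oriented by $dr\wedge\sigma^1\wedge\sigma^2\wedge\sigma^3$. The zero section $\Sigma=\{r=0\}$ is a $2$-sphere, round of radius $m$ in the induced metric; it is a minimal surface. A submanifold is minimal if its mean curvature vector vanishes identically. *)

(* Defs.v *)
From HB Require Import structures.
From mathcomp Require Import all_boot all_order all_algebra.
From mathcomp Require Import generic_quotient complex.
From mathcomp Require Import all_classical all_reals all_analysis.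

Set Implicit Arguments.
Unset Strict Implicit.
Unset Printing Implicit Defensive.

Import Order.TTheory GRing.Theory Num.Theory.
Import numFieldNormedType.Exports.

Local Open Scope classical_set_scope.
Local Open Scope ring_scope.

(** * Submanifolds of a coordinate domain R^n with a metric tensor *)

Section Coordinates.
Variable R : realType.

Definition partial (k : nat) (i : 'I_k) (f : 'rV[R]_k -> R) (t : 'rV[R]_k) : R :=
  'D_(delta_mx 0 i) f t.

Fixpoint Ck_on (k : nat) (W : set 'rV[R]_k) (p : nat) (f : 'rV[R]_k -> R) : Prop :=
  (forall t, W t -> {for t, continuous f}) /\
  match p with
  | 0%N => True
  | q.+1 => forall i : 'I_k,
      (forall t, W t -> derivable f t (delta_mx 0 i)) /\ Ck_on W q (partial i f)
  end.

Definition smooth_on (k : nat) (W : set 'rV[R]_k) (f : 'rV[R]_k -> R) : Prop :=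
  forall p : nat, Ck_on W p f.

(* Row i holds the components of the coordinate tangent vector d(phi)/d(t_i). *)
Definition tangent_mx (k n : nat) (phi : 'rV[R]_k -> 'rV[R]_n) (t : 'rV[R]_k) :
    'M[R]_(k, n) :=
  \matrix_(i < k, l < n) partial i (fun s => phi s 0 l) t.

(* [phi] restricted to the open set [W] is a smooth immersion and a
   homeomorphism onto a relatively open subset of [S]. *)
Definition local_parametrization (k n : nat) (S : set 'rV[R]_n)
    (W : set 'rV[R]_k) (phi : 'rV[R]_k -> 'rV[R]_n) : Prop :=
  [/\ open W,
      forall l : 'I_n, smooth_on W (fun t => phi t 0 l),
      forall t, W t -> row_free (tangent_mx phi t) &
      exists U : set 'rV[R]_n,
        [/\ open U, phi @` W = S `&` U &
            exists psi : 'rV[R]_n -> 'rV[R]_k,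
              {within S `&` U, continuous psi} /\
              forall t, W t -> psi (phi t) = t]].

Definition embedded_submanifold (k n : nat) (S : set 'rV[R]_n) : Prop :=
  forall p, S p -> exists (W : set 'rV[R]_k) (phi : 'rV[R]_k -> 'rV[R]_n),
    local_parametrization S W phi /\ (phi @` W) p.

Section MeanCurvature.
Variables (k n : nat) (g : 'rV[R]_n -> 'M[R]_n).

Definition christoffel (x : 'rV[R]_n) (l i j : 'I_n) : R :=
  2^-1 * \sum_(s < n) invmx (g x) l s *
    (partial i (fun y => g y s j) x + partial j (fun y => g y s i) x
     - partial s (fun y => g y i j) x).

Variables (phi : 'rV[R]_k -> 'rV[R]_n) (t : 'rV[R]_k).

Definition induced_metric : 'M[R]_k :=
  tangent_mx phi t *m g (phi t) *m (tangent_mx phi t)^T.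

(* Component of [v] that is g-orthogonal to the tangent space of [phi]. *)
Definition normal_part (v : 'rV[R]_n) : 'rV[R]_n :=
  v - v *m g (phi t) *m (tangent_mx phi t)^T *m invmx induced_metric
        *m tangent_mx phi t.

(* The Levi-Civita derivative of d(phi)/d(t_j) along d(phi)/d(t_i). *)
Definition covariant_second_derivative (i j : 'I_k) : 'rV[R]_n :=
  \row_(l < n)
    (partial i (partial j (fun s => phi s 0 l)) t +
     \sum_(p < n) \sum_(q < n) christoffel (phi t) l p q *
        tangent_mx phi t i p * tangent_mx phi t j q).

Definition second_fundamental_form (i j : 'I_k) : 'rV[R]_n :=
  normal_part (covariant_second_derivative i j).

Definition mean_curvature_vector : 'rV[R]_n :=
  \sum_(i < k) \sum_(j < k)
     invmx induced_metric i j *: second_fundamental_form i j.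

End MeanCurvature.
End Coordinates.

(** * The Atiyah--Hitchin manifold *)

Section AtiyahHitchin.
Variable R : realType.
Local Notation C := R[i].

(* A point of a chart is (Re z, Im z, Re u, Im u), where u = r e^{i psi}.  The
   same functions read off the components dz and du of a tangent vector. *)
Definition base_coord (x : 'rV[R]_4) : C := Complex (x 0 0) (x 0 1).
Definition fiber_coord (x : 'rV[R]_4) : C := Complex (x 0 2%:R) (x 0 3%:R).

Definition point_of (z u : C) : 'rV[R]_4 :=
  \row_(i < 4) [:: complex.Re z; complex.Im z; complex.Re u; complex.Im u]`_i.

(* (w, phi) = (1/z, psi + 4 arg z); the inverse change has the same form. *)
Definition transition (x : 'rV[R]_4) : 'rV[R]_4 :=
  let z := base_coord x in
  point_of z^-1 (fiber_coord x * (z / `|z|) ^+ 4).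

(* [(false, x)] lies in the z-chart, [(true, x)] in the w-chart. *)
Definition glued (p q : bool * 'rV[R]_4) : bool :=
  if p.1 == q.1 then p.2 == q.2
  else (base_coord p.2 != 0) && (q.2 == transition p.2).

Lemma base_point_of z u : base_coord (point_of z u) = z.
Proof. by rewrite /base_coord !mxE /=; case: z. Qed.

Lemma fiber_point_of z u : fiber_coord (point_of z u) = u.
Proof. by rewrite /fiber_coord !mxE /=; case: u. Qed.

Lemma point_of_coords x : point_of (base_coord x) (fiber_coord x) = x.
Proof.
apply/rowP => i; rewrite mxE.
by case: i => -[|[|[|[|//]]]] Hi /=; congr (x 0 _); apply: val_inj.
Qed.

Lemma base_transition x : base_coord (transition x) = (base_coord x)^-1.
Proof. exact: base_point_of. Qed.

Lemma transitionK x : base_coord x != 0 -> transition (transition x) = x.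
Proof.
move=> z0; rewrite {1}/transition base_transition invrK.
rewrite /transition fiber_point_of -mulrA -exprMn normrV ?unitfE // invrK.
by rewrite mulrACA divff // mul1r mulVf ?normr_eq0 // expr1n mulr1 point_of_coords.
Qed.

Lemma glued_refl : reflexive glued.
Proof. by move=> p; rewrite /glued !eqxx. Qed.

Lemma glued_sym : symmetric glued.
Proof.
move=> [i x] [j y]; rewrite /glued /= [j == i]eq_sym; case: ifP => _.
  exact: eq_sym.
by apply/andP/andP => -[z0 /eqP ->]; rewrite base_transition invr_eq0 z0
  transitionK.
Qed.

Lemma glued_trans : transitive glued.
Proof.
move=> [j y] [i x] [l z]; rewrite /glued /=.
case: i; case: j; case: l => //=.
all: try by move=> /eqP ->.
all: try by move=> h /eqP <-.
all: by move=> /andP[z0 /eqP ->] /andP[_ /eqP ->]; rewrite transitionK.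
Qed.

Definition glued_equiv : equiv_rel (bool * 'rV[R]_4)%type :=
  EquivRel glued glued_refl glued_sym glued_trans.

Definition AH : topologicalType := quotient_topology {eq_quot glued_equiv}%qT.

Definition chart (i : bool) (x : 'rV[R]_4) : AH :=
  (\pi_({eq_quot glued_equiv}) (i, x))%qT.

Definition zero_section : set AH :=
  [set p | exists i x, fiber_coord x = 0 /\ p = chart i x].

(* C^infinity on the closed half-line: restriction of a smooth function on R. *)
Definition smooth_halfline (f : R -> R) : Prop :=
  exists F : R -> R,
    (forall (n : nat) (r : R), derivable F^`(n)%classic r 1) /\
    (forall r : R, 0 <= r -> f r = F r).

Record AH_profile (m : R) (a b c : R -> R) : Prop := {
  profile_smooth :
    [/\ smooth_halfline a, smooth_halfline b & smooth_halfline c];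
  profile_init : [/\ a 0 = 0, b 0 = - m & c 0 = m];
  profile_sign : forall r : R, 0 < r -> [/\ 0 < a r, b r < 0 & 0 < c r];
  profile_ode_a : forall r : R, 0 < r ->
    is_derive r 1 a ((a r ^+ 2 - (b r - c r) ^+ 2) / (2 * b r * c r));
  profile_ode_b : forall r : R, 0 < r ->
    is_derive r 1 b ((b r ^+ 2 - (c r - a r) ^+ 2) / (2 * c r * a r));
  profile_ode_c : forall r : R, 0 < r ->
    is_derive r 1 c ((c r ^+ 2 - (a r - b r) ^+ 2) / (2 * a r * b r))
}.

Section Metric.
Variables a b c : R -> R.

Section OneForms.
Variable x : 'rV[R]_4.
Let z := base_coord x.
Let u := fiber_coord x.

Definition fiber_norm : R := complex.Re `|u|.

Variable v : 'rV[R]_4.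
Let dz := base_coord v.
Let du := fiber_coord v.

(* u = r e^{i psi} gives du / u = dr / r + i dpsi. *)
Definition form_dr : R := fiber_norm * complex.Re (du / u).
Definition form_dpsi : R := complex.Im (du / u).

Definition sigma1 : R :=
  2^-1 * (form_dpsi +
    complex.Re (2 * (Complex 0 1) * (z * dz^* - z^* * dz) / (1 + `|z| ^+ 2))).

(* [sqrtC (u / `|u|)] is one of the two values of e^{i psi/2}; the metric does
   not depend on which one is taken. *)
Let sigma23 : C := 2 * sqrtC (u / `|u|) * dz / (1 + `|z| ^+ 2).
Definition sigma2 : R := complex.Re sigma23.
Definition sigma3 : R := complex.Im sigma23.

End OneForms.

Definition metric_form (x v w : 'rV[R]_4) : R :=
  let r := fiber_norm x in
  form_dr x v * form_dr x w + a r ^+ 2 * (sigma1 x v * sigma1 x w)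
  + b r ^+ 2 * (sigma2 x v * sigma2 x w) + c r ^+ 2 * (sigma3 x v * sigma3 x w).

(* The polar expression is singular at u = 0, where the metric is its continuous
   extension.  The change z = 1/w, psi = phi + 4 arg w preserves sigma1 and, up
   to a common sign, sigma2 and sigma3, so the same matrix represents the metric
   in both charts. *)
Definition AH_metric (x : 'rV[R]_4) : 'M[R]_4 :=
  \matrix_(i < 4, j < 4)
    let g y := metric_form y (delta_mx 0 i) (delta_mx 0 j) in
    if fiber_coord x == 0
    then lim (g y @[y --> within [set y | fiber_coord y != 0] (nbhs x)])
    else g x.

End Metric.

Definition AH_submanifold (k : nat) (N : set AH) : Prop :=
  forall i : bool, embedded_submanifold k (chart i @^-1` N).

Definition AH_minimal (a b c : R -> R) (k : nat) (N : set AH) : Prop :=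
  forall (i : bool) (W : set 'rV[R]_k) (phi : 'rV[R]_k -> 'rV[R]_4),
    local_parametrization (chart i @^-1` N) W phi ->
    forall t, W t -> mean_curvature_vector (AH_metric a b c) phi t = 0.

Definition compact_minimal_submanifold (a b c : R -> R) (k : nat) (N : set AH) :
    Prop :=
  [/\ N !=set0, compact N, AH_submanifold k N & AH_minimal a b c k N].

End AtiyahHitchin.

Arguments zero_section R : clear implicits.

(* Main.v *)
(* Write u for the fibre coordinate, r = |u| and F = r^2. Since grad F = 2 r d/dr, the Hessian
   of F is 2 dr^2 + 2 r (a a' sigma1^2 + b b' sigma2^2 + c c' sigma3^2), with eigenvalues 2,
   2 r a'/a, 2 r b'/b, 2 r c'/c. A barrier argument for the ODE system shows b + c < a and
   a + b < c for r > 0, which is exactly what makes the sum of any two of the last three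
   eigenvalues positive. At a maximum of F on a compact minimal N, the tangent space of N is
   orthogonal to d/dr and the Laplacian of F restricted to N, which is <= 0, is the trace of
   Hess F over that tangent space, which is > 0 unless r = 0. So N lies in the zero section
   Sigma. This excludes dimension 3, and in dimension 2 makes N open and closed in Sigma.
   Conversely Sigma is minimal because b'(0) = c'(0). *)
Require Import Defs.
From mathcomp Require Import all_boot all_order all_algebra.
From mathcomp Require Import generic_quotient complex ring lra.
From mathcomp Require Import all_classical all_reals all_analysis.

Set Implicit Arguments.
Unset Strict Implicit.
Unset Printing Implicit Defensive.

Import Order.TTheory GRing.Theory Num.Theory.
Import numFieldNormedType.Exports.

Local Open Scope classical_set_scope.
Local Open Scope ring_scope.

(** * Calculus *)

(** The metric is explicit only where u is nonzero; on the zero section it is a limit. The two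
    regimes are therefore handled separately. Off Sigma the coefficients are differentiable
    expressions in four real coordinates, and the field r d/dr is linear in them, which makes the
    Hessian of F computable. On Sigma only the values and first derivatives of g that enter the mean
    curvature are computed, as limits and difference quotients, from a = 2 r + ..., b = - m + r / 2
    + ..., c = m + r / 2 + .... These expansions also explain the use of pairs of eigenvalues: near
    r = 0, b is negative and b' is close to 1/2, so 2 r b'/b is negative and F is not convex. The
    barriers hold because a' + b' - c' = - 2 wherever c = a + b, and b' + c' - a' = - 2 wherever a =
    b + c. The first quantity starts at - 2 m, but the second starts at 0, so its initial sign comes
    from its slope - 1 there. For the open and closed argument, points of Sigma are separated by an
    explicit map to the round sphere in R^3, and interior points come from minimising a distance. *)

Section Analysis.
Variable R : realType.

Lemma is_derive_line (V W : normedModType R) (f : V -> W) (x v : V) (s : R) (d : W) :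
  is_derive (x + s *: v) v f d -> is_derive s 1 (fun h : R => f (x + h *: v)) d.
Proof.
have E : (fun h => h^-1 *: (((fun h : R => f (x + h *: v)) \o shift s) (h *: 1) -
            f (x + s *: v))) =
         (fun h => h^-1 *: ((f \o shift (x + s *: v)) (h *: v) - f (x + s *: v))).
  apply/funext => h /=; congr (_ *: (f _ - _)).
  by rewrite [h%:A]mulr1 scalerDl addrCA.
by case=> df <-; apply: DeriveDef; rewrite /derivable /derive E.
Qed.

(** Derivability is asked near x because [derive1_at_max], applied to h -> f (x + h v), needs it on
    an open interval. *)
Lemma interior_max_derivative (V : normedModType R) (f : V -> R) (x v : V) (d : R) :
  is_derive x v f d -> (\forall y \near x, f y <= f x) ->
  (\forall y \near x, derivable f y v) -> d = 0.
Proof.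
move=> df xmax fd.
have c0 : ((fun h : R => x + h *: v) h @[h --> (0:R)]) --> x.
  rewrite -[X in _ --> X]addr0 -(scale0r v); apply: cvgD; first exact: cvg_cst.
  by apply: cvgZr_tmp; exact: cvg_id.
have /nbhs_ballP[e /= e0 He] : \forall h \near (0:R),
    f (x + h *: v) <= f x /\ derivable f (x + h *: v) v.
  have /c0 h1 := xmax; have /c0 h2 := fd.
  by near=> h; split; near: h; [exact: h1|exact: h2].
have df0 : is_derive (0:R) 1 (fun h : R => f (x + h *: v)) d.
  by apply: is_derive_line; rewrite scale0r addr0.
have H : is_derive (0:R) 1 (fun h : R => f (x + h *: v)) 0.
  have ine t : t \in `](- e), e[%R -> ball (0:R) e t.
    by rewrite in_itv /= /ball /= sub0r normrN -ltr_norml.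
  apply: (@derive1_at_max R _ (- e) e 0).
  - by rewrite ltW // gtrN.
  - move=> t /ine/He [_ dt].
    by have [] := is_derive_line (derivableP dt).
  - by rewrite in_itv /= oppr_lt0 e0.
  - by move=> t /ine/He [? _]; rewrite scale0r addr0.
by rewrite -[LHS](@derive_val _ _ _ _ _ _ _ df0) (@derive_val _ _ _ _ _ _ _ H).
Unshelve. all: by end_near. Qed.

(** If d2 > 0, then [dh] vanishes at 0 and is positive just to the right, so the mean value theorem
    gives h (e / 2) > h 0. *)
Lemma second_derivative_max (h dh : R -> R) (d2 : R) :
  (\forall s \near (0:R), is_derive (s:R) 1 h (dh s)) -> is_derive (0:R) 1 dh d2 ->
  (\forall s \near (0:R), h s <= h 0) -> d2 <= 0.
Proof.
move=> hd dhd hmax.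
have dh0 : dh 0 = 0.
  apply: (@interior_max_derivative _ h 0 1) => //.
    exact: nbhs_singleton hd.
  by near=> y; have [] : is_derive (y:R) 1 h (dh y) by near: y.
case: (leP d2 0) => // d20; exfalso.
have [e /= e0 He] : exists2 e, 0 < e & forall s, 0 < s < e ->
   [/\ 0 < dh s, is_derive (s:R) 1 h (dh s) & h s <= h 0].
  have /cvgrPdist_lt /(_ _ d20) P : h^-1 *: (dh (h *: 1 + 0) - dh 0) @[h --> (0:R)^'] --> d2.
    by case: dhd => cd <-; exact: cd.
  have P1 : \forall s \near (0:R)^', 0 < s -> 0 < dh s.
    near=> s => s0.
    have : `|d2 - s^-1 *: (dh (s *: 1 + 0) - dh 0)| < d2 by near: s.
    rewrite dh0 subr0 addr0 [_%:A]mulr1 /GRing.scale /= => Q.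
    have : 0 < s^-1 * dh s.
      have := ler_norm (d2 - s^-1 * dh s); lra.
    by rewrite pmulr_rgt0 // invr_gt0.
  have P2 : \forall s \near (0:R), s != 0 -> 0 < s -> 0 < dh s := P1.
  have /nbhs_ballP[e /= e0 He] : \forall s \near (0:R),
      (s != 0 -> 0 < s -> 0 < dh s) /\ is_derive (s:R) 1 h (dh s) /\ h s <= h 0.
    by near=> s; split; [near: s|split; near: s].
  exists e => // s /andP[s0 se].
  have [|h1 [h2 h3]] := He s; last by split => //; exact: h1 (lt0r_neq0 s0) s0.
  by rewrite /ball /= sub0r normrN gtr0_norm.
have e2 : 0 < e / 2 by rewrite divr_gt0.
have e2e : e / 2 < e by lra.
have dnear : derivable h 0 1 by have [] := nbhs_singleton hd.
have [c] : exists2 c, c \in `]0, e / 2[%R & h (e / 2) - h 0 = dh c * (e / 2 - 0).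
  apply: MVT => //.
    move=> x; rewrite in_itv /= => /andP[x0 xe].
    by have [|//] := He x; rewrite x0 (lt_trans xe).
  apply: derivable_within_continuous => x; rewrite in_itv /= => /andP[].
  rewrite le_eqVlt => /orP[/eqP <- //|x0 xe].
  by have [|_ []//] := He x; rewrite x0 (le_lt_trans xe).
rewrite in_itv /= => /andP[c0 ce] E.
have [|dc _ _] := He c; first by rewrite c0 (lt_trans ce).
have [|_ _ hm] := He (e / 2); first by rewrite e2.
have : 0 < dh c * (e / 2 - 0) by rewrite subr0 mulr_gt0.
by rewrite -E subr_gt0 ltNge hm.
Unshelve. all: by end_near. Qed.

(** At the first point r1 where h reaches 0 the derivative is negative, so h would be positive just
    before r1. The sign of the derivative is asked only on the zero set of h, where the profile
    equations simplify. *)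
Lemma negative_barrier (h dh : R -> R) :
  (\forall r \near (0:R)^'+, h r < 0) ->
  (forall r : R, 0 < r -> is_derive r 1 h (dh r)) ->
  (forall r : R, 0 < r -> h r = 0 -> dh r < 0) ->
  forall r : R, 0 < r -> h r < 0.
Proof.
move=> h0 hd hz r0 r0gt0; rewrite ltNge; apply/negP => hr0.
have [e /= e0 He] : exists2 e, 0 < e & forall s, 0 < s < e -> h s < 0.
  move: h0 => /nbhs_ballP[e /= e0 He].
  exists e => // s /andP[s0 se]; apply: He => //.
  by rewrite /ball /= sub0r normrN gtr0_norm.
have hc r : 0 < r -> {for r, continuous h}.
  by move=> /hd [? _]; apply/differentiable_continuous/derivable1_diffP.
pose A := [set r : R | 0 < r /\ 0 <= h r].
have lbA : lbound A e.
  move=> r [rgt0 hr]; rewrite leNgt; apply/negP => re.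
  by have := He r; rewrite rgt0 re => /(_ isT); rewrite ltNge hr.
have infA : has_inf A by split; [exists r0|exists e].
pose r1 := inf A.
have r1e : e <= r1 by apply: lb_le_inf => //; exists r0.
have r1gt0 : 0 < r1 by apply: lt_le_trans r1e.
have below r : 0 < r -> r < r1 -> h r < 0.
  move=> rgt0 rr1; rewrite ltNge; apply/negP => hr.
  have : r1 <= r by apply: ge_inf; [exists e|split].
  by rewrite leNgt rr1.
(* Continuity excludes both signs: h r1 > 0 would spread to the left of r1, against [below], and h
   r1 < 0 would spread to the right, against r1 being the infimum of A. *)
have hr1 : h r1 = 0.
  apply/eqP; rewrite eq_le; apply/andP; split.
    rewrite leNgt; apply/negP => hpos.
    have /nbhs_ballP[d /= d0 Hd] : \forall r \near r1, 0 < r /\ 0 < h r.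
      have k1 : \forall r \near r1, 0 < h r.
        exact: (cvgr_gt _ (hc _ r1gt0) _ hpos).
      near=> r; split; last by near: r.
      by near: r; exact: lt_nbhsr.
    pose d' := Num.min (d / 2) (r1 / 2).
    have d'0 : 0 < d' by rewrite lt_min !divr_gt0.
    have d'r1 : d' < r1 by rewrite gt_min; apply/orP; right; lra.
    have := below (r1 - d'); rewrite subr_gt0 d'r1 gtrDl oppr_lt0 d'0 => /(_ isT isT).
    have [|_ /ltW] := Hd (r1 - d').
      rewrite /ball /= opprB addrC subrK gtr0_norm // gt_min.
      by apply/orP; left; lra.
    by rewrite leNgt => /negP.
  rewrite leNgt; apply/negP => hneg.
  have /nbhs_ballP[d /= d0 Hd] : \forall r \near r1, h r < 0.
    exact: (cvgr_lt _ (hc _ r1gt0) _ hneg).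
  have [a aA ad] := inf_adherent d0 infA.
  have r1a : r1 <= a by apply: ge_inf => //; exists e.
  have [_] := aA; rewrite leNgt => /negP; apply; apply: Hd.
  by rewrite /ball /= ler0_norm ?subr_le0 // opprB ltrBlDl.
have dneg := hz _ r1gt0 hr1.
have /cvgrPdist_lt /(_ (- dh r1)) P :
    k^-1 *: (h (k *: 1 + r1) - h r1) @[k --> (0:R)^'] --> dh r1.
  by case: (hd _ r1gt0) => cd <-; exact: cd.
have := P; rewrite oppr_gt0 => /(_ dneg); rewrite hr1 /dnbhs near_withinE.
move=> /nbhs_ballP[d /= d0 Hd].
pose d' := Num.min (d / 2) (r1 / 2).
have d'0 : 0 < d' by rewrite lt_min !divr_gt0.
have d'r1 : d' < r1 by rewrite gt_min; apply/orP; right; lra.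
have d'd : d' < d by rewrite gt_min; apply/orP; left; lra.
(* The difference quotient at - d' has negative numerator and denominator, so it is positive; yet it
   lies within - dh r1 of the negative number dh r1. *)
have := Hd (- d'); rewrite /ball /= sub0r opprK gtr0_norm //.
move=> /(_ d'd); rewrite oppr_eq0 => /(_ (lt0r_neq0 d'0)).
have hb : h (r1 - d') < 0.
  by apply: below; rewrite ?subr_gt0 // gtrDl oppr_lt0.
rewrite [_%:A]mulr1 subr0 [- d' + _]addrC /GRing.scale /= invrN mulNr opprK.
have : 0 < - (d'^-1 * h (r1 - d')) by rewrite -mulrN mulr_gt0 ?invr_gt0 ?oppr_gt0.
move=> q; have := ler_norm (- (dh r1 + d'^-1 * h (r1 - d'))); rewrite normrN.
lra.
Unshelve. all: by end_near. Qed.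

End Analysis.

(** * Directional derivatives and Hessians from partial derivatives *)

Section Partials.
Variable R : realType.
Implicit Types k : nat.

Lemma cvg_line (V : normedModType R) (x v : V) :
  ((fun h : R => x + h *: v) h @[h --> (0:R)]) --> x.
Proof.
rewrite -[X in _ --> X]addr0 -(scale0r v); apply: cvgD; first exact: cvg_cst.
by apply: cvgZr_tmp; exact: cvg_id.
Qed.

(** The base point t0 + h w moves with h. The mean value theorem in direction j gives c times g at
    an intermediate point, which tends to t0, and continuity of g concludes. *)
Lemma partial_increment k (f g : 'rV[R]_k -> R) (t0 w : 'rV[R]_k) (j : 'I_k) (c : R) :
  (\forall t \near t0, is_derive t (delta_mx 0 j) f (g t)) ->
  {for t0, continuous g} ->
  h^-1 * (f (t0 + h *: (c *: delta_mx 0 j + w)) - f (t0 + h *: w)) @[h --> (0:R)^']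
    --> c * g t0.
Proof.
set e := delta_mx 0 j => fd fc; apply/cvgrPdist_lt => eps eps0.
have eps1 : 0 < eps / (`|c| + 1) by rewrite divr_gt0 // ltr_wpDl.
have fc' : \forall t \near t0, `|g t0 - g t| < eps / (`|c| + 1).
  by move/cvgrPdist_lt : fc => /(_ _ eps1).
have /nbhs_ballP[d /= d0 Hd] : \forall t \near t0, is_derive t e f (g t) /\
    `|g t0 - g t| < eps / (`|c| + 1).
  by near=> t; split; near: t.
(* C bounds the norm of w + s c e for 0 <= s <= 1, with 1 added to make it positive; |h| < d / C
   keeps the whole segment in the ball where the hypotheses hold. *)
pose C := `|w| + `|c| * `|e| + 1.
have C0 : 0 < C by rewrite ltr_wpDl // addr_ge0 // mulr_ge0.
have dC : 0 < d / C by rewrite divr_gt0.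
have small (h s : R) : `|h| < d / C -> 0 <= s <= 1 -> ball t0 d (t0 + h *: w + (s * (h * c)) *: e).
  move=> hd /andP[s0 s1]; rewrite -ball_normE /ball_ /= opprD addrA opprD addrA subrr sub0r.
  rewrite -opprD normrN.
  apply: (@le_lt_trans _ _ (`|h| * C)); last by rewrite -ltr_pdivlMr.
  apply: (le_trans (ler_normD _ _)). rewrite !normrZ (ger0_norm s0).
  rewrite /C 2!mulrDr mulr1 -addrA; apply: lerD => //.
  rewrite -[leLHS]addr0; apply: lerD => //.
  have aux (x y z : R) : 0 <= x -> 0 <= y -> 0 <= z -> s * (x * y) * z <= x * (y * z).
    move=> x0 y0 z0; rewrite -subr_ge0.
    have -> : x * (y * z) - s * (x * y) * z = (1 - s) * (x * (y * z)) by ring.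
    by rewrite !mulr_ge0 // subr_ge0.
  exact: aux.
near=> h.
have h0 : h != 0 by near: h; exact: nbhs_dnbhs_neq.
have hd : `|h| < d / C.
  near: h; apply: (@nbhs_dnbhs _ (0:R)); apply/nbhs_ballP; exists (d / C) => //= h.
  by rewrite /ball /= sub0r normrN.
have D s : 0 <= s <= 1 -> is_derive (s:R) 1 (fun s => f (t0 + h *: w + (s * (h * c)) *: e))
    ((h * c) * g (t0 + h *: w + (s * (h * c)) *: e)).
  move=> s01; have [df _] := Hd _ (small _ _ hd s01).
  have l1 := is_derive_line df.
  have l2 : is_derive (s:R) 1 (fun s => s * (h * c)) (h * c).
    by apply: is_derive_eq; rewrite /GRing.scale /= ?mulr1 ?mulr0 ?addr0 ?add0r.
  have l3 := @is_derive1_comp _ _ (fun s => s * (h * c)) _ _ _ l1 l2.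
  by apply: is_derive_eq l3 _; rewrite mulrC.
have [s] : exists2 s, s \in `[0, 1]%R & f (t0 + h *: w + (1 * (h * c)) *: e) -
      f (t0 + h *: w + (0 * (h * c)) *: e) =
    ((h * c) * g (t0 + h *: w + (s * (h * c)) *: e)) * (1 - 0).
  apply: (@MVT_segment _ (fun s => f (t0 + h *: w + (s * (h * c)) *: e))
    (fun s => ((h * c) * g (t0 + h *: w + (s * (h * c)) *: e)))) => //.
    move=> x; rewrite in_itv /= => /andP[x0 x1]; apply: D.
    by rewrite !ltW.
  apply: derivable_within_continuous => x; rewrite in_itv /= => x01.
  by have [] := D x x01.
rewrite in_itv /= => s01 E.
have -> : t0 + h *: (c *: e + w) = t0 + h *: w + (1 * (h * c)) *: e.
  by rewrite scalerDr scalerA mul1r -addrA; congr (_ + _); rewrite addrC.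
have -> : f (t0 + h *: w) = f (t0 + h *: w + (0 * (h * c)) *: e).
  by rewrite mul0r scale0r addr0.
rewrite E subr0 mulr1 -mulrA mulKf // -mulrBr normrM.
have [_ H] := Hd _ (small _ _ hd s01).
apply: (@le_lt_trans _ _ ((`|c|) * (eps / (`|c| + 1)))).
  by apply: ler_wpM2l => //; exact: ltW.
rewrite mulrCA -ltr_pdivlMl // mulVf ?gt_eqF //.
by rewrite ltr_pdivrMr ?ltr_wpDl // mul1r ltrDl.
Unshelve. all: by end_near. Qed.

(** The direction v is built up one coordinate at a time, and [partial_increment] handles each added
    term. *)
Lemma is_derive_partials k (f : 'rV[R]_k -> R) (g : 'I_k -> 'rV[R]_k -> R) (t0 v : 'rV[R]_k) :
  (forall j, \forall t \near t0, is_derive t (delta_mx 0 j) f (g j t)) ->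
  (forall j, {for t0, continuous (g j)}) ->
  is_derive t0 v f (\sum_j v 0 j * g j t0).
Proof.
move=> fd fc.
have H (s : seq 'I_k) :
    h^-1 * (f (t0 + h *: (\sum_(j <- s) v 0 j *: delta_mx 0 j)) - f t0) @[h --> (0:R)^']
    --> \sum_(j <- s) v 0 j * g j t0.
  elim: s => [|j s IH].
    rewrite !big_nil.
    have -> : (fun h : R => h^-1 * (f (t0 + h *: 0) - f t0)) = cst 0.
      by apply/funext => h; rewrite scaler0 addr0 subrr mulr0.
    exact: cvg_cst.
  rewrite !big_cons; set w := \sum_(_ <- s) _ *: _.
  have -> : (fun h : R => h^-1 * (f (t0 + h *: (v 0 j *: delta_mx 0 j + w)) - f t0)) =
    (fun h => h^-1 * (f (t0 + h *: (v 0 j *: delta_mx 0 j + w)) - f (t0 + h *: w)) +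
              h^-1 * (f (t0 + h *: w) - f t0)).
    by apply/funext => h; rewrite -mulrDr addrA subrK.
  exact: cvgD (partial_increment _ _ _) IH.
have := H (index_enum 'I_k); rewrite -row_sum_delta => L.
have E : (fun h => h^-1 *: ((f \o shift t0) (h *: v) - f t0)) =
         (fun h => h^-1 * (f (t0 + h *: v) - f t0)).
  by apply/funext => h /=; rewrite [h *: v + t0]addrC.
apply: DeriveDef; rewrite /derivable /derive E; first by apply/cvg_ex; eexists; exact: L.
by apply/cvg_lim => //.
Qed.

Lemma Ck_on_sub k (W : set 'rV[R]_k) (f : 'rV[R]_k -> R) :
  Ck_on W 2 f -> [/\ forall t, W t -> {for t, continuous f},
    forall t j, W t -> is_derive t (delta_mx 0 j) f (partial j f t),
    forall t j, W t -> {for t, continuous (partial j f)},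
    forall t i j, W t -> is_derive t (delta_mx 0 i) (partial j f) (partial i (partial j f) t) &
    forall t i j, W t -> {for t, continuous (partial i (partial j f))}].
Proof.
move=> [h0 /= H]; split=> [//|t j Wt|t j Wt|t i j Wt|t i j Wt];
  have [h1 [h2 h3]] := H j; [exact/derivableP/h1|exact: h2| |]; have [h4 [h5 _]] := h3 i;
  [exact/derivableP/h4|exact: h5].
Qed.

Lemma max_gradient k (W : set 'rV[R]_k) (f : 'rV[R]_k -> R) (f1 : 'I_k -> 'rV[R]_k -> R)
    (t0 : 'rV[R]_k) i :
  open W -> W t0 -> (forall t j, W t -> is_derive t (delta_mx 0 j) f (f1 j t)) ->
  (forall t, W t -> f t <= f t0) -> f1 i t0 = 0.
Proof.
move=> Wo Wt0 fd fmax.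
have WW : \forall t \near t0, W t by exact: open_nbhs_nbhs.
apply: (interior_max_derivative (fd _ i Wt0)).
  by apply: filterS WW => t /fmax.
by apply: filterS WW => t Wt; have [] := fd _ i Wt.
Qed.

(** Both derivatives of s -> f (t0 + s v) come from [is_derive_partials], for which f1 and f2 must
    be continuous; [second_derivative_max] then applies. *)
Lemma max_hessian k (W : set 'rV[R]_k) (f : 'rV[R]_k -> R) (f1 : 'I_k -> 'rV[R]_k -> R)
    (f2 : 'I_k -> 'I_k -> 'rV[R]_k -> R) (t0 v : 'rV[R]_k) :
  open W -> W t0 ->
  (forall t j, W t -> is_derive t (delta_mx 0 j) f (f1 j t)) ->
  (forall t j, W t -> {for t, continuous (f1 j)}) ->
  (forall t i j, W t -> is_derive t (delta_mx 0 i) (f1 j) (f2 i j t)) ->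
  (forall t i j, W t -> {for t, continuous (f2 i j)}) ->
  (forall t, W t -> f t <= f t0) ->
  \sum_i \sum_j v 0 i * v 0 j * f2 i j t0 <= 0.
Proof.
move=> Wo Wt0 d1 c1 d2 c2 fmax.
have WW t : W t -> \forall t' \near t, W t' by move=> Wt; exact: open_nbhs_nbhs.
have D1 t : W t -> is_derive t v f (\sum_j v 0 j * f1 j t).
  move=> Wt; apply: is_derive_partials => j; last exact: c1.
  by apply: filterS (WW t Wt) => t' Wt'; exact: d1.
have WL : \forall s \near (0:R), W (t0 + s *: v) := cvg_line v (WW t0 Wt0).
apply: (@second_derivative_max _ (fun s : R => f (t0 + s *: v))
   (fun s => \sum_j v 0 j * f1 j (t0 + s *: v))).
- by apply: filterS WL => s Ws; apply: is_derive_line; exact: D1.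
- have D2 j : is_derive (0:R) 1 (fun s : R => f1 j (t0 + s *: v))
      (\sum_i v 0 i * f2 i j t0).
    apply: is_derive_line; rewrite scale0r addr0.
    apply: (@is_derive_partials _ (f1 j) (fun i => f2 i j)) => i; last exact: c2.
    by apply: filterS (WW t0 Wt0) => t' Wt'; exact: d2.
  have -> : (fun s : R => \sum_j v 0 j * f1 j (t0 + s *: v)) =
      \sum_j (v 0 j *: (fun s : R => f1 j (t0 + s *: v))).
    by apply/funext => s; rewrite fct_sumE.
  apply: is_derive_eq; rewrite exchange_big /=; apply: eq_bigr => j _.
  by rewrite scaler_sumr; apply: eq_bigr => i _; rewrite /GRing.scale /= mulrA [v 0 i * _]mulrC.
- by apply: filterS WL => s Ws; rewrite scale0r addr0; exact: fmax.
Qed.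

End Partials.

(** * Open images of injective immersions between equal dimensions *)

Section OpenImage.
Variable R : realType.

(** The norm on row vectors is the maximum norm, which is not differentiable; the squared Euclidean
    distance is. *)
Definition dist2 k (x y : 'rV[R]_k) : R := \sum_l (x 0 l - y 0 l) ^+ 2.

Lemma dist2_ge0 k (x y : 'rV[R]_k) : 0 <= dist2 x y.
Proof. by apply: sumr_ge0 => l _; exact: sqr_ge0. Qed.

Lemma dist2_eq0 k (x y : 'rV[R]_k) : dist2 x y = 0 -> x = y.
Proof.
move=> /eqP; rewrite psumr_eq0 => [/allP H|l _]; last exact: sqr_ge0.
apply/rowP => l; apply/eqP; rewrite -subr_eq0 -sqrf_eq0.
exact: (implyP (H l (mem_index_enum _))).
Qed.

(** The two sides differ by half the square of z - x + 2 (x - y). Hence a point z far from x is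
    further from y than x is, once y is close to x. *)
Lemma dist2_shift k (z x y : 'rV[R]_k) :
  2^-1 * dist2 z x - 2 * dist2 x y <= dist2 z y - dist2 x y.
Proof.
rewrite -subr_ge0 /dist2 !mulr_sumr -!sumrB; apply: sumr_ge0 => l _.
set a := z 0 l; set b := x 0 l; set c := y 0 l.
have -> : (a - c) ^+ 2 - (b - c) ^+ 2 - (2^-1 * (a - b) ^+ 2 - 2 * (b - c) ^+ 2) =
  2^-1 * (a - b + 2 * (b - c)) ^+ 2 by field.
by rewrite mulr_ge0 // sqr_ge0.
Qed.

(* Minimise |f t - y|^2 over a closed ball: for y close to f t0 the minimum is not on the
   sphere, by injectivity, so it is critical, and the invertible Jacobian forces f t = y. *)
Lemma open_image k (W : set 'rV[R]_k) (f : 'rV[R]_k -> 'rV[R]_k) (t0 : 'rV[R]_k) :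
  open W -> W t0 ->
  (forall t l, W t -> {for t, continuous (fun s => f s 0 l)}) ->
  (forall t l j, W t -> derivable (fun s => f s 0 l) t (delta_mx 0 j)) ->
  (forall t, W t -> row_free (tangent_mx f t)) ->
  (forall t t', W t -> W t' -> f t = f t' -> t = t') ->
  exists2 e, 0 < e & forall y, dist2 (f t0) y < e -> exists2 t, W t & f t = y.
Proof.
move=> Wo Wt0 fc fd frank finj.
have /nbhs_ballP[d /= d0 Hd] : nbhs t0 W by exact: open_nbhs_nbhs.
have d2 : 0 < d / 2 by rewrite divr_gt0.
pose B := closed_ball t0 (d / 2).
have BE : B = [set t | `|t0 - t| <= d / 2] by rewrite /B closed_ballE.
have BW t : B t -> W t.
  rewrite BE /= => tB; apply: Hd; rewrite -ball_normE /ball_ /=.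
  by apply: le_lt_trans tB _; lra.
have Bcpt : compact B.
  apply: bounded_closed_compact; last exact: closed_ball_closed.
  exists (`|t0| + d / 2); split; first exact: num_real.
  move=> M Mlt t; rewrite BE /= => tB; apply: le_trans (ltW Mlt).
  have -> : t = t0 - (t0 - t) by rewrite subKr.
  by apply: le_trans (ler_normB _ _) _; rewrite lerD2l.
have Bt0 : B t0 by exact: closed_ballxx.
have Qc y t : W t -> {for t, continuous (fun s => dist2 (f s) y)}.
  move=> Wt; rewrite /dist2.
  have -> : (fun s => \sum_l (f s 0 l - y 0 l) ^+ 2) =
     \sum_l ((fun s => f s 0 l) - cst (y 0 l)) ^+ 2.
    by apply/funext => s; rewrite fct_sumE.
  apply: (big_ind (fun g => {for t, continuous g})).
  - exact: cst_continuous.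
  - by move=> g h; exact: continuousD.
  - move=> l _.
    have c1 : {for t, continuous ((fun s => f s 0 l) - cst (y 0 l))}.
      by apply: continuousB; [exact: fc|exact: cst_continuous].
    by rewrite expr2; exact: continuousM.
have Qcw y (A : set 'rV[R]_k) : (forall t, A t -> W t) ->
    {within A, continuous (fun s => dist2 (f s) y)}.
  by move=> AW; apply: continuous_in_subspaceT => t; rewrite inE => /AW; exact: Qc.
pose S := [set t | `|t0 - t| = d / 2].
have SB t : S t -> B t by rewrite BE /S /= => ->.
have Scpt : compact S.
  have SBS : S = B `&` S by apply/seteqP; split => [t St|t []//]; split => //; exact: SB.
  rewrite SBS.
  apply: compact_closedI => //.
  have -> : S = (fun t => `|t0 - t|) @^-1` [set d / 2] by [].
  apply: preimage_closed; last exact: closed_eq.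
  by move=> t _; apply: (@cvg_norm _ _ _ _ (nbhs_filter t)); apply: cvgB; [exact: cvg_cst|exact: cvg_id].
have [e e0 He] : exists2 e, 0 < e & forall t, S t -> e <= dist2 (f t) (f t0).
  (* The sphere is empty when k = 0. *)
  have [S0|/set0P S0] := eqVneq S set0.
    by exists 1 => // t; rewrite S0.
  have [c /set_mem cS cmin] := compact_EVT_min S0 Scpt (Qcw (f t0) _ (fun t St => BW _ (SB _ St))).
  exists (dist2 (f c) (f t0)); last by move=> t St; apply: cmin; exact: mem_set.
  rewrite lt_neqAle dist2_ge0 andbT eq_sym; apply/eqP => /dist2_eq0 fE.
  have ct0 := finj _ _ (BW _ (SB _ cS)) Wt0 fE.
  by move: cS; rewrite /S /= ct0 subrr normr0 => Z; move: d2; rewrite -Z ltxx.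
(* On the sphere [dist2_shift] gives dist2 (f c) y - dist2 (f t0) y >= e / 2 - 2 dist2 (f t0) y,
   which is positive when dist2 (f t0) y < e / 4. *)
exists (e / 4); first by rewrite divr_gt0.
move=> y yB.
have [c /set_mem cB cmin] := compact_EVT_min (ex_intro _ t0 Bt0) Bcpt (Qcw y _ BW).
have Wc := BW _ cB.
exists c => //.
have cint : `|t0 - c| < d / 2.
  have cB' : `|t0 - c| <= d / 2 by have : B c := cB; rewrite BE.
  rewrite lt_neqAle cB' andbT.
  apply/eqP => cS; have := He _ cS.
  have := cmin _ (mem_set Bt0); have := dist2_shift (f c) (f t0) y; lra.
pose V := ball t0 (d / 2).
have VE : V = [set t | `|t0 - t| < d / 2] by rewrite /V -ball_normE.
have Vc : V c by rewrite VE.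
have VB t : V t -> B t by rewrite VE BE /= => /ltW.
have dQ j t : W t -> is_derive t (delta_mx 0 j) (fun s => dist2 (f s) y)
    (\sum_l 2 * (f t 0 l - y 0 l) * partial j (fun s => f s 0 l) t).
  move=> Wt; rewrite /dist2.
  have -> : (fun s => \sum_l (f s 0 l - y 0 l) ^+ 2) =
     \sum_l ((fun s => f s 0 l) - cst (y 0 l)) ^+ 2.
    by apply/funext => s; rewrite fct_sumE.
  have D l : is_derive t (delta_mx 0 j) (fun s => f s 0 l) (partial j (fun s => f s 0 l) t).
    exact: derivableP (fd t l j Wt).
  apply: is_derive_eq; apply: eq_bigr => l _.
  by rewrite subr0 /GRing.scale /= expr1 mulr_natl.
have crit j : \sum_l 2 * (f c 0 l - y 0 l) * partial j (fun s => f s 0 l) c = 0.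
  have nV : \forall t \near c, V t by apply: open_nbhs_nbhs; split => //; exact: ball_open.
  apply/eqP; rewrite -oppr_eq0; apply/eqP.
  have dN : is_derive c (delta_mx 0 j) (- (fun s => dist2 (f s) y))
     (- \sum_l 2 * (f c 0 l - y 0 l) * partial j (fun s => f s 0 l) c).
    by apply: is_deriveN; exact: dQ.
  apply: (interior_max_derivative dN).
    apply: filterS nV => t /VB Bt; rewrite /GRing.opp /= lerN2.
    by apply: cmin; exact: mem_set.
  by apply: filterS nV => t /VB/BW Wt; apply: derivableN; have [] := dQ j t Wt.
(* Up to the factor 2 this row is the gradient of the squared distance to y at the interior minimum
   c. *)
have : (f c - y) *m (tangent_mx f c)^T = 0.
  apply/rowP => j; rewrite !mxE; apply: (@mulfI _ 2); first by rewrite pnatr_eq0.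
  rewrite mulr0 -[RHS](crit j) mulr_sumr; apply: eq_bigr => l _.
  by rewrite !mxE mulrA.
have U : tangent_mx f c \in unitmx by rewrite -row_free_unit; exact: frank.
move=> /(congr1 (mulmx^~ (invmx (tangent_mx f c)^T))).
by rewrite mulmxK ?unitmx_tr // mul0mx => /eqP; rewrite subr_eq0 => /eqP.
Qed.

End OpenImage.

(** * The profile functions *)

Section Profile.
Variable R : realType.

Lemma is_derive_inj (V W : normedModType R) (f : V -> W) (x v : V) (d d' : W) :
  is_derive x v f d -> is_derive x v f d' -> d = d'.
Proof. by move=> h h'; rewrite -(@derive_val _ _ _ _ _ _ _ h) (@derive_val _ _ _ _ _ _ _ h'). Qed.

(** All four facts are properties of the smooth extension F, with f1 = F', restricted to the
    half-line. *)
Lemma smooth_halfline_derive (f : R -> R) : smooth_halfline f ->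
  exists f1 : R -> R, [/\ f1 r @[r --> (0:R)^'+] --> f1 0,
    f r @[r --> (0:R)^'+] --> f 0,
    r^-1 * (f r - f 0) @[r --> (0:R)^'+] --> f1 0 &
    forall r : R, 0 < r -> is_derive r 1 f (f1 r)].
Proof.
case=> F [Fd Ff].
have F0 r : derivable F r 1 by exact: (Fd 0%N).
have F1 r : derivable F^`()%classic r 1 by have := Fd 1%N r; rewrite derive1n1.
have toR (g : R -> R) (l : R) : g @ (0:R) --> l -> g r @[r --> (0:R)^'+] --> l.
  by move=> /cvg_at_right_filter.
have Er : \forall r \near (0:R)^'+, f r = F r.
  by near=> r; apply: Ff; apply: ltW; near: r; exact: nbhs_right_gt.
have f0 : f 0 = F 0 by exact: Ff.
exists F^`()%classic; split.
- apply: toR; apply: differentiable_continuous; exact/derivable1_diffP.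
- have : F r @[r --> (0:R)^'+] --> F 0.
    by apply: toR; apply: differentiable_continuous; exact/derivable1_diffP.
  rewrite f0; apply: cvg_trans; apply: near_eq_cvg.
  by apply: filterS Er => r ->.
- have D : h^-1 *: (F (h *: 1 + 0) - F 0) @[h --> (0:R)^'] --> F^`()%classic 0.
    by rewrite derive1E; exact: F0.
  have : h^-1 *: (F (h *: 1 + 0) - F 0) @[h --> (0:R)^'+] --> F^`()%classic 0.
    apply: cvg_trans D; apply: cvg_app.
    by apply: within_subset => r /=; rewrite lt_neqAle eq_sym => /andP[].
  apply: cvg_trans; apply: near_eq_cvg.
  apply: filterS Er => r Er; rewrite f0 Er addr0.
  by rewrite [_%:A]mulr1.
- move=> r r0; have D := derivableP (F0 r); rewrite -derive1E in D.
  apply: near_eq_is_derive D; near=> s; apply/esym/Ff/ltW.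
  by near: s; exact: lt_nbhsr.
Unshelve. all: by end_near. Qed.

Variables (m : R) (a b c : R -> R).
Hypotheses (hm : 0 < m) (habc : AH_profile m a b c).

Lemma profile_nonzero r : 0 < r -> [/\ a r != 0, b r != 0 & c r != 0].
Proof.
by move=> /(profile_sign habc)[a0 b0 c0]; split; [rewrite gt_eqF|rewrite lt_eqF|rewrite gt_eqF].
Qed.

(* Since (b + c - a)(0) = 0, the three ODEs become algebraic equations for a'(0), b'(0), c'(0)
   in the limit r -> 0. *)
Lemma profile_asymptotics :
  [/\ a r @[r --> (0:R)^'+] --> 0, b r @[r --> (0:R)^'+] --> - m &
      c r @[r --> (0:R)^'+] --> m] /\
  [/\ r^-1 * a r @[r --> (0:R)^'+] --> (2:R),
      r^-1 * (b r + m) @[r --> (0:R)^'+] --> (2^-1:R) &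
      r^-1 * (c r - m) @[r --> (0:R)^'+] --> (2^-1:R)].
Proof.
have [sa sb sc] := profile_smooth habc.
have [a0 b0 c0] := profile_init habc.
have [a1 []] := smooth_halfline_derive sa; rewrite a0 => a1c ac a1q a1d.
have [b1 []] := smooth_halfline_derive sb; rewrite b0 opprK => b1c bc b1q b1d.
have [c1 []] := smooth_halfline_derive sc; rewrite c0 => c1c cc c1q c1d.
have a1q' : r^-1 * a r @[r --> (0:R)^'+] --> a1 0.
  by move: a1q; under eq_fun do rewrite subr0.
have m0 : m != 0 by rewrite gt_eqF.
have pos : \forall r \near (0:R)^'+, 0 < r by exact: nbhs_right_gt.
have uniq (f g : R -> R) (l l' : R) : f r @[r --> (0:R)^'+] --> l ->
    g r @[r --> (0:R)^'+] --> l' -> (forall r, 0 < r -> f r = g r) -> l = l'.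
  move=> fl gl fg; apply: (cvg_unique _ fl) => //; apply: cvg_trans gl.
  by apply: near_eq_cvg; apply: filterS pos => r /fg.
have q : r^-1 * (b r + c r - a r) @[r --> (0:R)^'+] --> b1 0 + c1 0 - a1 0.
  have -> : (fun r => r^-1 * (b r + c r - a r)) =
      (fun r => r^-1 * (b r + m) + r^-1 * (c r - m) - r^-1 * a r).
    by apply/funext => r; ring.
  exact: cvgB (cvgD b1q c1q) a1q'.
have Ea : a1 0 * (2 * - m * m) = 0 ^+ 2 - (- m - m) ^+ 2.
  apply: (uniq (fun r => a1 r * (2 * b r * c r)) (fun r => a r ^+ 2 - (b r - c r) ^+ 2)).
  - by apply: cvgM a1c _; apply: cvgM cc; apply: cvgM bc; exact: cvg_cst.
  - by apply: cvgB; rewrite !expr2; [exact: cvgM|apply: cvgM; exact: cvgB].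
  - move=> r r0; have [_ bn cn] := profile_nonzero r0.
    rewrite (is_derive_inj (a1d _ r0) (profile_ode_a habc r0)) divfK //.
    by rewrite !mulf_neq0 ?pnatr_eq0.
have A1 : a1 0 = 2.
  apply: (@mulIf _ (2 * - m * m)); first by rewrite !mulf_neq0 ?pnatr_eq0 ?oppr_eq0.
  by rewrite Ea; ring.
(* The numerator b^2 - (c - a)^2 factors as (b - c + a) (b + c - a). Its second factor and the a in
   the denominator both vanish at 0, so each is divided by r before the limit. *)
have Eb : b1 0 * (2 * m * a1 0) = (- m - m + 0) * (b1 0 + c1 0 - a1 0).
  apply: (uniq (fun r => b1 r * (2 * c r * (r^-1 * a r)))
    (fun r => (b r - c r + a r) * (r^-1 * (b r + c r - a r)))).
  - by apply: cvgM b1c _; apply: cvgM a1q'; apply: cvgM cc; exact: cvg_cst.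
  - by apply: cvgM q; apply: cvgD ac; exact: cvgB.
  - move=> r r0; have [an bn cn] := profile_nonzero r0.
    rewrite (is_derive_inj (b1d _ r0) (profile_ode_b habc r0)).
    by field; rewrite an cn gt_eqF.
have Ec : c1 0 * (2 * a1 0 * - m) = (m - 0 + - m) * 0 + (m + 0 - - m) * (b1 0 + c1 0 - a1 0).
  rewrite mulr0 add0r.
  apply: (uniq (fun r => c1 r * (2 * (r^-1 * a r) * b r))
    (fun r => (c r + a r - b r) * (r^-1 * (b r + c r - a r)))).
  - by apply: cvgM c1c _; apply: cvgM bc; apply: cvgM a1q'; exact: cvg_cst.
  - by apply: cvgM q; apply: cvgB bc; exact: cvgD.
  - move=> r r0; have [an bn cn] := profile_nonzero r0.
    rewrite (is_derive_inj (c1d _ r0) (profile_ode_c habc r0)).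
    by field; rewrite an bn gt_eqF.
rewrite A1 in Eb Ec.
(* With a'(0) = 2 the two limits say 4 m b'(0) = 4 m c'(0) = - 2 m (b'(0) + c'(0) - 2), so both
   derivatives are 1/2. *)
have BC : b1 0 = c1 0 by apply: (mulfI m0); lra.
have B1 : b1 0 = 2^-1.
  by apply: (mulfI m0); rewrite -BC in Eb; lra.
split; first by split.
by split; [rewrite -A1|rewrite -B1|rewrite -B1 BC].
Qed.

(** The initial value is - 2 m. Where c = a + b, the numerators of a' and b' vanish and c' = 2, so
    the barrier derivative is - 2. *)
Lemma profile_ac_lt r : 0 < r -> a r + b r - c r < 0.
Proof.
move: r; apply: (@negative_barrier R (fun r => a r + b r - c r) (fun r =>
   (a r ^+ 2 - (b r - c r) ^+ 2) / (2 * b r * c r) +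
   (b r ^+ 2 - (c r - a r) ^+ 2) / (2 * c r * a r) -
   (c r ^+ 2 - (a r - b r) ^+ 2) / (2 * a r * b r))).
- have [[a0 b0 c0] _] := profile_asymptotics.
  have L : a r + b r - c r @[r --> (0:R)^'+] --> 0 + - m - m by exact: cvgB (cvgD a0 b0) c0.
  have N : 0 + - m - m < 0 by move: hm; lra.
  exact: (cvgr_lt _ L _ N).
- move=> r r0; have ha := profile_ode_a habc r0; have hb := profile_ode_b habc r0.
  have hc := profile_ode_c habc r0.
  exact: is_deriveB (is_deriveD ha hb) hc.
- move=> r r0 /= h; have [a0 b0 c0] := profile_sign habc r0.
  have ec : c r = a r + b r by move: h; lra.
  have [an bn cn] := profile_nonzero r0.
  have -> : (a r ^+ 2 - (b r - c r) ^+ 2) / (2 * b r * c r) +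
   (b r ^+ 2 - (c r - a r) ^+ 2) / (2 * c r * a r) -
   (c r ^+ 2 - (a r - b r) ^+ 2) / (2 * a r * b r) = - 2.
    by rewrite ec in cn *; field; rewrite an bn cn.
  by rewrite oppr_lt0.
Qed.

(** Here the barrier function vanishes at 0, and its negativity near 0 comes from the slope 1/2 +
    1/2 - 2 = - 1. Where a = b + c, b' = c' = 0 and a' = 2. *)
Lemma profile_bc_lt r : 0 < r -> b r + c r - a r < 0.
Proof.
move: r; apply: (@negative_barrier R (fun r => b r + c r - a r) (fun r =>
   (b r ^+ 2 - (c r - a r) ^+ 2) / (2 * c r * a r) +
   (c r ^+ 2 - (a r - b r) ^+ 2) / (2 * a r * b r) -
   (a r ^+ 2 - (b r - c r) ^+ 2) / (2 * b r * c r))).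
- have [_ [a1 b1 c1]] := profile_asymptotics.
  have L : r^-1 * (b r + m) + r^-1 * (c r - m) - r^-1 * a r @[r --> (0:R)^'+]
    --> (2^-1 + 2^-1 - 2 : R) by exact: cvgB (cvgD b1 c1) a1.
  have M : (2^-1 + 2^-1 - 2 : R) < 0 by lra.
  have N : \forall r \near (0:R)^'+, r^-1 * (b r + m) + r^-1 * (c r - m) - r^-1 * a r < 0.
    exact: (cvgr_lt _ L _ M).
  near=> r; have r0 : 0 < r by near: r; exact: nbhs_right_gt.
  have : r^-1 * (b r + m) + r^-1 * (c r - m) - r^-1 * a r < 0 by near: r.
  have -> : r^-1 * (b r + m) + r^-1 * (c r - m) - r^-1 * a r = r^-1 * (b r + c r - a r) by ring.
  by rewrite pmulr_rlt0 // invr_gt0.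
- move=> r r0; have ha := profile_ode_a habc r0; have hb := profile_ode_b habc r0.
  have hc := profile_ode_c habc r0.
  exact: is_deriveB (is_deriveD hb hc) ha.
- move=> r r0 /= h; have [a0 b0 c0] := profile_sign habc r0.
  have ec : a r = b r + c r by move: h; lra.
  have [an bn cn] := profile_nonzero r0.
  have -> : (b r ^+ 2 - (c r - a r) ^+ 2) / (2 * c r * a r) +
   (c r ^+ 2 - (a r - b r) ^+ 2) / (2 * a r * b r) -
   (a r ^+ 2 - (b r - c r) ^+ 2) / (2 * b r * c r) = - 2.
    by rewrite ec in an *; field; rewrite an bn cn.
  by rewrite oppr_lt0.
Unshelve. all: by end_near. Qed.

End Profile.

(** * The maximum principle for minimal submanifolds *)

Section Trace.
Variable R : realType.

Lemma row_sqr_eq0 n (v : 'rV[R]_n) : v *m v^T = 0 -> v = 0.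
Proof.
move=> /matrixP /(_ 0 0); rewrite !mxE => h; apply: dist2_eq0.
by rewrite -h /dist2; apply: eq_bigr => l _; rewrite !mxE subr0 expr2.
Qed.

Lemma gram_unit k n (S : 'M[R]_(k, n)) : row_free S -> S *m S^T \in unitmx.
Proof.
move=> Sf; rewrite -row_free_unit; apply: inj_row_free => v vS.
apply/eqP; rewrite -(mulmx_free_eq0 _ Sf); apply/eqP/row_sqr_eq0.
by rewrite trmx_mul mulmxA -(mulmxA v) vS mul0mx.
Qed.

Lemma gram_inv_sym k n (S : 'M[R]_(k, n)) :
  (invmx (S *m S^T))^T = invmx (S *m S^T).
Proof. by rewrite trmx_inv trmx_mul trmxK. Qed.

(** The orthogonal projector onto the row space of S. *)
Definition proj_row k n (S : 'M[R]_(k, n)) := S^T *m invmx (S *m S^T) *m S.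

Lemma proj_row_idem k n (S : 'M[R]_(k, n)) : row_free S ->
  proj_row S *m proj_row S = proj_row S.
Proof.
move=> /gram_unit U; rewrite /proj_row; set P := invmx _.
have PP : P *m (S *m S^T) = 1%:M by rewrite mulVmx.
transitivity (S^T *m (P *m (S *m S^T)) *m P *m S); first by rewrite !mulmxA.
by rewrite PP mulmx1.
Qed.

Lemma proj_row_sym k n (S : 'M[R]_(k, n)) : (proj_row S)^T = proj_row S.
Proof. by rewrite /proj_row !trmx_mul trmxK gram_inv_sym mulmxA. Qed.

(** A symmetric idempotent has P_ll equal to the sum over q of P_lq^2, which is at least P_ll^2. *)
Lemma proj_row_diag k n (S : 'M[R]_(k, n)) l : row_free S ->
  0 <= proj_row S l l <= 1.
Proof.
move=> Sf; have E : proj_row S l l = \sum_q proj_row S l q ^+ 2.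
  rewrite -{1}(proj_row_idem Sf) mxE; apply: eq_bigr => q _.
  by rewrite expr2; congr (_ * _); rewrite -[in LHS](proj_row_sym S) mxE.
have H : proj_row S l l ^+ 2 <= proj_row S l l.
  rewrite [leRHS]E (bigD1 l) //= lerDl; apply: sumr_ge0 => q _; exact: sqr_ge0.
have P0 : 0 <= proj_row S l l by rewrite E; apply: sumr_ge0 => q _; exact: sqr_ge0.
rewrite P0 /= leNgt; apply/negP => gt1.
have : proj_row S l l * 1 < proj_row S l l * proj_row S l l.
  by rewrite ltr_pM2l // (lt_trans ltr01).
by rewrite mulr1 -expr2 ltNge H.
Qed.

Lemma proj_row_trace k n (S : 'M[R]_(k, n)) : row_free S ->
  \sum_l proj_row S l l = k%:R.
Proof.
move=> /gram_unit U; rewrite -/(mxtrace _) /proj_row mxtrace_mulC mulmxA mulmxV //.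
exact: mxtrace1.
Qed.

Lemma sum4 (V : nmodType) (F : 'I_4 -> V) :
  \sum_(i < 4) F i = F 0 + F 1 + F 2%:R + F 3%:R.
Proof.
rewrite !big_ord_recr big_ord0 /= add0r.
by congr (F _ + F _ + F _ + F _); apply: val_inj.
Qed.

(** The trace is the sum of lam l times w_l, where w_l, the diagonal of the projector onto the
    tangent space, lies in [0, 1], sums to k and vanishes at index 0. For k = 3 the other weights
    are all 1. *)
Lemma two_convex_trace k (S : 'M[R]_(k, 4)) (lam : 'I_4 -> R) :
  k = 2%N \/ k = 3%N -> row_free S -> (forall i, S i 0 = 0) ->
  0 < lam 1 + lam 2%:R -> 0 < lam 1 + lam 3%:R -> 0 < lam 2%:R + lam 3%:R ->
  0 < \sum_i \sum_j invmx (S *m S^T) i j * \sum_l lam l * S i l * S j l.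
Proof.
move=> k23 Sf S0 l12 l13 l23.
have -> : \sum_i \sum_j invmx (S *m S^T) i j * \sum_l lam l * S i l * S j l =
    \sum_l lam l * proj_row S l l.
  under [RHS]eq_bigr => l _.
    rewrite /proj_row mxE mulr_sumr.
    under eq_bigr => i _ do rewrite mxE mulr_suml mulr_sumr.
    over.
  rewrite [RHS]exchange_big /= exchange_big /=; apply: eq_bigr => i _.
  rewrite [RHS]exchange_big /=; apply: eq_bigr => j _; rewrite mulr_sumr.
  by apply: eq_bigr => l _; rewrite !mxE; ring.
have w0 : proj_row S 0 0 = 0.
  by rewrite /proj_row mxE big1 // => j _; rewrite S0 mulr0.
have W l := proj_row_diag l Sf; have := proj_row_trace Sf.
move: (W 1) (W 2%:R) (W 3%:R); rewrite !sum4 w0 mulr0 !add0r.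
set w1 := proj_row S 1 1; set w2 := proj_row S 2%:R 2%:R; set w3 := proj_row S 3%:R 3%:R.
move=> /andP[a0 a1] /andP[b0 b1] /andP[c0 c1] ws.
case: k23 => kE; rewrite kE in ws; last first.
  have -> : w1 = 1 by lra.
  have -> : w2 = 1 by lra.
  have -> : w3 = 1 by lra.
  lra.
(* For k = 2 the weights sum to 2, so lam 1 appears on the right with coefficient (1 - w3) + (1 -
   w2) = w1, and likewise for the other two. *)
have -> : lam 1 * w1 + lam 2%:R * w2 + lam 3%:R * w3 =
   (1 - w3) * (lam 1 + lam 2%:R) + (1 - w2) * (lam 1 + lam 3%:R) + (1 - w1) * (lam 2%:R + lam 3%:R).
  have -> : w1 = 2 - w2 - w3 by lra.
  ring.
have p1 : 0 <= (1 - w3) * (lam 1 + lam 2%:R) by rewrite mulr_ge0 ?subr_ge0 // ltW.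
have p2 : 0 <= (1 - w2) * (lam 1 + lam 3%:R) by rewrite mulr_ge0 ?subr_ge0 // ltW.
have p3 : 0 <= (1 - w1) * (lam 2%:R + lam 3%:R) by rewrite mulr_ge0 ?subr_ge0 // ltW.
(* The three terms are nonnegative and cannot all vanish: w1 = w2 = 1 forces w3 = 0, and then the
   first term is lam 1 + lam 2. *)
have [w11|w11] := eqVneq w1 1; last first.
  have : 0 < (1 - w1) * (lam 2%:R + lam 3%:R).
    by rewrite mulr_gt0 // subr_gt0 lt_neqAle w11.
  by lra.
have [w21|w21] := eqVneq w2 1; last first.
  have : 0 < (1 - w2) * (lam 1 + lam 3%:R).
    by rewrite mulr_gt0 // subr_gt0 lt_neqAle w21.
  by lra.
have -> : w3 = 0 by lra.
rewrite w11 w21; lra.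
Qed.

(* With P = (S S^T)^-1 one has P = (P S)(P S)^T, so the sum is over the quadratic form
   at the columns of P S. *)
Lemma gram_inv_sum_le0 k n (S : 'M[R]_(k, n)) (h : 'I_k -> 'I_k -> R) : row_free S ->
  (forall v : 'rV[R]_k, \sum_i \sum_j v 0 i * v 0 j * h i j <= 0) ->
  \sum_i \sum_j invmx (S *m S^T) i j * h i j <= 0.
Proof.
move=> /gram_unit U H; set P := invmx _; pose Q := P *m S.
have PE i j : P i j = \sum_l Q i l * Q j l.
  have {1}-> : P = Q *m Q^T.
    rewrite /Q trmx_mul /P gram_inv_sym mulmxA -(mulmxA (invmx _) S).
    by rewrite mulVmx // mul1mx.
  by rewrite mxE; apply: eq_bigr => l _; rewrite !mxE.
have -> : \sum_i \sum_j P i j * h i j = \sum_l \sum_i \sum_j Q i l * Q j l * h i j.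
  under eq_bigr => i _ do under eq_bigr => j _ do rewrite PE mulr_suml.
  under eq_bigr => i _ do rewrite exchange_big /=.
  by rewrite exchange_big.
rewrite -oppr_ge0 -sumrN; apply: sumr_ge0 => l _; rewrite oppr_ge0.
have -> : \sum_i \sum_j Q i l * Q j l * h i j =
    \sum_i \sum_j (\row_i Q i l) 0 i * (\row_i Q i l) 0 j * h i j.
  by apply: eq_bigr => i _; apply: eq_bigr => j _; rewrite !mxE.
exact: H.
Qed.

End Trace.

(** * Mean curvature at a maximum of the squared distance *)

Section Maximum.
Variable R : realType.

(** The indicator of the two fibre coordinates lets sums over the fibre directions run over all four
    indices; [height2] is thus F = |u|^2. *)
Definition vert (i : 'I_4) : R := (1 < i)%N%:R.
Definition height2 (x : 'rV[R]_4) : R := \sum_l vert l * x 0 l ^+ 2.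

Lemma induced_metric_gram k n (g : 'rV[R]_n -> 'M[R]_n) (phi : 'rV[R]_k -> 'rV[R]_n) t
    (E : 'M[R]_n) : g (phi t) = E *m E^T ->
  induced_metric g phi t = (tangent_mx phi t *m E) *m (tangent_mx phi t *m E)^T.
Proof. by move=> gE; rewrite /induced_metric gE trmx_mul !mulmxA. Qed.

(** Projection to the normal space is linear, so vanishing mean curvature means that the trace of
    the covariant second derivatives is tangent. *)
Lemma mean_curvature_normal_part k n (g : 'rV[R]_n -> 'M[R]_n) (phi : 'rV[R]_k -> 'rV[R]_n) t :
  mean_curvature_vector g phi t = normal_part g phi t
    (\sum_i \sum_j invmx (induced_metric g phi t) i j *: covariant_second_derivative g phi t i j).
Proof.
rewrite /mean_curvature_vector /normal_part !mulmx_suml -sumrB; apply: eq_bigr => i _.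
rewrite !mulmx_suml -sumrB; apply: eq_bigr => j _.
by rewrite /second_fundamental_form /normal_part -!scalemxAl -scalerBr.
Qed.

(* At the maximum dF kills the tangent space, and by minimality also the trace of the covariant
   second derivatives of phi; the trace of the second derivatives of F o phi, which is <= 0,
   thus equals the trace of Hess F over the tangent space, which is > 0. *)
Lemma mean_curvature_max k (W : set 'rV[R]_k) (phi : 'rV[R]_k -> 'rV[R]_4) (t0 : 'rV[R]_k)
    (g : 'rV[R]_4 -> 'M[R]_4) (E : 'M[R]_4) (rho : R) (lam : 'I_4 -> R) :
  k = 2%N \/ k = 3%N -> open W -> W t0 ->
  (forall l, smooth_on W (fun t => phi t 0 l)) ->
  row_free (tangent_mx phi t0) ->
  (forall t, W t -> height2 (phi t) <= height2 (phi t0)) ->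
  g (phi t0) = E *m E^T -> E \in unitmx ->
  rho != 0 -> (forall l, 2 * vert l * phi t0 0 l = rho * E l 0) ->
  (forall p q, 2 * vert p * (p == q)%:R -
      \sum_l 2 * vert l * phi t0 0 l * christoffel g (phi t0) l p q =
    \sum_l lam l * E p l * E q l) ->
  0 < lam 1 + lam 2%:R -> 0 < lam 1 + lam 3%:R -> 0 < lam 2%:R + lam 3%:R ->
  mean_curvature_vector g phi t0 <> 0.
Proof.
move=> k23 Wo Wt0 phis Tfree hmax gE Eunit rho0 gradE hessE l12 l13 l23 H0.
have C l := Ck_on_sub (phis l 2%N).
pose f := fun t => height2 (phi t).
pose ph l := fun t => phi t 0 l.
pose f1 j t := \sum_l 2 * vert l * ph l t * partial j (ph l) t.
pose f2 i j t := \sum_l 2 * vert l *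
   (partial i (ph l) t * partial j (ph l) t + ph l t * partial i (partial j (ph l)) t).
have cont0 t l : W t -> {for t, continuous (ph l)} by have [c0 _ _ _ _] := C l; exact: c0.
have cont1 t l j : W t -> {for t, continuous (partial j (ph l))}.
  by have [_ _ c1 _ _] := C l; exact: c1.
have cont2 t l i j : W t -> {for t, continuous (partial i (partial j (ph l)))}.
  by have [_ _ _ _ c2] := C l; exact: c2.
have der1 t l j : W t -> is_derive t (delta_mx 0 j) (ph l) (partial j (ph l) t).
  by have [_ d1 _ _ _] := C l; exact: d1.
have der2 t l i j : W t ->
    is_derive t (delta_mx 0 i) (partial j (ph l)) (partial i (partial j (ph l)) t).
  by have [_ _ _ d2 _] := C l; exact: d2.
have fd1 t j : W t -> is_derive t (delta_mx 0 j) f (f1 j t).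
  move=> Wt; have D l := der1 t l j Wt.
  have -> : f = \sum_l (vert l *: (ph l ^+ 2)).
    by apply/funext => s; rewrite fct_sumE.
  apply: is_derive_eq; apply: eq_bigr => l _.
  by rewrite /GRing.scale /= expr1 mulr_natl; ring.
have fd2 t i j : W t -> is_derive t (delta_mx 0 i) (f1 j) (f2 i j t).
  move=> Wt; have D l := der1 t l i Wt; have D2 l := der2 t l i j Wt.
  have -> : f1 j = \sum_l ((2 * vert l) *: (ph l * partial j (ph l))).
    by apply/funext => s; rewrite fct_sumE; apply: eq_bigr => l _; rewrite /= -mulrA.
  apply: is_derive_eq; apply: eq_bigr => l _.
  by rewrite /GRing.scale /=; ring.
have fc1 t j : W t -> {for t, continuous (f1 j)}.
  move=> Wt; have -> : f1 j = \sum_l ((2 * vert l) *: (ph l * partial j (ph l))).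
    by apply/funext => s; rewrite fct_sumE; apply: eq_bigr => l _; rewrite /= -mulrA.
  apply: (big_ind (fun g => {for t, continuous g})).
  - exact: cst_continuous.
  - by move=> u v; exact: continuousD.
  - move=> l _; apply: continuousZl_tmp; apply: continuousM; [exact: cont0|exact: cont1].
have fc2 t i j : W t -> {for t, continuous (f2 i j)}.
  move=> Wt; have -> : f2 i j = \sum_l ((2 * vert l) *: (partial i (ph l) * partial j (ph l) +
       ph l * partial i (partial j (ph l)))).
    by apply/funext => s; rewrite fct_sumE.
  apply: (big_ind (fun g => {for t, continuous g})).
  - exact: cst_continuous.
  - by move=> u v; exact: continuousD.
  - move=> l _; apply: continuousZl_tmp; apply: continuousD; apply: continuousM;
    [exact: cont1|exact: cont1|exact: cont0|exact: cont2].
(* The rows of S are the coordinate tangent vectors expressed in the orthonormal coframe E. *)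
set T := tangent_mx phi t0 in Tfree *; pose S := T *m E.
have TE i l : T i l = partial i (ph l) t0 by rewrite mxE.
pose dF : 'I_4 -> R := fun l => 2 * vert l * phi t0 0 l.
have crit i : \sum_l dF l * T i l = 0.
  rewrite -[RHS](max_gradient i Wo Wt0 fd1 hmax); apply: eq_bigr => l _.
  by rewrite TE.
have Sfree : row_free S.
  apply: inj_row_free => v; rewrite /S mulmxA => /(congr1 (mulmx^~ (invmx E))).
  by rewrite mulmxK // mul0mx => /eqP; rewrite mulmx_free_eq0 // => /eqP.
(* Column 0 of E is dF / rho, and dF kills the rows of T at the maximum. *)
have S0 i : S i 0 = 0.
  apply: (mulfI rho0); rewrite mulr0 -[RHS](crit i) mxE mulr_sumr.
  by apply: eq_bigr => l _; rewrite /dF gradE; ring.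
have indE : induced_metric g phi t0 = S *m S^T by exact: induced_metric_gram.
set P := invmx (S *m S^T).
have le0 : \sum_i \sum_j P i j * f2 i j t0 <= 0.
  apply: gram_inv_sum_le0 => // v.
  exact: (@max_hessian _ _ W f f1 f2 t0 v Wo Wt0 fd1 fc1 fd2 fc2 hmax).
have gt0 := two_convex_trace k23 Sfree S0 l12 l13 l23.
(* Minimality makes V equal to its tangential part, a combination of the rows of T, and [crit] then
   gives dF(V) = 0. *)
move: H0; rewrite mean_curvature_normal_part indE -/P.
set V := \sum_i \sum_j _ => /eqP; rewrite subr_eq0 => /eqP VT.
have dV : \sum_l dF l * V 0 l = 0.
  rewrite VT; set al := _ *m invmx _.
  under eq_bigr => l _ do rewrite mxE mulr_sumr.
  rewrite exchange_big /= big1 // => i _.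
  rewrite (eq_bigr (fun l => al 0 i * (dF l * T i l))); first by rewrite -mulr_sumr crit mulr0.
  by move=> l _; ring.
(* The chain rule in covariant form: a second derivative of F o phi is Hess F on two tangent vectors
   plus dF of the covariant second derivative. The Christoffel terms of the two summands cancel. *)
have key i j : f2 i j t0 = \sum_l lam l * S i l * S j l +
    \sum_l dF l * covariant_second_derivative g phi t0 i j 0 l.
  have -> : \sum_l lam l * S i l * S j l =
      \sum_p \sum_q T i p * T j q * (2 * vert p * (p == q)%:R -
      \sum_l dF l * christoffel g (phi t0) l p q).
    under [RHS]eq_bigr => p _ do under eq_bigr => q _ do rewrite /dF hessE mulr_sumr.
    under [RHS]eq_bigr => p _ do rewrite exchange_big /=.
    rewrite exchange_big /=; apply: eq_bigr => l _.
    rewrite !mxE -mulrA mulr_suml mulr_sumr; apply: eq_bigr => p _.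
    rewrite !mulr_sumr; apply: eq_bigr => q _; ring.
  have -> : \sum_l dF l * covariant_second_derivative g phi t0 i j 0 l =
      \sum_l dF l * partial i (partial j (ph l)) t0 +
      \sum_p \sum_q T i p * T j q * \sum_l dF l * christoffel g (phi t0) l p q.
    have -> : \sum_p \sum_q T i p * T j q * \sum_l dF l * christoffel g (phi t0) l p q =
        \sum_l dF l * \sum_p \sum_q christoffel g (phi t0) l p q * T i p * T j q.
      under eq_bigr => p _ do under eq_bigr => q _ do rewrite mulr_sumr.
      under eq_bigr => p _ do rewrite exchange_big /=.
      rewrite exchange_big /=; apply: eq_bigr => l _.
      rewrite mulr_sumr; apply: eq_bigr => p _; rewrite mulr_sumr; apply: eq_bigr => q _; ring.
    by rewrite -big_split /=; apply: eq_bigr => l _; rewrite mxE mulrDr.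
  rewrite addrCA -big_split /=.
  under [X in _ + X]eq_bigr => p _.
    rewrite -big_split /=.
    under eq_bigr => q _ do rewrite -mulrDr subrK.
    rewrite (bigD1 p) //= big1 => [|q qp]; last by rewrite eq_sym (negbTE qp) !mulr0.
    rewrite eqxx mulr1 addr0.
    over.
  rewrite -big_split /=; apply: eq_bigr => l _; rewrite !TE /dF /ph; ring.
have : \sum_i \sum_j P i j * f2 i j t0 =
    \sum_i \sum_j P i j * (\sum_l lam l * S i l * S j l) + \sum_l dF l * V 0 l.
  have -> : \sum_l dF l * V 0 l = \sum_i \sum_j P i j *
      \sum_l dF l * covariant_second_derivative g phi t0 i j 0 l.
    under [RHS]eq_bigr => i _ do under eq_bigr => j _ do rewrite mulr_sumr.
    under [RHS]eq_bigr => i _ do rewrite exchange_big /=.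
    rewrite [RHS]exchange_big /=; apply: eq_bigr => l _.
    rewrite /V summxE mulr_sumr; apply: eq_bigr => i _.
    rewrite summxE mulr_sumr; apply: eq_bigr => j _; rewrite !mxE; ring.
  rewrite -big_split /=; apply: eq_bigr => i _; rewrite -big_split /=.
  by apply: eq_bigr => j _; rewrite key mulrDr.
rewrite dV addr0 => Eq; move: le0; rewrite Eq leNgt => /negP; apply.
exact: gt0.
Qed.

End Maximum.

(** * The metric off the zero section in real coordinates *)

Section Forms.
Variable R : realType.
Local Notation C := R[i].
Implicit Types x v w : 'rV[R]_4.

Definition fiber_rad x : R := Num.sqrt (x 0 2%:R ^+ 2 + x 0 3%:R ^+ 2).
Definition conf_factor x : R := 1 + (x 0 0 ^+ 2 + x 0 1 ^+ 2).

Lemma fiber_coord_eq0 x : (fiber_coord x == 0) = (x 0 2%:R == 0) && (x 0 3%:R == 0).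
Proof. by rewrite eq_complex. Qed.

Lemma fiber_rad_ge0 x : 0 <= fiber_rad x. Proof. exact: sqrtr_ge0. Qed.

Lemma fiber_rad_sqr x : fiber_rad x ^+ 2 = x 0 2%:R ^+ 2 + x 0 3%:R ^+ 2.
Proof. by rewrite sqr_sqrtr // addr_ge0 // sqr_ge0. Qed.

Lemma fiber_rad_eq0 x : (fiber_rad x == 0) = (fiber_coord x == 0).
Proof.
rewrite -sqrf_eq0 fiber_rad_sqr paddr_eq0 ?sqr_ge0 // !sqrf_eq0.
by rewrite fiber_coord_eq0.
Qed.

Lemma fiber_rad_gt0 x : (0 < fiber_rad x) = (fiber_coord x != 0).
Proof. by rewrite lt0r fiber_rad_eq0 fiber_rad_ge0 andbT. Qed.

Lemma conf_factor_gt0 x : 0 < conf_factor x.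
Proof. by rewrite ltr_wpDr // addr_ge0 // sqr_ge0. Qed.

Lemma fiber_normE x : fiber_norm x = fiber_rad x.
Proof. by rewrite /fiber_norm normc_def. Qed.

Lemma natC n : (n%:R : C) = Complex n%:R 0.
Proof. by rewrite -(rmorph_nat (real_complex R)). Qed.

Lemma form_drE x v : fiber_coord x != 0 ->
  form_dr x v = (x 0 2%:R * v 0 2%:R + x 0 3%:R * v 0 3%:R) / fiber_rad x.
Proof.
move=> u0; have r0 : fiber_rad x != 0 by rewrite fiber_rad_eq0.
rewrite /form_dr fiber_normE /= -fiber_rad_sqr; field.
exact: r0.
Qed.

Lemma form_dpsiE x v : fiber_coord x != 0 ->
  form_dpsi x v = (x 0 2%:R * v 0 3%:R - x 0 3%:R * v 0 2%:R) / fiber_rad x ^+ 2.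
Proof.
move=> u0; have r0 : fiber_rad x != 0 by rewrite fiber_rad_eq0.
rewrite /form_dpsi /= -fiber_rad_sqr; field.
exact: r0.
Qed.

Lemma conf_factorC x : 1 + `|base_coord x| ^+ 2 = Complex (conf_factor x) 0.
Proof.
rewrite -add_Re2_Im2 (_ : (1 : C) = Complex 1 0) // /conf_factor; apply/eqP.
by rewrite eq_complex /= addr0 !eqxx.
Qed.

Lemma sigma1E x v : fiber_coord x != 0 ->
  sigma1 x v = 2^-1 * ((x 0 2%:R * v 0 3%:R - x 0 3%:R * v 0 2%:R) / fiber_rad x ^+ 2 +
     4 * (x 0 0 * v 0 1 - x 0 1 * v 0 0) / conf_factor x).
Proof.
move=> u0; rewrite /sigma1 form_dpsiE // conf_factorC (natC 2) /=.
congr (_ * (_ + _)); have c0 := conf_factor_gt0 x.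
rewrite expr0n /= addr0; field.
by rewrite gt_eqF.
Qed.

(** The number s2 + i s3 is the chosen value of e^{i psi/2}; the first three relations say that it
    has modulus 1 and square u / |u|. *)
Lemma sigma23E x : fiber_coord x != 0 -> exists s2 s3 : R,
  [/\ s2 ^+ 2 + s3 ^+ 2 = 1, s2 ^+ 2 - s3 ^+ 2 = x 0 2%:R / fiber_rad x,
     2 * (s2 * s3) = x 0 3%:R / fiber_rad x,
     forall v, sigma2 x v = 2 * (s2 * v 0 0 - s3 * v 0 1) / conf_factor x &
     forall v, sigma3 x v = 2 * (s2 * v 0 1 + s3 * v 0 0) / conf_factor x].
Proof.
move=> u0; have r0 : fiber_rad x != 0 by rewrite fiber_rad_eq0.
have := sqrtCK (fiber_coord x / `|fiber_coord x|).
rewrite /sigma2 /sigma3 conf_factorC (natC 2); case: (sqrtC _) => s2 s3.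
rewrite expr2 normc_def -/(fiber_rad x) => /eqP; rewrite eq_complex /= -/(fiber_rad x).
rewrite expr0n /= addr0 => /andP[/eqP e1 /eqP e2].
have E1 : s2 ^+ 2 - s3 ^+ 2 = x 0 2%:R / fiber_rad x.
  by rewrite !expr2 e1; field.
have E2 : 2 * (s2 * s3) = x 0 3%:R / fiber_rad x.
  have -> : 2 * (s2 * s3) = s2 * s3 + s3 * s2 by ring.
  by rewrite e2; field.
exists s2, s3; split => // [|v|v].
- have : (s2 ^+ 2 + s3 ^+ 2) ^+ 2 = 1.
    have -> : (s2 ^+ 2 + s3 ^+ 2) ^+ 2 = (s2 ^+ 2 - s3 ^+ 2) ^+ 2 + (2 * (s2 * s3)) ^+ 2 by ring.
    by rewrite E1 E2 !expr_div_n -mulrDl -fiber_rad_sqr mulfV // sqrf_eq0.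
  move=> /eqP; rewrite sqrf_eq1 => /orP[/eqP //|/eqP h].
  have : 0 <= s2 ^+ 2 + s3 ^+ 2 by rewrite addr_ge0 // sqr_ge0.
  by rewrite h; lra.
- have c0 := conf_factor_gt0 x; rewrite /= addr0; field.
  by rewrite gt_eqF.
- have c0 := conf_factor_gt0 x; rewrite /= addr0; field.
  by rewrite gt_eqF.
Qed.

(* The branch of [sqrtC] enters only through its square u / |u|. *)
Lemma sigma23_quad x v w (be ga : R) : fiber_coord x != 0 ->
  be * (sigma2 x v * sigma2 x w) + ga * (sigma3 x v * sigma3 x w) =
  4 / conf_factor x ^+ 2 * ((be + ga) / 2 * (v 0 0 * w 0 0 + v 0 1 * w 0 1) +
    (be - ga) / 2 / fiber_rad x * (x 0 2%:R * (v 0 0 * w 0 0 - v 0 1 * w 0 1)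
                           - x 0 3%:R * (v 0 0 * w 0 1 + v 0 1 * w 0 0))).
Proof.
move=> u0; have [s2 [s3 [e1 e2 e3 E2 E3]]] := sigma23E u0.
have c0 : conf_factor x != 0 by rewrite gt_eqF // conf_factor_gt0.
have r0 : fiber_rad x != 0 by rewrite fiber_rad_eq0.
have h2 : x 0 2%:R = fiber_rad x * (s2 ^+ 2 - s3 ^+ 2) by rewrite e2; field.
have h3 : x 0 3%:R = fiber_rad x * (2 * (s2 * s3)) by rewrite e3; field.
have hb : s2 ^+ 2 = 1 - s3 ^+ 2 by rewrite -e1 addrK.
rewrite !E2 !E3 h2 h3.
(* The identity holds only modulo s2^2 + s3^2 = 1. With that factor inserted both sides are
   homogeneous of degree 2 in s2, s3 and agree formally. *)
have -> : (be + ga) / 2 * (v 0 0 * w 0 0 + v 0 1 * w 0 1) =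
  (be + ga) / 2 * (s2 ^+ 2 + s3 ^+ 2) * (v 0 0 * w 0 0 + v 0 1 * w 0 1).
  by rewrite e1 mulr1.
by field; rewrite r0.
Qed.

End Forms.

(** * Metric coefficients and their derivative along the fibres *)

Section RadialDerivative.
Variable R : realType.
Implicit Types x v w : 'rV[R]_4.

Lemma is_derive_of_line (V W : normedModType R) (f : V -> W) (x v : V) (d : W) :
  is_derive (0:R) 1 (fun h : R => f (x + h *: v)) d -> is_derive x v f d.
Proof.
have E : (fun h => h^-1 *: (((fun h : R => f (x + h *: v)) \o shift 0) (h *: 1) -
            f (x + (0:R) *: v))) =
         (fun h => h^-1 *: ((f \o shift x) (h *: v) - f x)).
  apply/funext => h /=; rewrite scale0r !addr0; congr (_ *: (f _ - _)).
  by rewrite [h%:A]mulr1 addrC.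
by case=> df <-; apply: DeriveDef; rewrite /derivable /derive -E.
Qed.

Lemma is_derive_comp1 (V : normedModType R) (f : R -> R) (g : V -> R) (x v : V) (df dg : R) :
  is_derive (g x) 1 f df -> is_derive x v g dg -> is_derive x v (f \o g) (df * dg).
Proof.
move=> fd gd; apply: is_derive_of_line.
have h1 : is_derive (g (x + (0:R) *: v)) 1 f df by rewrite scale0r addr0.
have h2 : is_derive (0:R) 1 (fun h : R => g (x + h *: v)) dg.
  by apply: is_derive_line; rewrite scale0r addr0.
exact: (@is_derive1_comp _ f (fun h : R => g (x + h *: v)) _ _ _ h1 h2).
Qed.

(** These rules are restated with pointwise operations on real-valued functions, so that derivatives
    of long expressions can be assembled as nested terms. *)
Lemma is_derive_add (V : normedModType R) (f g : V -> R) (x v : V) (df dg : R) :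
  is_derive x v f df -> is_derive x v g dg -> is_derive x v (fun y => f y + g y) (df + dg).
Proof. exact: is_deriveD. Qed.

Lemma is_derive_sub (V : normedModType R) (f g : V -> R) (x v : V) (df dg : R) :
  is_derive x v f df -> is_derive x v g dg -> is_derive x v (fun y => f y - g y) (df - dg).
Proof. exact: is_deriveB. Qed.

Lemma is_derive_scale (V : normedModType R) (k : R) (f : V -> R) (x v : V) (df : R) :
  is_derive x v f df -> is_derive x v (fun y => k * f y) (k * df).
Proof. exact: is_deriveZ. Qed.

Lemma is_derive_mul (V : normedModType R) (f g : V -> R) (x v : V) (df dg : R) :
  is_derive x v f df -> is_derive x v g dg ->
  is_derive x v (fun y => f y * g y) (f x * dg + g x * df).
Proof. exact: is_deriveM. Qed.

Lemma is_derive_sqr (V : normedModType R) (f : V -> R) (x v : V) (df : R) :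
  is_derive x v f df -> is_derive x v (fun y => f y ^+ 2) (2 * f x * df).
Proof. by move=> D; apply: is_derive_eq (is_deriveX 2 D) _; rewrite /GRing.scale /= expr1. Qed.

Lemma is_derive_inv (V : normedModType R) (f : V -> R) (x v : V) (d : R) :
  f x != 0 -> is_derive x v f d ->
  is_derive x v (fun y => (f y)^-1) (- (f x) ^- 2 * d).
Proof.
move=> fx0 [fd <-]; apply: DeriveDef; first exact: derivableV.
by rewrite deriveV.
Qed.

Definition coordinate n (l : 'I_n) (y : 'rV[R]_n) : R := y 0 l.

Lemma is_derive_coordinate n (x v : 'rV[R]_n) l :
  is_derive x v (@coordinate n l) (v 0 l).
Proof.
apply: is_derive_of_line.
have -> : (fun h : R => coordinate l (x + h *: v)) = cst (x 0 l) + (fun h => h * v 0 l).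
  by apply/funext => h; rewrite /coordinate !mxE.
apply: is_derive_eq; rewrite /GRing.scale /= ?mulr1 ?mulr0 ?addr0 ?add0r //.
Qed.

Definition inv_rad (y : 'rV[R]_4) : R := (fiber_rad y)^-1.
Definition inv_conf (y : 'rV[R]_4) : R := (conf_factor y)^-1.

Variables a b c : R -> R.

(** The forms, as functions of the base point for a fixed vector, are rewritten without [sqrtC] and
    with ring operations on functions, to which the differentiation rules apply. [metric_formE]
    identifies them with the metric where u is nonzero. *)
Definition dr_entry v : 'rV[R]_4 -> R :=
  (v 0 2%:R *: @coordinate 4 2%:R + v 0 3%:R *: @coordinate 4 3%:R) * inv_rad.
Definition sigma1_entry v : 'rV[R]_4 -> R :=
  2^-1 *: ((v 0 3%:R *: @coordinate 4 2%:R - v 0 2%:R *: @coordinate 4 3%:R) * inv_rad ^+ 2 +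
    4 *: ((v 0 1 *: @coordinate 4 0 - v 0 0 *: @coordinate 4 1) * inv_conf)).
Definition sigma23_entry v w : 'rV[R]_4 -> R :=
  (4 *: inv_conf ^+ 2) *
  ((2^-1 * (v 0 0 * w 0 0 + v 0 1 * w 0 1)) *: ((b \o @fiber_rad R) ^+ 2 + (c \o @fiber_rad R) ^+ 2) +
   2^-1 *: (((b \o @fiber_rad R) ^+ 2 - (c \o @fiber_rad R) ^+ 2) *
     (((v 0 0 * w 0 0 - v 0 1 * w 0 1) *: @coordinate 4 2%:R
      - (v 0 0 * w 0 1 + v 0 1 * w 0 0) *: @coordinate 4 3%:R) * inv_rad))).
Definition metric_entry v w : 'rV[R]_4 -> R :=
  dr_entry v * dr_entry w + (a \o @fiber_rad R) ^+ 2 * (sigma1_entry v * sigma1_entry w) + sigma23_entry v w.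

Lemma dr_entryE x v : dr_entry v x = (v 0 2%:R * x 0 2%:R + v 0 3%:R * x 0 3%:R) * (fiber_rad x)^-1.
Proof. by []. Qed.

Lemma sigma1_entryE x v : sigma1_entry v x =
  2^-1 * ((v 0 3%:R * x 0 2%:R - v 0 2%:R * x 0 3%:R) * (fiber_rad x)^-1 ^+ 2 +
    4 * ((v 0 1 * x 0 0 - v 0 0 * x 0 1) * (conf_factor x)^-1)).
Proof. by []. Qed.

Lemma sigma23_entryE x v w : sigma23_entry v w x =
  4 * (conf_factor x)^-1 ^+ 2 *
  (2^-1 * (v 0 0 * w 0 0 + v 0 1 * w 0 1) * (b (fiber_rad x) ^+ 2 + c (fiber_rad x) ^+ 2) +
   2^-1 * ((b (fiber_rad x) ^+ 2 - c (fiber_rad x) ^+ 2) *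
     (((v 0 0 * w 0 0 - v 0 1 * w 0 1) * x 0 2%:R
      - (v 0 0 * w 0 1 + v 0 1 * w 0 0) * x 0 3%:R) * (fiber_rad x)^-1))).
Proof. by []. Qed.

Lemma metric_entryE x v w : metric_entry v w x =
  dr_entry v x * dr_entry w x + a (fiber_rad x) ^+ 2 * (sigma1_entry v x * sigma1_entry w x) + sigma23_entry v w x.
Proof. by []. Qed.

Lemma metric_formE x v w : fiber_coord x != 0 -> metric_form a b c x v w = metric_entry v w x.
Proof.
move=> u0; rewrite /metric_form fiber_normE -addrA sigma23_quad //.
rewrite !form_drE // !sigma1E // metric_entryE !dr_entryE !sigma1_entryE sigma23_entryE.
have c0 : conf_factor x != 0 by rewrite gt_eqF // conf_factor_gt0.
have r0 : fiber_rad x != 0 by rewrite fiber_rad_eq0.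
by field; rewrite c0 r0.
Qed.

(** At the point x, [fiber_part x] is the Euler field r d/dr of the fibres. On a constant vector v,
    [fiber_part v] is the derivative of that field along v. *)
Definition fiber_part v : 'rV[R]_4 := \row_l (vert R l * v 0 l).

Lemma vertE : [/\ vert R 0 = 0, vert R 1 = 0, vert R 2%:R = 1 & vert R 3%:R = 1].
Proof. by []. Qed.

Lemma fiber_partE v : [/\ fiber_part v 0 0 = 0, fiber_part v 0 1 = 0, fiber_part v 0 2%:R = v 0 2%:R
  & fiber_part v 0 3%:R = v 0 3%:R].
Proof. by have [v0 v1 v2 v3] := vertE; rewrite !mxE v0 v1 v2 v3 !mul0r !mul1r. Qed.

Lemma is_derive_fiber_rad x v : fiber_coord x != 0 ->
  is_derive x v (@fiber_rad R) ((x 0 2%:R * v 0 2%:R + x 0 3%:R * v 0 3%:R) / fiber_rad x).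
Proof.
move=> u0; have r0 : fiber_rad x != 0 by rewrite fiber_rad_eq0.
have D l := is_derive_coordinate x v l.
have D2 := is_derive_add (is_derive_sqr (D 2%:R)) (is_derive_sqr (D 3%:R)).
have D1 : is_derive (coordinate 2%:R x ^+ 2 + coordinate 3%:R x ^+ 2) 1 (@Num.sqrt R) (2 * fiber_rad x)^-1.
  apply: is_derive1_sqrt; rewrite -[X in 0 < X]/(x 0 2%:R ^+ 2 + x 0 3%:R ^+ 2) -fiber_rad_sqr.
  by rewrite exprn_gt0 // fiber_rad_gt0.
have H : is_derive x v (@fiber_rad R) _ :=
  @is_derive_comp1 _ _ (fun y : 'rV[R]_4 => coordinate 2%:R y ^+ 2 + coordinate 3%:R y ^+ 2) _ _ _ _ D1 D2.
apply: is_derive_eq H _; rewrite /coordinate.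
by field; exact: r0.
Qed.

Lemma is_derive_conf_factor x v :
  is_derive x v (@conf_factor R) (2 * (x 0 0 * v 0 0 + x 0 1 * v 0 1)).
Proof.
have D l := is_derive_coordinate x v l.
have H := is_derive_add (is_derive_cst (1:R) x v)
  (is_derive_add (is_derive_sqr (D 0)) (is_derive_sqr (D 1))).
by apply: is_derive_eq H _; rewrite /coordinate; ring.
Qed.

(** This is the Lie derivative of g along Y = r d/dr. It fixes dr and kills the sigmas, so L_Y g = 2
    dr^2 + 2 r (a a' sigma1^2 + b b' sigma2^2 + c c' sigma3^2). The last two terms are the brackets
    of Y with the constant fields v and w. *)
Lemma metric_entry_radial x v w (da db dc : R) : fiber_coord x != 0 ->
  is_derive (fiber_rad x) 1 a da -> is_derive (fiber_rad x) 1 b db -> is_derive (fiber_rad x) 1 c dc ->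
  is_derive x (fiber_part x) (metric_entry v w)
   (2 * (form_dr x v * form_dr x w) + 2 * fiber_rad x * (a (fiber_rad x) * da * (sigma1 x v * sigma1 x w) +
    b (fiber_rad x) * db * (sigma2 x v * sigma2 x w) + c (fiber_rad x) * dc * (sigma3 x v * sigma3 x w))
    - metric_entry (fiber_part v) w x - metric_entry v (fiber_part w) x).
Proof.
move=> u0 Da Db Dc.
have c0 : conf_factor x != 0 by rewrite gt_eqF // conf_factor_gt0.
have r0 : fiber_rad x != 0 by rewrite fiber_rad_eq0.
have [f0 f1 f2 f3] := fiber_partE x.
have D l : is_derive x (fiber_part x) (@coordinate 4 l) (fiber_part x 0 l) := is_derive_coordinate x (fiber_part x) l.
have D0 := D 0; have D1 := D 1; have D2 := D 2%:R; have D3 := D 3%:R.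
rewrite f0 in D0; rewrite f1 in D1; rewrite f2 in D2; rewrite f3 in D3.
have Dr : is_derive x (fiber_part x) (@fiber_rad R) (fiber_rad x).
  apply: is_derive_eq (is_derive_fiber_rad _ u0) _.
  by rewrite f2 f3 -!expr2 -fiber_rad_sqr expr2 mulfK.
have Dir : is_derive x (fiber_part x) inv_rad (- (fiber_rad x)^-1).
  apply: is_derive_eq (is_derive_inv r0 Dr) _; field.
  exact: r0.
have Dic : is_derive x (fiber_part x) inv_conf 0.
  apply: is_derive_eq (is_derive_inv c0 (is_derive_conf_factor x (fiber_part x))) _.
  by rewrite f0 f1 !mulr0 addr0 !mulr0.
have Dra := is_derive_comp1 Da Dr; have Drb := is_derive_comp1 Db Dr; have Drc := is_derive_comp1 Dc Dr.
(* Under scaling of u, [dr_entry] is homogeneous of degree 0, hence constant along the Euler field;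
   the fibre term of [sigma1_entry] below has degree - 1. *)
have Dd u : is_derive x (fiber_part x) (dr_entry u) 0.
  apply: is_derive_eq (is_derive_mul (is_derive_add (is_derive_scale (u 0 2%:R) D2)
    (is_derive_scale (u 0 3%:R) D3)) Dir) _.
  by rewrite /coordinate /inv_rad; field.
have Ds u : is_derive x (fiber_part x) (sigma1_entry u)
    (- (2^-1 * ((u 0 3%:R * x 0 2%:R - u 0 2%:R * x 0 3%:R) * (fiber_rad x)^-1 ^+ 2))).
  apply: is_derive_eq (is_derive_scale 2^-1 (is_derive_add (is_derive_mul (is_derive_sub
      (is_derive_scale (u 0 3%:R) D2) (is_derive_scale (u 0 2%:R) D3)) (is_derive_sqr Dir))
    (is_derive_scale 4 (is_derive_mul (is_derive_sub (is_derive_scale (u 0 1) D0)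
       (is_derive_scale (u 0 0) D1)) Dic)))) _.
  by rewrite /coordinate /inv_rad /inv_conf; field; rewrite r0 c0.
have D23 : is_derive x (fiber_part x) (sigma23_entry v w)
   (4 * (conf_factor x)^-1 ^+ 2 *
  (2^-1 * (v 0 0 * w 0 0 + v 0 1 * w 0 1) * (2 * fiber_rad x * (b (fiber_rad x) * db + c (fiber_rad x) * dc)) +
   2^-1 * (2 * fiber_rad x * (b (fiber_rad x) * db - c (fiber_rad x) * dc) *
     (((v 0 0 * w 0 0 - v 0 1 * w 0 1) * x 0 2%:R
      - (v 0 0 * w 0 1 + v 0 1 * w 0 0) * x 0 3%:R) * (fiber_rad x)^-1)))).
  have Db2 := is_derive_sqr Drb; have Dc2 := is_derive_sqr Drc.
  apply: is_derive_eq (is_derive_mul (is_derive_scale 4 (is_derive_sqr Dic))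
   (is_derive_add (is_derive_scale (2^-1 * (v 0 0 * w 0 0 + v 0 1 * w 0 1)) (is_derive_add Db2 Dc2))
    (is_derive_scale 2^-1 (is_derive_mul (is_derive_sub Db2 Dc2)
    (is_derive_mul (is_derive_sub (is_derive_scale (v 0 0 * w 0 0 - v 0 1 * w 0 1) D2)
       (is_derive_scale (v 0 0 * w 0 1 + v 0 1 * w 0 0) D3)) Dir))))) _.
  by rewrite /coordinate /inv_rad /inv_conf /=; field; rewrite r0 c0.
apply: is_derive_eq (is_derive_add (is_derive_add (is_derive_mul (Dd v) (Dd w))
   (is_derive_mul (is_derive_sqr Dra) (is_derive_mul (Ds v) (Ds w)))) D23) _.
rewrite -(addrA (a (fiber_rad x) * da * _)).
rewrite sigma23_quad // !form_drE // !sigma1E // !metric_entryE !dr_entryE !sigma1_entryE !sigma23_entryE /=.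
have [-> -> -> ->] := fiber_partE v; have [-> -> -> ->] := fiber_partE w.
by field; rewrite r0 c0.
Qed.
End RadialDerivative.

(** * The Hessian of the squared distance off the zero section *)

Section Hessian.
Variable R : realType.
Implicit Types x v w : 'rV[R]_4.

Lemma forall_ord4 (P : 'I_4 -> Prop) : P 0 -> P 1 -> P 2%:R -> P 3%:R -> forall i, P i.
Proof.
move=> p0 p1 p2 p3 [[|[|[|[|//]]]] i4].
- by move: p0; congr (P _); apply: val_inj.
- by move: p1; congr (P _); apply: val_inj.
- by move: p2; congr (P _); apply: val_inj.
- by move: p3; congr (P _); apply: val_inj.
Qed.

Lemma linear_form4 (f : 'rV[R]_4 -> R) (k0 k1 k2 k3 : R) :
  (forall v, f v = k0 * v 0 0 + k1 * v 0 1 + k2 * v 0 2%:R + k3 * v 0 3%:R) ->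
  forall v, f v = \sum_s v 0 s * f (delta_mx 0 s).
Proof.
move=> H v; rewrite sum4 !H !mxE /=; ring.
Qed.

Section Forms.
Variable x : 'rV[R]_4.
Hypothesis u0 : fiber_coord x != 0.

Lemma form_dr_sum v : form_dr x v = \sum_s v 0 s * form_dr x (delta_mx 0 s).
Proof.
apply: (@linear_form4 _ 0 0 (x 0 2%:R / fiber_rad x) (x 0 3%:R / fiber_rad x)) => w.
by rewrite form_drE //; ring.
Qed.

Lemma sigma1_sum v : sigma1 x v = \sum_s v 0 s * sigma1 x (delta_mx 0 s).
Proof.
apply: (@linear_form4 _ (- (2 * x 0 1 / conf_factor x)) (2 * x 0 0 / conf_factor x)
  (- (2^-1 * x 0 3%:R / fiber_rad x ^+ 2)) (2^-1 * x 0 2%:R / fiber_rad x ^+ 2)) => w.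
rewrite sigma1E //; field.
by rewrite fiber_rad_eq0 u0 gt_eqF // conf_factor_gt0.
Qed.

Lemma sigma2_sum v : sigma2 x v = \sum_s v 0 s * sigma2 x (delta_mx 0 s).
Proof.
have [s2 [s3 [_ _ _ E _]]] := sigma23E u0.
apply: (@linear_form4 _ (2 * s2 / conf_factor x) (- (2 * s3 / conf_factor x)) 0 0) => w.
by rewrite E; ring.
Qed.

Lemma sigma3_sum v : sigma3 x v = \sum_s v 0 s * sigma3 x (delta_mx 0 s).
Proof.
have [s2 [s3 [_ _ _ _ E]]] := sigma23E u0.
apply: (@linear_form4 _ (2 * s3 / conf_factor x) (2 * s2 / conf_factor x) 0 0) => w.
by rewrite E; ring.
Qed.

Variables a b c : R -> R.

Lemma metric_form_sum v w :
  metric_form a b c x v w = \sum_s v 0 s * metric_form a b c x (delta_mx 0 s) w.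
Proof.
rewrite /metric_form form_dr_sum sigma1_sum sigma2_sum sigma3_sum.
rewrite !mulr_suml !mulr_sumr -!big_split /=; apply: eq_bigr => s _; ring.
Qed.

Lemma metric_form_sym v w : metric_form a b c x v w = metric_form a b c x w v.
Proof. by rewrite /metric_form; ring. Qed.

Lemma metric_form_fib_delta p w :
  metric_form a b c x (fiber_part (delta_mx 0 p)) w = vert R p * metric_form a b c x (delta_mx 0 p) w.
Proof.
rewrite metric_form_sum (bigD1 p) //= !mxE !eqxx mulr1 big1 ?addr0 // => s sp.
by rewrite !mxE (negbTE sp) andbF mulr0 mul0r.
Qed.

(** The sigmas vanish on r d/dr, so only the dr term survives; r d/dr is therefore the gradient of F
    / 2. *)
Lemma metric_form_fib_self w :
  metric_form a b c x (fiber_part x) w = x 0 2%:R * w 0 2%:R + x 0 3%:R * w 0 3%:R.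
Proof.
have r0 : fiber_rad x != 0 by rewrite fiber_rad_eq0.
rewrite metric_formE // metric_entryE !dr_entryE !sigma1_entryE sigma23_entryE; have [-> -> -> ->] := fiber_partE x.
rewrite -!expr2 -fiber_rad_sqr.
by field; rewrite r0 gt_eqF // conf_factor_gt0.
Qed.

Definition coframe : 'M[R]_4 :=
  \matrix_(i, l) [:: form_dr x (delta_mx 0 i); a (fiber_rad x) * sigma1 x (delta_mx 0 i);
     b (fiber_rad x) * sigma2 x (delta_mx 0 i); c (fiber_rad x) * sigma3 x (delta_mx 0 i)]`_l.

Lemma coframeE i : [/\ coframe i 0 = form_dr x (delta_mx 0 i),
   coframe i 1 = a (fiber_rad x) * sigma1 x (delta_mx 0 i),
   coframe i 2%:R = b (fiber_rad x) * sigma2 x (delta_mx 0 i) &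
   coframe i 3%:R = c (fiber_rad x) * sigma3 x (delta_mx 0 i)].
Proof. by rewrite !mxE. Qed.

Lemma AH_metricE i j : AH_metric a b c x i j =
  metric_form a b c x (delta_mx 0 i) (delta_mx 0 j).
Proof. by rewrite mxE (negbTE u0). Qed.

Lemma AH_metric_coframe : AH_metric a b c x = coframe *m coframe^T.
Proof.
apply/matrixP => i j; rewrite AH_metricE mxE sum4.
have [h0 h1 h2 h3] := coframeE i; have [k0 k1 k2 k3] := coframeE j.
rewrite ![_^T _ _]mxE h0 h1 h2 h3 k0 k1 k2 k3 /metric_form fiber_normE; ring.
Qed.

(** A vector killed by all four forms is zero: sigma2 and sigma3 are a rescaled rotation of its base
    part, and once that vanishes, dr and sigma1 do the same for its fibre part. *)
Lemma coframe_unit : a (fiber_rad x) != 0 -> b (fiber_rad x) != 0 -> c (fiber_rad x) != 0 ->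
  coframe \in unitmx.
Proof.
move=> a0 b0 c0; rewrite -row_free_unit; apply: inj_row_free => v vE.
have r0 : fiber_rad x != 0 by rewrite fiber_rad_eq0.
have q0 : conf_factor x != 0 by rewrite gt_eqF // conf_factor_gt0.
have col0 l : \sum_s v 0 s * coframe s l = 0.
  by have := congr1 (fun M : 'rV[R]_4 => M 0 l) vE; rewrite !mxE.
have h0 : form_dr x v = 0.
  rewrite -[RHS](col0 0) form_dr_sum; apply: eq_bigr => s _.
  by have [-> _ _ _] := coframeE s.
have h1 : sigma1 x v = 0.
  apply: (mulfI a0); rewrite mulr0 -[RHS](col0 1) sigma1_sum mulr_sumr.
  by apply: eq_bigr => s _; have [_ -> _ _] := coframeE s; ring.
have h2 : sigma2 x v = 0.
  apply: (mulfI b0); rewrite mulr0 -[RHS](col0 2%:R) sigma2_sum mulr_sumr.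
  by apply: eq_bigr => s _; have [_ _ -> _] := coframeE s; ring.
have h3 : sigma3 x v = 0.
  apply: (mulfI c0); rewrite mulr0 -[RHS](col0 3%:R) sigma3_sum mulr_sumr.
  by apply: eq_bigr => s _; have [_ _ _ ->] := coframeE s; ring.
have [s2 [s3 [e1 _ _ E2 E3]]] := sigma23E u0.
have k2 : s2 * v 0 0 - s3 * v 0 1 = 0.
  have -> : s2 * v 0 0 - s3 * v 0 1 = conf_factor x / 2 * sigma2 x v by rewrite E2; field.
  by rewrite h2 mulr0.
have k3 : s2 * v 0 1 + s3 * v 0 0 = 0.
  have -> : s2 * v 0 1 + s3 * v 0 0 = conf_factor x / 2 * sigma3 x v by rewrite E3; field.
  by rewrite h3 mulr0.
have v0 : v 0 0 = 0.
  rewrite -[LHS]mul1r -e1.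
  have -> : (s2 ^+ 2 + s3 ^+ 2) * v 0 0 =
    s2 * (s2 * v 0 0 - s3 * v 0 1) + s3 * (s2 * v 0 1 + s3 * v 0 0) by ring.
  by rewrite k2 k3 !mulr0 addr0.
have v1 : v 0 1 = 0.
  rewrite -[LHS]mul1r -e1.
  have -> : (s2 ^+ 2 + s3 ^+ 2) * v 0 1 =
    s2 * (s2 * v 0 1 + s3 * v 0 0) - s3 * (s2 * v 0 0 - s3 * v 0 1) by ring.
  by rewrite k2 k3 !mulr0 subr0.
have k1 : x 0 2%:R * v 0 3%:R - x 0 3%:R * v 0 2%:R = 0.
  have -> : x 0 2%:R * v 0 3%:R - x 0 3%:R * v 0 2%:R = 2 * fiber_rad x ^+ 2 * sigma1 x v.
    by rewrite sigma1E // v0 v1; field; rewrite q0 r0.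
  by rewrite h1 mulr0.
have k0 : x 0 2%:R * v 0 2%:R + x 0 3%:R * v 0 3%:R = 0.
  have -> : x 0 2%:R * v 0 2%:R + x 0 3%:R * v 0 3%:R = fiber_rad x * form_dr x v.
    by rewrite form_drE //; field.
  by rewrite h0 mulr0.
have r20 : fiber_rad x ^+ 2 != 0 by rewrite sqrf_eq0.
have v2 : v 0 2%:R = 0.
  apply: (mulfI r20); rewrite mulr0 fiber_rad_sqr.
  have -> : (x 0 2%:R ^+ 2 + x 0 3%:R ^+ 2) * v 0 2%:R =
    x 0 2%:R * (x 0 2%:R * v 0 2%:R + x 0 3%:R * v 0 3%:R) -
    x 0 3%:R * (x 0 2%:R * v 0 3%:R - x 0 3%:R * v 0 2%:R) by ring.
  by rewrite k0 k1 !mulr0 subr0.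
have v3 : v 0 3%:R = 0.
  apply: (mulfI r20); rewrite mulr0 fiber_rad_sqr.
  have -> : (x 0 2%:R ^+ 2 + x 0 3%:R ^+ 2) * v 0 3%:R =
    x 0 3%:R * (x 0 2%:R * v 0 2%:R + x 0 3%:R * v 0 3%:R) +
    x 0 2%:R * (x 0 2%:R * v 0 3%:R - x 0 3%:R * v 0 2%:R) by ring.
  by rewrite k0 k1 !mulr0 addr0.
by apply/rowP; apply: forall_ord4; rewrite [RHS]mxE.
Qed.

End Forms.

Lemma differentiable_partials n (f : 'rV[R]_n -> R) (x v : 'rV[R]_n) :
  differentiable f x -> 'D_v f x = \sum_s v 0 s * partial s f x.
Proof.
move=> fd; rewrite deriveE // {1}(row_sum_delta v) linear_sum; apply: eq_bigr => s _.
by rewrite linearZ /partial deriveE.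
Qed.

(** Full differentiability turns the derivative along r d/dr into a combination of partial
    derivatives, the form in which it meets the Christoffel symbols. *)
Lemma metric_entry_differentiable a b c x v w : fiber_coord x != 0 ->
  derivable a (fiber_rad x) 1 -> derivable b (fiber_rad x) 1 -> derivable c (fiber_rad x) 1 ->
  differentiable (metric_entry a b c v w) x.
Proof.
move=> u0 /derivable1_diffP da /derivable1_diffP db /derivable1_diffP dc.
have r0 : fiber_rad x != 0 by rewrite fiber_rad_eq0.
have q0 : conf_factor x != 0 by rewrite gt_eqF // conf_factor_gt0.
have D l : differentiable (@coordinate R 4 l) x by exact: differentiable_coord.
have Dr : differentiable (@fiber_rad R) x.
  have -> : @fiber_rad R = Num.sqrt \o (@coordinate R 4 2%:R ^+ 2 + @coordinate R 4 3%:R ^+ 2) :> ('rV[R]_4 -> R) by [].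
  apply: differentiable_comp; first by apply: differentiableD; exact: differentiableX.
  apply/derivable1_diffP.
  have [] // : is_derive ((@coordinate R 4 2%:R ^+ 2 + @coordinate R 4 3%:R ^+ 2) x) 1 (@Num.sqrt R)
    (2 * Num.sqrt ((@coordinate R 4 2%:R ^+ 2 + @coordinate R 4 3%:R ^+ 2) x))^-1.
  apply: is_derive1_sqrt; rewrite -[X in 0 < X]/(x 0 2%:R ^+ 2 + x 0 3%:R ^+ 2) -fiber_rad_sqr.
  by rewrite exprn_gt0 // fiber_rad_gt0.
have Dq : differentiable (@conf_factor R) x.
  have -> : @conf_factor R = cst 1 + (@coordinate R 4 0 ^+ 2 + @coordinate R 4 1 ^+ 2) by [].
  by apply: differentiableD; [exact: differentiable_cst|apply: differentiableD; exact: differentiableX].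
have Dir : differentiable (@inv_rad R) x by exact: differentiableV.
have Diq : differentiable (@inv_conf R) x by exact: differentiableV.
have Da : differentiable (a \o @fiber_rad R) x by exact: differentiable_comp.
have Db : differentiable (b \o @fiber_rad R) x by exact: differentiable_comp.
have Dc : differentiable (c \o @fiber_rad R) x by exact: differentiable_comp.
have Ddr s : differentiable (dr_entry s) x.
  apply: differentiableM; last exact: Dir.
  by apply: differentiableD; apply: differentiableZ; exact: D.
have Ds1 s : differentiable (sigma1_entry s) x.
  apply: differentiableZ; apply: differentiableD.
    apply: differentiableM; last by apply: differentiableX; exact: Dir.
    by apply: differentiableB; apply: differentiableZ; exact: D.
  apply: differentiableZ; apply: differentiableM; last exact: Diq.
  by apply: differentiableB; apply: differentiableZ; exact: D.
apply: differentiableD; first apply: differentiableD.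
- by apply: differentiableM; exact: Ddr.
- apply: differentiableM; first by apply: differentiableX; exact: Da.
  by apply: differentiableM; exact: Ds1.
- have Db2 : differentiable ((b \o @fiber_rad R) ^+ 2) x by exact: differentiableX.
  have Dc2 : differentiable ((c \o @fiber_rad R) ^+ 2) x by exact: differentiableX.
  apply: differentiableM; first by apply: differentiableZ; apply: differentiableX; exact: Diq.
  apply: differentiableD; first by apply: differentiableZ; exact: differentiableD.
  apply: differentiableZ; apply: differentiableM; first exact: differentiableB.
  apply: differentiableM; last exact: Dir.
  by apply: differentiableB; apply: differentiableZ; exact: D.
Qed.

Lemma fiber_rad_continuous : continuous (@fiber_rad R).
Proof.
move=> x; apply: (@continuous_comp _ _ _ (@coordinate R 4 2%:R ^+ 2 + @coordinate R 4 3%:R ^+ 2) (@Num.sqrt R)).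
  have cc l : {for x, continuous (@coordinate R 4 l)} by exact: coord_continuous.
  by rewrite !expr2; apply: continuousD; apply: continuousM; exact: cc.
exact: sqrt_continuous.
Qed.

Lemma conf_factor_continuous : continuous (@conf_factor R).
Proof.
move=> y; have cc k : continuous (@coordinate R 4 k) by move=> z; exact: coord_continuous.
rewrite (_ : @conf_factor R = cst 1 + (@coordinate R 4 0 * @coordinate R 4 0 + @coordinate R 4 1 * @coordinate R 4 1)); last first.
  by apply/funext => z; rewrite /conf_factor !expr2.
by apply: continuousD; [exact: cst_continuous|apply: continuousD; apply: continuousM; exact: cc].
Qed.

Lemma fiber_neq0_near x : fiber_coord x != 0 -> \forall y \near x, fiber_coord y != 0.
Proof.
rewrite -fiber_rad_gt0 => /(cvgr_gt _ (@fiber_rad_continuous x)).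
by apply: filterS => y; rewrite fiber_rad_gt0.
Qed.

End Hessian.

(** * Hessian of the squared distance and positivity of its partial traces *)

Section Convexity.
Variables (R : realType) (m : R) (a b c : R -> R).
Hypotheses (hm : 0 < m) (habc : AH_profile m a b c).
Implicit Types x v w : 'rV[R]_4.

Lemma AH_metric_near x i j : fiber_coord x != 0 ->
  \forall y \near x, AH_metric a b c y i j = metric_entry a b c (delta_mx 0 i) (delta_mx 0 j) y.
Proof.
move=> u0; apply: filterS (fiber_neq0_near u0) => y y0.
by rewrite AH_metricE // metric_formE.
Qed.

Lemma AH_metric_partial x s i j : fiber_coord x != 0 ->
  partial s (fun y => AH_metric a b c y i j) x =
  partial s (metric_entry a b c (delta_mx 0 i) (delta_mx 0 j)) x.
Proof. by move=> u0; apply: near_eq_derive; exact: AH_metric_near. Qed.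

(* The derivative along e_p of g(grad(F/2), e_q) = d(F/2)(e_q), where F = |u|^2. *)
Lemma gradient_identity x p q : fiber_coord x != 0 ->
  \sum_s vert R s * x 0 s * partial p (metric_entry a b c (delta_mx 0 s) (delta_mx 0 q)) x =
  vert R q * (p == q)%:R - vert R p * metric_form a b c x (delta_mx 0 p) (delta_mx 0 q).
Proof.
move=> u0.
have r0 : 0 < fiber_rad x by rewrite fiber_rad_gt0.
have D s : is_derive x (delta_mx 0 p) (metric_entry a b c (delta_mx 0 s) (delta_mx 0 q))
    (partial p (metric_entry a b c (delta_mx 0 s) (delta_mx 0 q)) x).
  apply/derivableP/diff_derivable/metric_entry_differentiable => //.
  - by have [] := profile_ode_a habc r0.
  - by have [] := profile_ode_b habc r0.
  - by have [] := profile_ode_c habc r0.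
have C l := is_derive_coordinate x (delta_mx 0 p) l.
pose L := \sum_s (vert R s *: (coordinate (n:=4) s * metric_entry a b c (delta_mx 0 s) (delta_mx 0 q))).
have DL : is_derive x (delta_mx 0 p) L (\sum_s vert R s *
    (x 0 s * partial p (metric_entry a b c (delta_mx 0 s) (delta_mx 0 q)) x
    + metric_entry a b c (delta_mx 0 s) (delta_mx 0 q) x * (p == s)%:R)).
  apply: is_derive_sum => s; apply: is_derive_eq (is_deriveZ _ (is_deriveM (C s) (D s))) _.
  by rewrite mxE eqxx /= /GRing.scale /= eq_sym.
(* The gradient identity holds at every nearby point, so both of its sides may be differentiated
   along e_p. *)
have LE : \forall y \near x, (vert R q *: coordinate (n:=4) q) y = L y.
  apply: filterS (fiber_neq0_near u0) => y y0.
  rewrite /L fct_sumE /GRing.scale /=.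
  have := metric_form_fib_self y0 a b c (delta_mx 0 q).
  rewrite (metric_form_sum y0) => E.
  rewrite (eq_bigr (fun s => fiber_part y 0 s * metric_form a b c y (delta_mx 0 s) (delta_mx 0 q))).
    have [v0 v1 v2 v3] := vertE R.
    rewrite E !mxE /coordinate; move: q {D L DL E}; apply: forall_ord4;
      by rewrite ?v0 ?v1 ?v2 ?v3 /GRing.scale /=; ring.
  by move=> s _; rewrite /GRing.scale /= mxE metric_formE //; rewrite -[in LHS]/(coordinate s y) mulrA.
have := is_derive_inj DL (near_eq_is_derive LE (is_deriveZ (vert R q) (C q))).
under eq_bigr => s _ do rewrite mulrDr mulrA.
rewrite big_split /= => H.
have S : \sum_s vert R s * (metric_entry a b c (delta_mx 0 s) (delta_mx 0 q) x * (p == s)%:R) =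
   vert R p * metric_form a b c x (delta_mx 0 p) (delta_mx 0 q).
  rewrite (bigD1 p) //= eqxx mulr1 metric_formE // big1 ?addr0 // => s sp.
  by rewrite eq_sym (negbTE sp) !mulr0.
rewrite S mxE eqxx /GRing.scale /= in H; rewrite eq_sym -H addrK.
by [].
Qed.

Definition hess_eigen (r : R) (l : 'I_4) : R :=
  [:: 2; 2 * r * ((a r ^+ 2 - (b r - c r) ^+ 2) / (2 * b r * c r)) / a r;
    2 * r * ((b r ^+ 2 - (c r - a r) ^+ 2) / (2 * c r * a r)) / b r;
    2 * r * ((c r ^+ 2 - (a r - b r) ^+ 2) / (2 * a r * b r)) / c r]`_l.

(* For X = grad F, Hess F is half the Lie derivative of g along X; X is twice the
   fibre position vector, so only a radial derivative of g is needed. *)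
Lemma AH_hessian x p q : fiber_coord x != 0 ->
  2 * vert R p * (p == q)%:R -
    \sum_l 2 * vert R l * x 0 l * christoffel (AH_metric a b c) x l p q =
  \sum_l hess_eigen (fiber_rad x) l * coframe x a b c p l * coframe x a b c q l.
Proof.
move=> u0.
have r0 : 0 < fiber_rad x by rewrite fiber_rad_gt0.
have [an bn cn] := profile_nonzero habc r0.
set G := AH_metric a b c.
have Gunit : G x \in unitmx.
  have U := coframe_unit u0 an bn cn.
  by rewrite /G AH_metric_coframe // unitmx_mul unitmx_tr U.
(* In these coordinates dF and grad F have the same components, which is X G = X. *)
pose X : 'rV[R]_4 := \row_l (2 * vert R l * x 0 l).
have XG : X *m G x = X.
  apply/rowP => q'; rewrite mxE.
  rewrite (eq_bigr (fun s => 2 * (fiber_part x 0 s * metric_form a b c x (delta_mx 0 s) (delta_mx 0 q')))).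
    rewrite -mulr_sumr -(metric_form_sum u0) metric_form_fib_self // !mxE.
    have [v0 v1 v2 v3] := vertE R.
    by move: q'; apply: forall_ord4; rewrite ?v0 ?v1 ?v2 ?v3 /=; ring.
  by move=> s _; rewrite AH_metricE // !mxE; ring.
have XV : X *m invmx (G x) = X by rewrite -{1}XG mulmxK.
pose A s := partial p (fun y => G y s q) x + partial q (fun y => G y s p) x
     - partial s (fun y => G y p q) x.
(* Since X G^-1 = X, contraction with X removes the inverse metric from the Christoffel symbols, and
   the 2 in X cancels their 2^-1. *)
have -> : \sum_l 2 * vert R l * x 0 l * christoffel G x l p q = \sum_s vert R s * x 0 s * A s.
  transitivity (2^-1 * \sum_s X 0 s * A s); last first.
    by rewrite mulr_sumr; apply: eq_bigr => s _; rewrite mxE; field.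
  rewrite -{1}XV mulr_sumr.
  rewrite (eq_bigr (fun l => \sum_s 2^-1 * (X 0 l * invmx (G x) l s * A s))).
    rewrite exchange_big /=; apply: eq_bigr => s _.
    by rewrite mxE -mulr_sumr mulr_suml.
  move=> l _; rewrite /christoffel !mulr_sumr; apply: eq_bigr => s _.
  rewrite mxE -/(A s); ring.
have AE s : A s = partial p (metric_entry a b c (delta_mx 0 s) (delta_mx 0 q)) x +
    partial q (metric_entry a b c (delta_mx 0 s) (delta_mx 0 p)) x -
    partial s (metric_entry a b c (delta_mx 0 p) (delta_mx 0 q)) x.
  by rewrite /A /G !AH_metric_partial.
under eq_bigr => s _ do rewrite AE mulrBr mulrDr.
rewrite sumrB big_split.
rewrite (gradient_identity p q u0).
rewrite (gradient_identity q p u0).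
have GD := metric_entry_radial (delta_mx 0 p) (delta_mx 0 q) u0 (profile_ode_a habc r0)
  (profile_ode_b habc r0) (profile_ode_c habc r0).
have diffg : differentiable (metric_entry a b c (delta_mx 0 p) (delta_mx 0 q)) x.
  apply: metric_entry_differentiable => //.
  - by have [] := profile_ode_a habc r0.
  - by have [] := profile_ode_b habc r0.
  - by have [] := profile_ode_c habc r0.
have -> : \sum_s vert R s * x 0 s * partial s (metric_entry a b c (delta_mx 0 p) (delta_mx 0 q)) x =
   'D_(fiber_part x) (metric_entry a b c (delta_mx 0 p) (delta_mx 0 q)) x.
  by rewrite differentiable_partials //; apply: eq_bigr => s _; rewrite !mxE.
rewrite (@derive_val _ _ _ _ _ _ _ GD) -!metric_formE //.
rewrite (metric_form_sym _ _ _ _ (delta_mx 0 p) (fiber_part _)) !metric_form_fib_delta //.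
rewrite (metric_form_sym _ _ _ _ (delta_mx 0 q) (delta_mx 0 p)).
rewrite sum4; have [-> -> -> ->] := coframeE x a b c p; have [-> -> -> ->] := coframeE x a b c q.
rewrite /hess_eigen /= [q == p]eq_sym.
have D0 : (p == q)%:R * (vert R q - vert R p) = 0.
  by case: eqVneq => [->|_]; rewrite ?subrr ?mulr0 ?mul0r.
set M := metric_form _ _ _ _ _ _; set d := (p == q)%:R in D0 *.
have -> : vert R q * d = vert R p * d.
  by apply/eqP; rewrite -subr_eq0 -mulrBl mulrC D0.
field.
by rewrite an bn cn.
Qed.

(** The equations give a'/a + b'/b = (a + b - c) / (a b), and cyclically. As b < 0 < a, c, the two
    barrier inequalities settle the pairs containing b; the pair a, c is positive by signs alone. *)
Lemma hess_eigen_gt0 r : 0 < r ->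
  [/\ 0 < hess_eigen r 1 + hess_eigen r 2%:R, 0 < hess_eigen r 1 + hess_eigen r 3%:R &
    0 < hess_eigen r 2%:R + hess_eigen r 3%:R].
Proof.
move=> r0; have [an bn cn] := profile_nonzero habc r0.
have [a0 b0 c0] := profile_sign habc r0.
have s0 := profile_ac_lt hm habc r0; have p0 := profile_bc_lt hm habc r0.
rewrite /hess_eigen /=; split.
- have -> : 2 * r * ((a r ^+ 2 - (b r - c r) ^+ 2) / (2 * b r * c r)) / a r +
    2 * r * ((b r ^+ 2 - (c r - a r) ^+ 2) / (2 * c r * a r)) / b r =
    2 * r * (- (a r + b r - c r) / (a r * - b r)).
    by field; rewrite an bn cn.
  by rewrite !mulr_gt0 ?oppr_gt0 ?invr_gt0 // mulr_gt0 // oppr_gt0.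
- have -> : 2 * r * ((a r ^+ 2 - (b r - c r) ^+ 2) / (2 * b r * c r)) / a r +
    2 * r * ((c r ^+ 2 - (a r - b r) ^+ 2) / (2 * a r * b r)) / c r =
    2 * r * ((a r + c r - b r) / (a r * c r)).
    by field; rewrite an bn cn.
  by rewrite !mulr_gt0 ?invr_gt0 ?mulr_gt0 //; lra.
- have -> : 2 * r * ((b r ^+ 2 - (c r - a r) ^+ 2) / (2 * c r * a r)) / b r +
    2 * r * ((c r ^+ 2 - (a r - b r) ^+ 2) / (2 * a r * b r)) / c r =
    2 * r * (- (b r + c r - a r) / (- b r * c r)).
    by field; rewrite an bn cn.
  by rewrite !mulr_gt0 ?oppr_gt0 ?invr_gt0 // mulr_gt0 // oppr_gt0.
Qed.

Lemma height2E x : height2 x = fiber_rad x ^+ 2.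
Proof.
have [v0 v1 v2 v3] := vertE R.
by rewrite /height2 sum4 v0 v1 v2 v3 fiber_rad_sqr; ring.
Qed.

Lemma AH_no_max k (W : set 'rV[R]_k) (phi : 'rV[R]_k -> 'rV[R]_4) (t0 : 'rV[R]_k) :
  k = 2%N \/ k = 3%N -> open W -> W t0 ->
  (forall l, smooth_on W (fun t => phi t 0 l)) ->
  row_free (tangent_mx phi t0) ->
  (forall t, W t -> fiber_rad (phi t) <= fiber_rad (phi t0)) ->
  mean_curvature_vector (AH_metric a b c) phi t0 = 0 -> fiber_rad (phi t0) = 0.
Proof.
move=> k23 Wo Wt0 phis Tfree hmax H0; apply/eqP; rewrite fiber_rad_eq0; apply/negPn/negP => u0.
have r0 : 0 < fiber_rad (phi t0) by rewrite fiber_rad_gt0.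
have [an bn cn] := profile_nonzero habc r0.
have [l12 l13 l23] := hess_eigen_gt0 r0.
apply: (@mean_curvature_max _ _ W phi t0 (AH_metric a b c) (coframe (phi t0) a b c)
  (2 * fiber_rad (phi t0)) (hess_eigen (fiber_rad (phi t0))) k23 Wo Wt0 phis Tfree) => //.
- by move=> t Wt; rewrite !height2E ler_pXn2r ?nnegrE ?fiber_rad_ge0 ?hmax.
- exact: AH_metric_coframe.
- exact: coframe_unit.
- by rewrite mulf_neq0 // gt_eqF.
- move=> l; have [-> _ _ _] := coframeE (phi t0) a b c l.
  rewrite form_drE // !mxE; have [v0 v1 v2 v3] := vertE R.
  have rn : fiber_rad (phi t0) != 0 by rewrite gt_eqF.
  by move: l; apply: forall_ord4; rewrite ?v0 ?v1 ?v2 ?v3 /=; field.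
- by move=> p q; exact: AH_hessian.
Qed.

End Convexity.

(** * Compact minimal submanifolds lie in the zero section *)

Section Topology.
Variable R : realType.
Implicit Types x y : 'rV[R]_4.

Lemma chart_eqP (p q : bool * 'rV[R]_4) :
  reflect (chart p.1 p.2 = chart q.1 q.2) (glued p q).
Proof.
case: p q => [i x] [j y] /=.
have := @eqmodP _ (glued_equiv R) (i, x) (j, y).
by move=> H; apply: (iffP H).
Qed.

Lemma chart_surj (p : AH R) : exists i x, p = chart i x.
Proof.
exists (repr p).1, (repr p).2; rewrite /chart -surjective_pairing.
by rewrite [LHS](esym (reprK p)).
Qed.

Lemma chart_continuous i : continuous (@chart R i).
Proof.
move=> x; apply: (@continuous_comp _ _ _ (fun y => (i, y)) (\pi_(AH R)%qT)).
  move=> A [[P Q] /= [nP nQ] PQA]; apply: filterS nQ => y Qy.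
  by apply: PQA; split=> //=; exact: nbhs_singleton nP.
exact: pi_continuous.
Qed.

Lemma bool_pair_continuous (T U : topologicalType) (F : bool * T -> U) :
  (forall i, continuous (fun t => F (i, t))) -> continuous F.
Proof.
move=> Fc [i t] A FA; have nA := Fc i t A FA.
exists ([set i], [set s | A (F (i, s))]); last by move=> [j s] /= [-> ].
by split => //=; exact: discrete_set1.
Qed.

(** Evaluation at a chosen representative makes the definition total; it descends F to the quotient
    when F respects [glued]. *)
Definition lift_AH (U : Type) (F : bool * 'rV[R]_4 -> U) (p : AH R) : U := F (repr p).

Lemma lift_AHE (U : Type) (F : bool * 'rV[R]_4 -> U) i x :
  (forall p q, glued p q -> F p = F q) -> lift_AH F (chart i x) = F (i, x).
Proof.
move=> FE; apply: FE; apply/chart_eqP.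
by rewrite /chart -surjective_pairing reprK.
Qed.

Lemma lift_AH_continuous (U : topologicalType) (F : bool * 'rV[R]_4 -> U) :
  (forall p q, glued p q -> F p = F q) ->
  (forall i, continuous (fun x => F (i, x))) -> continuous (lift_AH F).
Proof.
move=> FE Fc A; apply: repr_comp_continuous; first exact: bool_pair_continuous.
by move=> p q /eqP pq; apply/eqP; apply: FE; apply/chart_eqP; rewrite /chart -!surjective_pairing.
Qed.

Lemma fiber_rad_transition x : base_coord x != 0 -> fiber_rad (transition x) = fiber_rad x.
Proof.
move=> z0; rewrite -!fiber_normE /fiber_norm /transition fiber_point_of.
by rewrite normrM normrX normrM normfV normr_id divff ?normr_eq0 // expr1n mulr1.
Qed.

Lemma glued_fiber_rad (p q : bool * 'rV[R]_4) : glued p q -> fiber_rad p.2 = fiber_rad q.2.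
Proof.
by rewrite /glued; case: ifP => _ => [/eqP -> //|/andP[z0 /eqP ->]]; rewrite fiber_rad_transition.
Qed.

Definition height : AH R -> R := lift_AH (fun p => fiber_rad p.2).

Lemma heightE i x : height (chart i x) = fiber_rad x.
Proof. by rewrite /height lift_AHE //; exact: glued_fiber_rad. Qed.

Lemma height_continuous : continuous height.
Proof. by apply: lift_AH_continuous; [exact: glued_fiber_rad|move=> i; exact: fiber_rad_continuous]. Qed.

Lemma zero_sectionE i x : zero_section R (chart i x) <-> fiber_coord x = 0.
Proof.
split=> [[j [y [y0 /(congr1 height)]]]|x0]; last by exists i, x.
by rewrite !heightE => E; apply/eqP; rewrite -fiber_rad_eq0 E fiber_rad_eq0 y0.
Qed.

Lemma minimal_sub_zero_section m a b c k (N : set (AH R)) : 0 < m -> AH_profile m a b c ->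
  k = 2%N \/ k = 3%N -> compact_minimal_submanifold a b c k N -> N `<=` zero_section R.
Proof.
move=> hm habc k23 [N0 Ncpt Nsub Nmin].
have [p /set_mem Np pmax] := compact_EVT_max N0 Ncpt (continuous_subspaceT height_continuous).
have [i [x px]] := chart_surj p.
have [|W [phi [par [t0 Wt0 phit0]]]] := Nsub i x; first by rewrite /= -px.
have [Wo phis phifree [U [_ phiU _]]] := par.
have WN t : W t -> N (chart i (phi t)).
  move=> Wt; have : (phi @` W) (phi t) by exists t.
  by rewrite phiU => -[].
have h0 : fiber_rad (phi t0) = 0.
  apply: (AH_no_max hm habc k23 Wo Wt0 phis (phifree _ Wt0)).
    by move=> t Wt; rewrite -!(heightE i) phit0 -px; apply: pmax; exact/mem_set/WN.
  exact: Nmin par _ Wt0.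
move=> q Nq; have [j [y qy]] := chart_surj q; rewrite qy; apply/zero_sectionE.
apply/eqP; rewrite -fiber_rad_eq0 eq_le fiber_rad_ge0 andbT -(heightE j) -qy.
by rewrite -h0 -(heightE i) phit0 -px; apply: pmax; exact: mem_set.
Qed.

Lemma fiber_zero_tangent k (W : set 'rV[R]_k) (phi : 'rV[R]_k -> 'rV[R]_4) t :
  open W -> W t -> (forall s, W s -> fiber_coord (phi s) = 0) ->
  forall i, tangent_mx phi t i 2%:R = 0 /\ tangent_mx phi t i 3%:R = 0.
Proof.
move=> Wo Wt phi0 i.
have H (l : 'I_4) : (forall s, W s -> phi s 0 l = 0) -> tangent_mx phi t i l = 0.
  move=> h; rewrite mxE /partial.
  rewrite (@near_eq_derive _ _ _ _ (cst 0)) ?derive_cst //.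
  by apply: filterS (open_nbhs_nbhs (conj Wo Wt)) => s /h.
by split; apply: H => s /phi0 /eqP; rewrite fiber_coord_eq0 => /andP[/eqP ? /eqP ?].
Qed.

Lemma rank_le2 k (T : 'M[R]_(k, 4)) :
  (forall i, T i 2%:R = 0 /\ T i 3%:R = 0) -> (\rank T <= 2)%N.
Proof.
move=> T0; have -> : T = T *m (pid_mx 2 : 'M[R]_4).
  apply/matrixP => i j; rewrite mxE sum4 !mxE /=; have [h2 h3] := T0 i.
  by move: j; apply: forall_ord4; rewrite ?h2 ?h3 /= ?mulr1 ?mulr0 ?addr0 ?add0r.
by have := mxrankM_maxr T (pid_mx 2 : 'M[R]_4); rewrite rank_pid_mx.
Qed.

(** Inside the zero section the tangent matrix has two zero columns, so its rank is at most 2,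
    against an immersion of rank 3. *)
Lemma no_minimal3 m a b c (N : set (AH R)) : 0 < m -> AH_profile m a b c ->
  ~ compact_minimal_submanifold a b c 3 N.
Proof.
move=> hm habc Nmin; have k23 : 3%N = 2%N \/ 3%N = 3%N by right.
have Nsub := minimal_sub_zero_section hm habc k23 Nmin.
have [[p Np] _ Nemb _] := Nmin.
have [i [x px]] := chart_surj p.
have [|W [phi [[Wo phis phifree [U [_ phiU _]]] [t0 Wt0 phit0]]]] := Nemb i x; first by rewrite /= -px.
have W0 s : W s -> fiber_coord (phi s) = 0.
  move=> Ws; apply/(zero_sectionE i)/Nsub; have : (phi @` W) (phi s) by exists s.
  by rewrite phiU => -[].
have T0 := fiber_zero_tangent Wo Wt0 W0.
have := phifree _ Wt0; rewrite /row_free => /eqP rk.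
by have := rank_le2 T0; rewrite rk.
Qed.

End Topology.

(** * Uniqueness of the zero section *)

Section ZeroSection.
Variable R : realType.
Implicit Types (x : 'rV[R]_4) (y : 'rV[R]_2).

Lemma forall_ord2 (P : 'I_2 -> Prop) : P 0 -> P 1 -> forall i, P i.
Proof.
move=> p0 p1 [[|[|//]] i2].
- by move: p0; congr (P _); apply: val_inj.
- by move: p1; congr (P _); apply: val_inj.
Qed.

Definition emb y : 'rV[R]_4 := \row_l [:: y 0 0; y 0 1; 0; 0]`_l.

Lemma embE y : [/\ emb y 0 0 = y 0 0, emb y 0 1 = y 0 1, emb y 0 2%:R = 0 & emb y 0 3%:R = 0].
Proof. by rewrite !mxE. Qed.

Lemma emb_fiber y : fiber_coord (emb y) = 0.
Proof. by have [_ _ h2 h3] := embE y; rewrite /fiber_coord h2 h3. Qed.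

Lemma fiber0_emb x : fiber_coord x = 0 -> exists y, x = emb y.
Proof.
move=> /eqP; rewrite fiber_coord_eq0 => /andP[/eqP x2 /eqP x3].
exists (\row_l [:: x 0 0; x 0 1]`_l); apply/rowP; apply: forall_ord4;
  by rewrite [RHS]mxE /= ?mxE.
Qed.

Lemma emb_continuous : continuous emb.
Proof.
move=> y A /nbhs_ballP[d /= d0 Ad]; apply/nbhs_ballP; exists d => //= y' [_ yy'].
apply: Ad; split=> // i; rewrite (ord1 i); apply: forall_ord4.
- by rewrite !mxE /=; exact: yy'.
- by rewrite !mxE /=; exact: yy'.
- by rewrite !mxE /=; exact: ballxx.
- by rewrite !mxE /=; exact: ballxx.
Qed.

Definition stereo_sign (i : bool) : R := if i then -1 else 1.

Lemma stereo_sign_neq0 i : stereo_sign i != 0.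
Proof. by case: i; rewrite /stereo_sign ?oppr_eq0 oner_eq0. Qed.

Lemma stereo_signN i j : i != j -> stereo_sign j = - stereo_sign i.
Proof. by case: i; case: j => //= _; rewrite /stereo_sign opprK. Qed.

(* The inverse stereographic projection of z, or of conj(1/w) in the w-chart. *)
Definition stereo (p : bool * 'rV[R]_4) : 'rV[R]_3 :=
  \row_l [:: 2 * p.2 0 0 / conf_factor p.2; stereo_sign p.1 * (2 * p.2 0 1 / conf_factor p.2);
             stereo_sign p.1 * (2 / conf_factor p.2 - 1)]`_l.

Lemma stereoE p : [/\ stereo p 0 0 = 2 * p.2 0 0 / conf_factor p.2,
  stereo p 0 1 = stereo_sign p.1 * (2 * p.2 0 1 / conf_factor p.2) &
  stereo p 0 2%:R = stereo_sign p.1 * (2 / conf_factor p.2 - 1)].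
Proof. by rewrite !mxE. Qed.

Lemma base_coord_eq0 x : (base_coord x == 0) = (x 0 0 ^+ 2 + x 0 1 ^+ 2 == 0).
Proof.
rewrite eq_complex /= paddr_eq0 ?sqr_ge0 // !sqrf_eq0.
by [].
Qed.

Lemma transition_base x : transition x 0 0 = x 0 0 / (x 0 0 ^+ 2 + x 0 1 ^+ 2) /\
  transition x 0 1 = - x 0 1 / (x 0 0 ^+ 2 + x 0 1 ^+ 2).
Proof. by rewrite !mxE /= mulNr. Qed.

(** The two formulas match because 1 + |1/z|^2 = (1 + |z|^2) / |z|^2; the signs absorb the
    conjugation and the exchange of poles. *)
Lemma glued_stereo p q : glued p q -> stereo p = stereo q.
Proof.
case: p q => [i x] [j y]; rewrite /glued /=; case: ifP => [/eqP -> /eqP -> //|ij].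
move=> /andP[]; rewrite base_coord_eq0 => n0 /eqP ->.
have [t0 t1] := transition_base x.
have sj : stereo_sign j = - stereo_sign i by apply: stereo_signN; rewrite ij.
have cx : conf_factor x != 0 by rewrite gt_eqF // conf_factor_gt0.
set n := x 0 0 ^+ 2 + x 0 1 ^+ 2 in n0 t0 t1.
have cn : conf_factor x = 1 + n by [].
have ct : conf_factor (transition x) = conf_factor x / n.
  rewrite cn /conf_factor t0 t1 !expr_div_n sqrrN -mulrDl -/n.
  by field.
have [a0 a1 a2] := stereoE (i, x); have [b0 b1 b2] := stereoE (j, transition x).
have E0 : stereo (i, x) 0 0 = stereo (j, transition x) 0 0.
  by rewrite a0 b0 /= ct t0; field; rewrite n0 cx.
have E1 : stereo (i, x) 0 1 = stereo (j, transition x) 0 1.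
  by rewrite a1 b1 /= sj ct t1; field; rewrite n0 cx.
have E2 : stereo (i, x) 0 2%:R = stereo (j, transition x) 0 2%:R.
  by rewrite a2 b2 /= sj ct; rewrite cn in cx *; field; rewrite n0 cx.
apply/rowP; case => -[|[|[|//]]] l3.
- by rewrite (_ : Ordinal l3 = 0) //; exact: val_inj.
- by rewrite (_ : Ordinal l3 = 1) //; exact: val_inj.
- by rewrite (_ : Ordinal l3 = 2%:R) //; exact: val_inj.
Qed.

(** The continuous map [stereo] separates the points of the zero section, which is how points
    outside N are kept away from N. *)
Lemma stereo_inj i y j y' : stereo (i, emb y) = stereo (j, emb y') ->
  chart i (emb y) = chart j (emb y').
Proof.
move=> E; have /= [a0 a1 a2] := stereoE (i, emb y); have /= [b0 b1 b2] := stereoE (j, emb y').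
have [x0 x1 x2 x3] := embE y; have [z0 z1 z2 z3] := embE y'.
have q0 : conf_factor (emb y) != 0 by rewrite gt_eqF // conf_factor_gt0.
have q0' : conf_factor (emb y') != 0 by rewrite gt_eqF // conf_factor_gt0.
rewrite E b0 x0 z0 in a0; rewrite E b1 x1 z1 in a1; rewrite E b2 in a2.
have [ij|ij] := eqVneq i j.
  subst j; have s0 := stereo_sign_neq0 i.
  have Q : conf_factor (emb y') = conf_factor (emb y).
    move/(mulfI s0)/addIr/(mulfI (_ : (2:R) != 0)) : a2 => /(_ _)/invr_inj; apply.
    by rewrite pnatr_eq0.
  rewrite Q in a0 a1; congr (chart i (emb _)); apply/rowP; apply: forall_ord2.
    by move/mulIf : a0; rewrite invr_eq0 => /(_ q0)/mulfI; rewrite pnatr_eq0 => /(_ isT).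
  by move/(mulfI s0)/mulIf : a1; rewrite invr_eq0 => /(_ q0)/mulfI; rewrite pnatr_eq0 => /(_ isT).
have sj := stereo_signN ij.
have s0 := stereo_sign_neq0 i.
rewrite sj !mulNr -!mulrN in a1 a2.
move/(mulfI s0) : a1 => a1; move/(mulfI s0) : a2 => a2.
set q := conf_factor (emb y) in a0 a1 a2 q0; set q' := conf_factor (emb y') in a0 a1 a2 q0'.
pose n := y 0 0 ^+ 2 + y 0 1 ^+ 2.
have qn : q = 1 + n by rewrite /q /conf_factor x0 x1.
(* Opposite third coordinates give 1/q + 1/q' = 1, that is (q - 1) (q' - 1) = 1: the squared moduli
   of the two base points are inverse to each other. *)
have qq : q * q' = q + q'.
  have : 2 * (q' ^-1 + q^-1 - 1) = 0 by move: a2; lra.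
  move/eqP; rewrite mulf_eq0 pnatr_eq0 /= => /eqP H.
  have -> : q * q' = q * q' * (q'^-1 + q^-1 - 1) + q * q' by rewrite H mulr0 add0r.
  by field; rewrite q0 q0'.
have n0 : n != 0.
  apply/eqP => nE; rewrite nE addr0 in qn; rewrite qn in qq; move: qq; lra.
have q'E : q' = q / n.
  apply: (mulIf n0); rewrite divfK // (_ : n = q - 1); last by rewrite qn; ring.
  by rewrite mulrBr mulr1 mulrC qq; ring.
have [t0 t1] := transition_base (emb y); rewrite x0 x1 -/n in t0 t1.
suff -> : emb y' = transition (emb y).
  apply/(chart_eqP (i, _) (j, _)); rewrite /glued /= (negbTE ij) eqxx andbT base_coord_eq0.
  by rewrite x0 x1.
have y0 : y' 0 0 = y 0 0 / n.
  have -> : y' 0 0 = (2 * y' 0 0 / q') * q' / 2 by field.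
  by rewrite a0 q'E; field; rewrite n0 q0.
have y1 : y' 0 1 = - y 0 1 / n.
  have -> : y' 0 1 = (2 * y' 0 1 * - q'^-1) * - q' / 2 by field.
  by rewrite a1 q'E; field; rewrite n0 q0.
have : fiber_coord (transition (emb y)) = 0.
  by rewrite /transition fiber_point_of emb_fiber mul0r.
move=> /eqP; rewrite fiber_coord_eq0 => /andP[/eqP u2 /eqP u3].
by apply/rowP; apply: forall_ord4; rewrite ?z0 ?z1 ?z2 ?z3 ?y0 ?y1 ?t0 ?t1 ?u2 ?u3.
Qed.

Lemma stereo_continuous i l : continuous (fun x => stereo (i, x) 0 l).
Proof.
have cc k : continuous (@coordinate R 4 k) by move=> x; exact: coord_continuous.
have ciq : continuous (fun x => (conf_factor x)^-1).
  by move=> x; apply: continuousV; [rewrite gt_eqF // conf_factor_gt0|exact: conf_factor_continuous].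
case: l => -[|[|[|//]]] l3 x.
- rewrite (_ : (fun x => stereo (i, x) 0 _) = (cst 2 * @coordinate R 4 0) * (fun x => (conf_factor x)^-1)); last first.
    by apply/funext => z; rewrite mxE.
  apply: continuousM; last exact: ciq.
  by apply: continuousM; [exact: cst_continuous|exact: cc].
- rewrite (_ : (fun x => stereo (i, x) 0 _) =
    cst (stereo_sign i) * ((cst 2 * @coordinate R 4 1) * (fun x => (conf_factor x)^-1))); last first.
    by apply/funext => z; rewrite mxE.
  apply: continuousM; first exact: cst_continuous.
  apply: continuousM; last exact: ciq.
  by apply: continuousM; [exact: cst_continuous|exact: cc].
- rewrite (_ : (fun x => stereo (i, x) 0 _) =
    cst (stereo_sign i) * (cst 2 * (fun x => (conf_factor x)^-1) - cst 1)); last first.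
    by apply/funext => z; rewrite mxE.
  apply: continuousM; first exact: cst_continuous.
  apply: continuousB; last exact: cst_continuous.
  by apply: continuousM; [exact: cst_continuous|exact: ciq].
Qed.

Lemma dist2_continuous (T : topologicalType) k (f : T -> 'rV[R]_k) (z : 'rV[R]_k) :
  (forall l, continuous (fun s => f s 0 l)) -> continuous (fun s => dist2 (f s) z).
Proof.
move=> fc t; rewrite /dist2.
have -> : (fun s => \sum_l (f s 0 l - z 0 l) ^+ 2) =
     \sum_l ((fun s => f s 0 l) - cst (z 0 l)) * ((fun s => f s 0 l) - cst (z 0 l)).
  by apply/funext => s; rewrite fct_sumE; apply: eq_bigr => l _; rewrite expr2.
apply: (big_ind (fun g => {for t, continuous g})).
- exact: cst_continuous.
- by move=> g h; exact: continuousD.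
- move=> l _; have c1 : {for t, continuous ((fun s => f s 0 l) - cst (z 0 l))}.
    by apply: continuousB; [exact: fc|exact: cst_continuous].
  exact: continuousM.
Qed.

(** The set is pulled back along the line through y0 and y1, and the real line is connected. *)
Lemma connected_plane (A : set 'rV[R]_2) : open A -> closed A -> A !=set0 -> A = setT.
Proof.
move=> Ao Ac [y0 Ay0]; apply/seteqP; split=> // y1 _.
pose g (s : R) := y0 + s *: (y1 - y0).
have gc : continuous g.
  by move=> s; apply: cvgD; [exact: cvg_cst|apply: cvgZr_tmp; exact: cvg_id].
have RC : connected [set: R] by apply/connected_intervalP => ? ? *.
have : g @^-1` A = setT.
  apply: RC.
  - by exists 0; rewrite /g /= scale0r addr0.
  - by exists (g @^-1` A); [move/continuousP : gc; apply|rewrite setTI].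
  - by exists (g @^-1` A); [move/continuous_closedP : gc; apply|rewrite setTI].
by move=> /seteqP[_ /(_ 1 I)]; rewrite /g /= scale1r addrC subrK.
Qed.

End ZeroSection.

(** * A compact minimal surface fills the zero section *)

Section Uniqueness.
Variable R : realType.

Definition trace_set (N : set (AH R)) (i : bool) : set 'rV[R]_2 :=
  [set y | N (chart i (emb y))].

(** For a point outside N, the squared distance to it under [stereo] has a positive minimum on the
    compact set N, so nearby points are outside N as well. *)
Lemma trace_closed (N : set (AH R)) i : N !=set0 -> compact N -> N `<=` zero_section R ->
  closed (trace_set N i).
Proof.
move=> N0 Ncpt Nsub; rewrite -[trace_set N i]setCK; apply: open_closedC.
suff H (y : 'rV[R]_2) : ~ trace_set N i y -> \forall z \near y, ~ trace_set N i z.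
  by rewrite openE => y; exact: H.
move=> yN.
pose F (p : bool * 'rV[R]_4) := dist2 (stereo p) (stereo (i, emb y)).
have FE p q : glued p q -> F p = F q by rewrite /F => /glued_stereo ->.
have Fc j : continuous (fun x => F (j, x)).
  by apply: dist2_continuous => l; exact: stereo_continuous.
have Lc : continuous (lift_AH F) by exact: lift_AH_continuous.
have [p /set_mem Np pmin] := compact_EVT_min N0 Ncpt (continuous_subspaceT Lc).
have Lp : 0 < lift_AH F p.
  have [j [x [x0 pE]]] := Nsub _ Np; have [y' xE] := fiber0_emb x0.
  rewrite pE lift_AHE // lt_neqAle eq_sym dist2_ge0 andbT /F xE.
  apply/eqP => /dist2_eq0 /stereo_inj E; apply: yN.
  by rewrite /trace_set /= -E -xE -pE.
have Gc : {for y, continuous (fun y' => F (i, emb y'))}.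
  by apply: (@continuous_comp _ _ _ (@emb R) (fun x => F (i, x))); [exact: emb_continuous|exact: Fc].
have Fy : F (i, emb y) < lift_AH F p.
  rewrite /F /dist2 (eq_bigr (fun=> 0)) ?big1_eq // => l _.
  by rewrite subrr expr0n.
have nF : \forall y' \near y, F (i, emb y') < lift_AH F p by exact: cvgr_lt _ Gc _ Fy.
apply: filterS nF => y' y'lt y'N.
by have := pmin _ (mem_set y'N); rewrite lift_AHE // leNgt y'lt.
Qed.

Definition base2 (x : 'rV[R]_4) : 'rV[R]_2 := \row_j x 0 (widen_ord (isT : (2 <= 4)%N) j).

Lemma base2_emb x : fiber_coord x = 0 -> emb (base2 x) = x.
Proof.
move=> /eqP; rewrite fiber_coord_eq0 => /andP[/eqP x2 /eqP x3].
apply/rowP; apply: forall_ord4; rewrite ?x2 ?x3 mxE //= mxE; congr (x 0 _); exact: val_inj.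
Qed.

(** The fibre components of a local parametrization of N vanish, so its base part is still injective
    with invertible Jacobian, and [open_image] applies to it. *)
Lemma trace_open (N : set (AH R)) i : embedded_submanifold 2 (chart i @^-1` N) ->
  N `<=` zero_section R -> open (trace_set N i).
Proof.
move=> Nemb Nsub; suff H (y : 'rV[R]_2) : trace_set N i y -> \forall z \near y, trace_set N i z.
  by rewrite openE => y; exact: H.
move=> yN.
have [|W [phi [[Wo phis phifree [U [_ phiU [psi [_ psiK]]]]] [t0 Wt0 phit0]]]] := Nemb (emb y).
  by [].
have WN t : W t -> N (chart i (phi t)).
  move=> Wt; have : (phi @` W) (phi t) by exists t.
  by rewrite phiU => -[].
have W0 t : W t -> fiber_coord (phi t) = 0 by move=> /WN/Nsub/zero_sectionE.
pose f t := base2 (phi t).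
have fE l : (fun t => f t 0 l) = (fun t => phi t 0 (widen_ord (isT : (2 <= 4)%N) l)).
  by apply/funext => t; rewrite mxE.
have C l := Ck_on_sub (phis l 2%N).
have [e e0 He] : exists2 e, 0 < e & forall z, dist2 (f t0) z < e -> exists2 t, W t & f t = z.
  apply: (open_image Wo Wt0).
  - by move=> t l Wt; rewrite fE; have [c0 _ _ _ _] := C (widen_ord (isT : (2 <= 4)%N) l); exact: c0.
  - move=> t l j Wt; rewrite fE; have [_ d1 _ _ _] := C (widen_ord (isT : (2 <= 4)%N) l).
    by have [] := d1 t j Wt.
  - move=> t Wt; apply: inj_row_free => v vT.
    have T0 := fiber_zero_tangent Wo Wt W0.
    apply/eqP; rewrite -(mulmx_free_eq0 _ (phifree t Wt)); apply/eqP/rowP.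
    have H (l : 'I_2) : (v *m tangent_mx phi t) 0 (widen_ord (isT : (2 <= 4)%N) l) = 0.
      rewrite -[RHS](_ : (v *m tangent_mx f t) 0 l = 0); last by rewrite vT mxE.
      by rewrite !mxE; apply: eq_bigr => j _; rewrite !mxE fE.
    apply: forall_ord4; rewrite [RHS]mxE.
    + by rewrite -[RHS](H 0); congr (_ 0 _); exact: val_inj.
    + by rewrite -[RHS](H 1); congr (_ 0 _); exact: val_inj.
    + by rewrite mxE big1 // => j _; have [-> _] := T0 j; rewrite mulr0.
    + by rewrite mxE big1 // => j _; have [_ ->] := T0 j; rewrite mulr0.
  - move=> t t' Wt Wt' ff; rewrite -(psiK t) // -(psiK t') //; congr psi.
    by rewrite -(base2_emb (W0 _ Wt)) -(base2_emb (W0 _ Wt')) -/(f t) ff.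
have ft0 : f t0 = y.
  rewrite /f phit0; apply/rowP; apply: forall_ord2; rewrite !mxE //.
have Dc : {for y, continuous (fun z => dist2 z y)}.
  by apply: dist2_continuous => l z; exact: coord_continuous.
have Dy : dist2 y y < e.
  rewrite /dist2 (eq_bigr (fun=> 0)) ?big1_eq // => l _.
  by rewrite subrr expr0n.
have nD : \forall z \near y, dist2 z y < e by exact: cvgr_lt _ Dc _ Dy.
apply: filterS nD => z zlt.
have [|t Wt ftz] := He z.
  rewrite ft0; move: zlt; congr (_ < _); apply: eq_bigr => l _.
  by rewrite -sqrrN opprB.
by rewrite /trace_set /= -ftz /f base2_emb; [exact: WN|exact: W0].
Qed.

Lemma minimal2_zero_section m a b c (N : set (AH R)) : 0 < m -> AH_profile m a b c ->
  compact_minimal_submanifold a b c 2 N -> N = zero_section R.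
Proof.
move=> hm habc Nmin; have k23 : 2%N = 2%N \/ 2%N = 3%N by left.
have Nsub := minimal_sub_zero_section hm habc k23 Nmin.
have [N0 Ncpt Nemb _] := Nmin.
have full i : trace_set N i !=set0 -> trace_set N i = setT.
  by apply: connected_plane; [exact: trace_open|exact: trace_closed].
apply/seteqP; split=> // q [j [x [x0 ->]]].
have [y ->] := fiber0_emb x0.
suff : trace_set N j !=set0 by move=> /full/seteqP[_]; apply.
have [p Np] := N0; have [i [z [z0 pE]]] := Nsub _ Np; have [y' zE] := fiber0_emb z0.
have Ni : trace_set N i = setT by apply: full; exists y'; rewrite /trace_set /= -zE -pE.
have [ij|ij] := eqVneq i j; first by rewrite -ij Ni; exists 0.
(* The point z = 1 has w = 1 as well, so it carries N from one chart plane to the other. *)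
have [y1 [h0 h1]] : exists y1 : 'rV[R]_2, y1 0 0 = 1 /\ y1 0 1 = 0.
  by exists (\row_l [:: 1; 0]`_l); rewrite !mxE.
have g : chart i (emb y1) = chart j (emb y1).
  have gE : glued (i, emb y1) (j, emb y1) =
      (base_coord (emb y1) != 0) && (emb y1 == transition (emb y1)).
    by rewrite /glued /= (negbTE ij).
  apply/(chart_eqP (i, _) (j, _)); rewrite gE; have [e0 e1 e2 e3] := embE y1.
  rewrite base_coord_eq0 e0 e1 h0 h1 expr1n expr0n addr0 oner_eq0 /=; apply/eqP.
  have [t0 t1] := transition_base (emb y1).
  have : fiber_coord (transition (emb y1)) = 0.
    by rewrite /transition fiber_point_of emb_fiber mul0r.
  move=> /eqP; rewrite fiber_coord_eq0 => /andP[/eqP u2 /eqP u3].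
  apply/rowP; apply: forall_ord4; rewrite ?t0 ?t1 ?u2 ?u3 ?e0 ?e1 ?e2 ?e3 ?h0 ?h1 //.
    by rewrite expr1n expr0n addr0 divr1.
  by rewrite oppr0 mul0r.
exists y1; rewrite /trace_set /= -g.
by have /seteqP[_ /(_ y1 I)] := Ni.
Qed.

End Uniqueness.

(** * The metric along the zero section *)

Section Limits.
Variables (R : realType) (m : R) (a b c : R -> R).
Hypotheses (hm : 0 < m) (habc : AH_profile m a b c).
Implicit Types x y v w : 'rV[R]_4.

Lemma cvg_small_bounded (T : Type) (F : set_system T) (FF : Filter F) (f g : T -> R) (K : R) :
  f @ F --> (0:R) -> (\forall t \near F, `|g t| <= K) -> (fun t => f t * g t) @ F --> (0:R).
Proof.
move=> f0 gK; apply/cvgrPdist_lt => e e0.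
have K0 : 0 < `|K| + 1 by rewrite ltr_wpDl.
have e1 : 0 < e / (`|K| + 1) by rewrite divr_gt0.
have f1 : \forall t \near F, `|0 - f t| < e / (`|K| + 1).
  by move/cvgrPdist_lt : f0; apply.
near=> t.
have h1 : `|0 - f t| < e / (`|K| + 1) by near: t.
have h2 : `|g t| <= K by near: t.
rewrite sub0r normrN in h1; rewrite sub0r normrN normrM.
apply: (@le_lt_trans _ _ (`|f t| * (`|K| + 1))); last by rewrite -ltr_pdivlMr.
by apply: ler_wpM2l => //; apply: (le_trans h2); apply: (le_trans (ler_norm K)); rewrite lerDl.
Unshelve. all: by end_near. Qed.

Lemma cvg_at_right0 (T : Type) (F : set_system T) (FF : Filter F) (f : T -> R) :
  f @ F --> (0:R) -> (\forall t \near F, 0 < f t) -> f @ F --> (0:R)^'+.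
Proof.
move=> f0 fpos A; rewrite /at_right /within /= => /f0 fA.
have fA' : F (fun t => 0 < f t -> A (f t)) := fA.
by apply: filterS (filterI fpos fA') => t [h1 h2]; exact: h2.
Qed.

(** This is the filter whose limit defines [AH_metric] on the zero section. *)
Definition punctured x := within [set y | fiber_coord y != 0] (nbhs x).

Lemma punctured_proper x : fiber_coord x = 0 -> ProperFilter (punctured x).
Proof.
move=> x0; apply: Build_ProperFilter_ex => A; rewrite /punctured /within /= => HA.
have [_ _ v2 _] := vertE R.
have N : \forall h \near (0:R)^', fiber_coord (x + h *: delta_mx 0 2%:R) != 0 ->
    A (x + h *: delta_mx 0 2%:R).
  by apply: nbhs_dnbhs; exact: (cvg_line (delta_mx 0 2%:R) HA).
have N0 : \forall h \near (0:R)^', h != 0 by exact: nbhs_dnbhs_neq.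
have [h [h0 hA]] := filter_ex (filterI N0 N).
exists (x + h *: delta_mx 0 2%:R); apply: hA.
rewrite fiber_coord_eq0; apply/nandP; left.
move/eqP: x0; rewrite fiber_coord_eq0 => /andP[/eqP x2 _].
by rewrite !mxE x2 /= mulr1 add0r.
Qed.

Lemma fiber_rad_punctured x : fiber_coord x = 0 -> fiber_rad y @[y --> punctured x] --> (0:R)^'+.
Proof.
move=> x0; apply: cvg_at_right0.
  apply: cvg_within_filter.
  have := @fiber_rad_continuous R x; rewrite /continuous_at.
  by have /eqP -> : fiber_rad x == 0 by rewrite fiber_rad_eq0 x0.
by rewrite /punctured near_withinE; apply: nearW => y; rewrite fiber_rad_gt0.
Qed.

(** Off the zero section sigma1 v = 2 [sigma1_base] + [sigma1_fiber] / (2 r). Likewise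
    [sigma23_fiber] is Re (u dz(v) dz(w)) / r. *)
Definition sigma1_base v (y : 'rV[R]_4) : R := (v 0 1 * y 0 0 - v 0 0 * y 0 1) / conf_factor y.
Definition sigma1_fiber v (y : 'rV[R]_4) : R := (v 0 3%:R * y 0 2%:R - v 0 2%:R * y 0 3%:R) / fiber_rad y.
Definition sigma23_fiber v w (y : 'rV[R]_4) : R :=
  ((v 0 0 * w 0 0 - v 0 1 * w 0 1) * y 0 2%:R
      - (v 0 0 * w 0 1 + v 0 1 * w 0 0) * y 0 3%:R) / fiber_rad y.

(* [sigma1_fiber] and [sigma23_fiber] are bounded but have no limit at u = 0;
   their coefficients tend to 0. *)
Lemma metric_entry_split v w y : fiber_coord y != 0 ->
  let r := fiber_rad y in let A := r^-1 * a r in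
  metric_entry a b c v w y = (v 0 2%:R * w 0 2%:R + v 0 3%:R * w 0 3%:R)
    + (4^-1 * A ^+ 2 - 1) * (sigma1_fiber v y * sigma1_fiber w y)
    + a r * A * sigma1_base w y * sigma1_fiber v y + a r * A * sigma1_base v y * sigma1_fiber w y
    + 4 * a r ^+ 2 * sigma1_base v y * sigma1_base w y
    + 4 / conf_factor y ^+ 2 * ((b r ^+ 2 + c r ^+ 2) / 2 * (v 0 0 * w 0 0 + v 0 1 * w 0 1))
    + 4 / conf_factor y ^+ 2 * ((b r ^+ 2 - c r ^+ 2) / 2) * sigma23_fiber v w y.
Proof.
move=> y0 r A.
have q0 : conf_factor y != 0 by rewrite gt_eqF // conf_factor_gt0.
have r0 : r != 0 by rewrite /r fiber_rad_eq0.
rewrite metric_entryE !dr_entryE !sigma1_entryE sigma23_entryE /A /sigma1_base /sigma1_fiber /sigma23_fiber -/r.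
(* The fibre inner product splits into a radial and an angular part by Lagrange's identity, which
   [field] can check only after the constant is multiplied by |u|^2 / r^2 = 1. *)
rewrite -[X in _ = X + _ + _ + _ + _ + _ + _](_ :
   (v 0 2%:R * w 0 2%:R + v 0 3%:R * w 0 3%:R) * (y 0 2%:R ^+ 2 + y 0 3%:R ^+ 2) / r ^+ 2 = _).
  by field; rewrite q0 r0.
by rewrite -fiber_rad_sqr mulfK // sqrf_eq0.
Qed.

Lemma fiber_comp_bound y l : l = 2%:R \/ l = 3%:R -> `|y 0 l / fiber_rad y| <= 1.
Proof.
move=> h; have [->|r0] := eqVneq (fiber_rad y) 0; first by rewrite invr0 mulr0 normr0.
have rp : 0 < fiber_rad y by rewrite lt0r r0 fiber_rad_ge0.
rewrite normrM normfV (gtr0_norm rp) ler_pdivrMr // mul1r -sqrtr_sqr ler_wsqrtr //.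
by case: h => ->; rewrite ?lerDl ?lerDr sqr_ge0.
Qed.

Lemma sigma1_fiber_bound v y : `|sigma1_fiber v y| <= `|v 0 3%:R| + `|v 0 2%:R|.
Proof.
rewrite /sigma1_fiber mulrBl -!mulrA; apply: (le_trans (ler_normB _ _)).
by apply: lerD; rewrite normrM ler_piMr // fiber_comp_bound //; [left|right].
Qed.

Lemma sigma23_fiber_bound v w y :
  `|sigma23_fiber v w y| <= `|v 0 0 * w 0 0 - v 0 1 * w 0 1| + `|v 0 0 * w 0 1 + v 0 1 * w 0 0|.
Proof.
rewrite /sigma23_fiber mulrBl -!mulrA; apply: (le_trans (ler_normB _ _)).
by apply: lerD; rewrite normrM ler_piMr // fiber_comp_bound //; [left|right].
Qed.

Lemma sigma1_base_continuous v : continuous (sigma1_base v).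
Proof.
move=> y; have cc k : continuous (@coordinate R 4 k) by move=> z; exact: coord_continuous.
rewrite (_ : sigma1_base v = (cst (v 0 1) * @coordinate R 4 0 - cst (v 0 0) * @coordinate R 4 1) * (fun x => (conf_factor x)^-1)) //.
apply: continuousM; last by apply: continuousV; [rewrite gt_eqF // conf_factor_gt0|exact: conf_factor_continuous].
have ck k l : {for y, continuous (cst k * @coordinate R 4 l)}.
  by apply: continuousM; [exact: cst_continuous|exact: cc].
by apply: continuousB; exact: ck.
Qed.

(** The limit is the flat fibre metric plus the round metric of radius m. The angular terms drop out
    because a / r tends to 2, so there is no cone angle, and because b^2 - c^2 tends to 0. *)
Lemma metric_entry_zero_section_cvg x v w : fiber_coord x = 0 ->
  metric_entry a b c v w y @[y --> punctured x] -->
    (v 0 2%:R * w 0 2%:R + v 0 3%:R * w 0 3%:R)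
    + 4 * m ^+ 2 / conf_factor x ^+ 2 * (v 0 0 * w 0 0 + v 0 1 * w 0 1).
Proof.
move=> x0; have PF := punctured_proper x0; have rP := fiber_rad_punctured x0.
have [[a0 b0 c0] [a1 _ _]] := profile_asymptotics hm habc.
have Ca : a (fiber_rad y) @[y --> punctured x] --> (0:R) by exact: cvg_comp rP a0.
have Cb : b (fiber_rad y) @[y --> punctured x] --> - m by exact: cvg_comp rP b0.
have Cc : c (fiber_rad y) @[y --> punctured x] --> m by exact: cvg_comp rP c0.
have CA : (fiber_rad y)^-1 * a (fiber_rad y) @[y --> punctured x] --> (2:R) by exact: cvg_comp rP a1.
have Ck u : sigma1_base u y @[y --> punctured x] --> sigma1_base u x.
  by apply: cvg_within_filter; exact: sigma1_base_continuous.
have Cq : 4 / conf_factor y ^+ 2 @[y --> punctured x] --> 4 / conf_factor x ^+ 2.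
  have c1 : conf_factor y @[y --> punctured x] --> conf_factor x.
    by apply: cvg_within_filter; exact: conf_factor_continuous.
  apply: cvgM; first exact: cvg_cst.
  apply: cvgV; first by rewrite sqrf_eq0 gt_eqF // conf_factor_gt0.
  by under eq_fun do rewrite expr2; rewrite expr2; exact: cvgM.
pose G y := (v 0 2%:R * w 0 2%:R + v 0 3%:R * w 0 3%:R)
    + (4^-1 * ((fiber_rad y)^-1 * a (fiber_rad y)) ^+ 2 - 1) * (sigma1_fiber v y * sigma1_fiber w y)
    + a (fiber_rad y) * ((fiber_rad y)^-1 * a (fiber_rad y)) * sigma1_base w y * sigma1_fiber v y
    + a (fiber_rad y) * ((fiber_rad y)^-1 * a (fiber_rad y)) * sigma1_base v y * sigma1_fiber w y
    + 4 * a (fiber_rad y) ^+ 2 * sigma1_base v y * sigma1_base w y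
    + 4 / conf_factor y ^+ 2 * ((b (fiber_rad y) ^+ 2 + c (fiber_rad y) ^+ 2) / 2 * (v 0 0 * w 0 0 + v 0 1 * w 0 1))
    + 4 / conf_factor y ^+ 2 * ((b (fiber_rad y) ^+ 2 - c (fiber_rad y) ^+ 2) / 2) * sigma23_fiber v w y.
have GE : \forall y \near punctured x, G y = metric_entry a b c v w y.
  by rewrite /punctured near_withinE; apply: nearW => y y0; rewrite metric_entry_split.
have GL : G y @[y --> punctured x] --> (v 0 2%:R * w 0 2%:R + v 0 3%:R * w 0 3%:R)
    + 0 + 0 + 0 + 4 * 0 ^+ 2 * sigma1_base v x * sigma1_base w x
    + 4 / conf_factor x ^+ 2 * (((- m) ^+ 2 + m ^+ 2) / 2 * (v 0 0 * w 0 0 + v 0 1 * w 0 1)) + 0.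
  have sqrC (f : 'rV[R]_4 -> R) (l : R) : f y @[y --> punctured x] --> l ->
      f y ^+ 2 @[y --> punctured x] --> l ^+ 2.
    by move=> fl; under eq_fun do rewrite expr2; rewrite expr2; exact: cvgM.
  have CaA u : a (fiber_rad y) * ((fiber_rad y)^-1 * a (fiber_rad y)) * sigma1_base u y @[y --> punctured x] --> (0:R).
    rewrite [X in _ --> X](_ : 0 = 0 * 2 * sigma1_base u x); last by rewrite !mul0r.
    by apply: cvgM (Ck u); exact: cvgM.
  apply: cvgD; first apply: cvgD; first apply: cvgD; first apply: cvgD; first apply: cvgD;
    first apply: cvgD.
  - exact: cvg_cst.
  - apply: (@cvg_small_bounded _ _ _ _ _ ((`|v 0 3%:R| + `|v 0 2%:R|) * (`|w 0 3%:R| + `|w 0 2%:R|))).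
      rewrite [X in _ --> X](_ : 0 = 4^-1 * 2 ^+ 2 - 1); last by field.
      apply: cvgB; last exact: cvg_cst.
      by apply: cvgM; [exact: cvg_cst|exact: sqrC].
    by apply: nearW => y; rewrite normrM ler_pM // sigma1_fiber_bound.
  - apply: (@cvg_small_bounded _ _ _ _ _ (`|v 0 3%:R| + `|v 0 2%:R|)); first exact: CaA.
    by apply: nearW => y; exact: sigma1_fiber_bound.
  - apply: (@cvg_small_bounded _ _ _ _ _ (`|w 0 3%:R| + `|w 0 2%:R|)); first exact: CaA.
    by apply: nearW => y; exact: sigma1_fiber_bound.
  - apply: cvgM (Ck w); apply: cvgM (Ck v); apply: cvgM; first exact: cvg_cst.
    exact: sqrC.
  - apply: cvgM Cq _; apply: cvgM; last exact: cvg_cst.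
    by apply: cvgM; [apply: cvgD; exact: sqrC|exact: cvg_cst].
  - apply: (@cvg_small_bounded _ _ _ _ _
     (`|v 0 0 * w 0 0 - v 0 1 * w 0 1| + `|v 0 0 * w 0 1 + v 0 1 * w 0 0|)).
      rewrite [X in _ --> X](_ : 0 = 4 / conf_factor x ^+ 2 * (((- m) ^+ 2 - m ^+ 2) / 2)); last first.
        by rewrite sqrrN subrr mul0r mulr0.
      apply: cvgM Cq _; apply: cvgM; last exact: cvg_cst.
      by apply: cvgB; exact: sqrC.
    by apply: nearW => y; exact: sigma23_fiber_bound.
have q0 : conf_factor x != 0 by rewrite gt_eqF // conf_factor_gt0.
rewrite (_ : _ + _ = (v 0 2%:R * w 0 2%:R + v 0 3%:R * w 0 3%:R)
    + 0 + 0 + 0 + 4 * 0 ^+ 2 * sigma1_base v x * sigma1_base w x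
    + 4 / conf_factor x ^+ 2 * (((- m) ^+ 2 + m ^+ 2) / 2 * (v 0 0 * w 0 0 + v 0 1 * w 0 1)) + 0); last first.
  by field.
by apply: cvg_trans GL; apply: near_eq_cvg.
Qed.

Lemma AH_metric_zero_section x i j : fiber_coord x = 0 ->
  AH_metric a b c x i j = (i == j)%:R * (if (1 < i)%N then 1 else 4 * m ^+ 2 / conf_factor x ^+ 2).
Proof.
move=> x0; rewrite mxE x0 eqxx.
have PF := punctured_proper x0.
have L := @metric_entry_zero_section_cvg x (delta_mx 0 i) (delta_mx 0 j) x0.
transitivity ((delta_mx 0 i : 'rV[R]_4) 0 2%:R * (delta_mx 0 j : 'rV[R]_4) 0 2%:R +
  (delta_mx 0 i : 'rV[R]_4) 0 3%:R * (delta_mx 0 j : 'rV[R]_4) 0 3%:R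
    + 4 * m ^+ 2 / conf_factor x ^+ 2 * ((delta_mx 0 i : 'rV[R]_4) 0 0 * (delta_mx 0 j : 'rV[R]_4) 0 0 +
    (delta_mx 0 i : 'rV[R]_4) 0 1 * (delta_mx 0 j : 'rV[R]_4) 0 1)).
  apply: cvg_lim => //; apply: cvg_trans L; apply: near_eq_cvg.
  by rewrite near_withinE; apply: nearW => y y0; rewrite metric_formE.
rewrite !mxE /=; move: i j {L}; apply: forall_ord4; apply: forall_ord4 => /=; ring.
Qed.

End Limits.

(** * First derivatives of the metric at the zero section *)

Section NormalDerivative.
Variables (R : realType) (m : R) (a b c : R -> R).
Hypotheses (hm : 0 < m) (habc : AH_profile m a b c).
Implicit Types x y v w : 'rV[R]_4.

Lemma norm_dnbhs0 : (fun h : R => `|h|) @ (0:R)^' --> (0:R)^'+.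
Proof.
apply: cvg_at_right0.
  apply: cvg_within_filter; have := @norm_continuous _ R^o (0:R).
  by rewrite /continuous_at normr0.
by apply: filterS (nbhs_dnbhs_neq (0:R)) => h h0; rewrite normr_gt0.
Qed.

(** To first order b^2 = m^2 - m r and c^2 = m^2 + m r. The linear terms are opposite, so they
    cancel in b^2 + c^2 and survive in b^2 - c^2. *)
Lemma profile_sqr_asymptotics :
  r^-1 * (b r ^+ 2 - m ^+ 2) @[r --> (0:R)^'+] --> - m /\
  r^-1 * (c r ^+ 2 - m ^+ 2) @[r --> (0:R)^'+] --> m.
Proof.
have [[a0 b0 c0] [_ b1 c1]] := profile_asymptotics hm habc; split.
  rewrite (_ : (fun r => _) = (fun r => (r^-1 * (b r + m)) * (b r - m))); last first.
    by apply/funext => r; ring.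
  rewrite [X in _ --> X](_ : - m = 2^-1 * (- m - m)); last by field.
  by apply: cvgM b1 _; apply: cvgB b0 _; exact: cvg_cst.
rewrite (_ : (fun r => _) = (fun r => (r^-1 * (c r - m)) * (c r + m))); last first.
  by apply/funext => r; ring.
rewrite [X in _ --> X](_ : m = 2^-1 * (m + m)); last by field.
by apply: cvgM c1 _; apply: cvgD c0 _; exact: cvg_cst.
Qed.

(** These are the values of Re(dz^2) on the two base directions; their sum is 0. *)
Definition base_sign (p : 'I_4) : R := if p == 0 then 1 else -1.

(** Along e_l the radius is |h|, while u / r is sign(h) times a fixed direction. This sign turns the
    b^2 - c^2 term, linear in |h|, into one linear in h, so the two-sided derivative exists. *)
Lemma AH_metric_normal_derivative x (l p : 'I_4) : fiber_coord x = 0 ->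
  (1 < l)%N -> ~~ (1 < p)%N ->
  is_derive x (delta_mx 0 l) (fun y => AH_metric a b c y p p)
    (- (4 / conf_factor x ^+ 2 * (base_sign p * (l == 2%:R)%:R) * m)).
Proof.
move=> x0 l1 p1.
have [[a0 _ _] [a1 _ _]] := profile_asymptotics hm habc.
have [bs cs] := profile_sqr_asymptotics.
move/eqP: (x0); rewrite fiber_coord_eq0 => /andP[/eqP x2 /eqP x3].
set e := delta_mx 0 l : 'rV[R]_4; set q2 := 4 / conf_factor x ^+ 2; set sg := base_sign p * _.
set kp := sigma1_base (delta_mx 0 p) x.
(* X collects the terms that depend on h through |h| alone and must vanish in the limit; Y is (b^2 -
   c^2) / (2 r), which tends to - m. *)
pose X (r : R) := 4 * kp ^+ 2 * (a r * (r^-1 * a r)) +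
  q2 / 2 * (r^-1 * (b r ^+ 2 - m ^+ 2) + r^-1 * (c r ^+ 2 - m ^+ 2)).
pose Y (r : R) := 2^-1 * (r^-1 * (b r ^+ 2 - m ^+ 2) - r^-1 * (c r ^+ 2 - m ^+ 2)).
have X0 : X r @[r --> (0:R)^'+] --> (0:R).
  rewrite [L in _ --> L](_ : 0 = 4 * kp ^+ 2 * (0 * 2) + q2 / 2 * (- m + m)); last by ring.
  apply: cvgD; apply: cvgM; first exact: cvg_cst; first exact: cvgM; first exact: cvg_cst.
  exact: cvgD.
have Y0 : Y r @[r --> (0:R)^'+] --> - m.
  rewrite [L in _ --> L](_ : - m = 2^-1 * (- m - m)); last by field.
  by apply: cvgM; [exact: cvg_cst|exact: cvgB].
have DQ (h : R) : h != 0 -> h^-1 * (AH_metric a b c (x + h *: e) p p - AH_metric a b c x p p) =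
    X `|h| * (`|h| / h) + q2 * sg * Y `|h|.
  move=> h0; set y := x + h *: e.
  have nh0 : `|h| != 0 by rewrite normr_eq0.
  have y0 : y 0 0 = x 0 0.
    by rewrite !mxE eqxx [0 == l](contraTF _ l1) ?mulr0 ?addr0 // => /eqP <-.
  have y1 : y 0 1 = x 0 1.
    by rewrite !mxE eqxx [1 == l](contraTF _ l1) ?mulr0 ?addr0 // => /eqP <-.
  have y2 : y 0 2%:R = h * (l == 2%:R)%:R by rewrite !mxE x2 add0r eq_sym.
  have y3 : y 0 3%:R = h * (l == 3%:R)%:R by rewrite !mxE x3 add0r eq_sym.
  have ry : fiber_rad y = `|h|.
    rewrite /fiber_rad y2 y3 -sqrtr_sqr; congr Num.sqrt.
    move: l l1 @e @y @sg y0 y1 y2 y3; apply: forall_ord4 => //= _ *; ring.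
  have yn : fiber_coord y != 0 by rewrite -fiber_rad_eq0 ry.
  have qy : conf_factor y = conf_factor x by rewrite /conf_factor y0 y1.
  have ky : sigma1_base (delta_mx 0 p) y = kp by rewrite /kp /sigma1_base y0 y1 qy.
  rewrite AH_metricE // metric_formE // metric_entry_split // (AH_metric_zero_section hm habc) // ky ry qy.
  rewrite eqxx (negbTE p1) mul1r -/q2.
  have [d2 d3 dz dq] : [/\ (delta_mx 0 p : 'rV[R]_4) 0 2%:R = 0, (delta_mx 0 p : 'rV[R]_4) 0 3%:R = 0,
     (delta_mx 0 p : 'rV[R]_4) 0 0 * (delta_mx 0 p : 'rV[R]_4) 0 0 +
     (delta_mx 0 p : 'rV[R]_4) 0 1 * (delta_mx 0 p : 'rV[R]_4) 0 1 = 1 &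
     sigma23_fiber (delta_mx 0 p) (delta_mx 0 p) y = sg * h / `|h|].
    rewrite /sigma23_fiber ry y2 y3 /sg /base_sign !mxE.
    move: p p1 @kp @X @sg {X0 ky}; apply: forall_ord4 => //= _ *; split; ring.
  rewrite /sigma1_fiber d2 d3 dz dq /X /Y (_ : 4 * m ^+ 2 / conf_factor x ^+ 2 = q2 * m ^+ 2);
    last by rewrite /q2 mulrAC.
  by rewrite ry; field; rewrite h0 nh0.
have L : (fun h => h^-1 *: (((fun y => AH_metric a b c y p p) \o shift x) (h *: e) -
     AH_metric a b c x p p)) @ (0:R)^' --> - (q2 * sg * m).
  have C : X `|h| * (`|h| / h) + q2 * sg * Y `|h| @[h --> (0:R)^'] --> 0 + q2 * sg * - m.
    apply: cvgD.
      apply: (@cvg_small_bounded _ _ _ _ _ _ 1).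
        exact: cvg_comp norm_dnbhs0 X0.
      apply: filterS (nbhs_dnbhs_neq (0:R)) => h h0.
      by rewrite normrM normr_id normfV divff ?normr_eq0.
    apply: cvgM; first exact: cvg_cst.
    exact: cvg_comp norm_dnbhs0 Y0.
  rewrite add0r mulrN in C; apply: cvg_trans C; apply: near_eq_cvg.
  apply: filterS (nbhs_dnbhs_neq (0:R)) => h h0 /=.
  rewrite -DQ //. by rewrite [h *: e + x]addrC.
by apply: DeriveDef; [apply/cvg_ex; eexists; exact: L|exact/cvg_lim].
Qed.

(** A base direction stays on the zero section, where the mixed entries of g vanish identically. *)
Lemma AH_metric_tangent_derivative x (l p q : 'I_4) : fiber_coord x = 0 ->
  (1 < l)%N -> ~~ (1 < p)%N -> ~~ (1 < q)%N ->
  partial p (fun y => AH_metric a b c y l q) x = 0.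
Proof.
move=> x0 l1 p1 q1.
have lq : l != q by apply: contraTneq l1 => ->.
move/eqP: (x0); rewrite fiber_coord_eq0 => /andP[/eqP x2 /eqP x3].
rewrite /partial /derive.
rewrite (_ : (fun h => _) = cst 0) ?lim_cst //.
apply/funext => h /=; rewrite !(AH_metric_zero_section hm habc) ?(negbTE lq) ?mul0r ?subr0 ?scaler0 //.
apply/eqP; rewrite fiber_coord_eq0 !mxE x2 x3.
by move: p p1; apply: forall_ord4 => //= _; rewrite !mulr0 !addr0 eqxx.
Qed.

End NormalDerivative.

(** * The zero section is compact, embedded and minimal *)

Section ZeroSectionMinimal.
Variables (R : realType).
Implicit Types x : 'rV[R]_4.

(** The images of the squares [-1, 1]^2 of both charts cover it: outside the square |z|^2 >= 1
    bounds both coordinates of z, so those of 1/z are at most 1 in absolute value. *)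
Lemma zero_section_compact : compact (zero_section R).
Proof.
pose B := [set y : 'rV[R]_2 | forall l, `[(-1 : R), 1]%classic (y 0 l)].
have Bc : compact B by apply: (@rV_compact R 2 (fun=> `[-1, 1]%classic)) => _; exact: segment_compact.
have Cc i : compact ((chart i \o @emb R) @` B).
  apply: continuous_compact => //; apply: continuous_subspaceT => y.
  by apply: continuous_comp; [exact: emb_continuous|exact: chart_continuous].
rewrite (_ : zero_section R = (chart false \o @emb R) @` B `|` (chart true \o @emb R) @` B).
  exact: compactU.
apply/seteqP; split=> [q [i [x [x0 ->]]]|q [[y _ <-]|[y _ <-]]]; last 2 first.
- by exists false, (emb y); rewrite emb_fiber.
- by exists true, (emb y); rewrite emb_fiber.
have [y ->] := fiber0_emb x0.
suff [By|[y' By' yy']] : B y \/ exists2 y', B y' & chart i (emb y) = chart (~~ i) (emb y').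
- by case: i; [right|left]; exists y.
- by rewrite yy'; case: i {yy'}; [left|right]; exists y'.
have [By|nB] := pselect (B y); [by left|right].
have [e0 e1 _ _] := embE y.
pose n := y 0 0 ^+ 2 + y 0 1 ^+ 2.
have big l : 1 < `|y 0 l| -> 1 <= n /\ `|y 0 l| <= n.
  move=> hl; have hn : `|y 0 l| ^+ 2 <= n.
    rewrite real_normK ?num_real // /n; move: l {hl}; apply: forall_ord2.
      by rewrite lerDl sqr_ge0.
    by rewrite lerDr sqr_ge0.
  have h2 : `|y 0 l| <= `|y 0 l| ^+ 2 by rewrite expr2 ler_peMr // ltW.
  by split; [apply: le_trans (ltW hl) (le_trans h2 hn)|exact: le_trans h2 hn].
have [l hl] : exists l, 1 < `|y 0 l|.
  apply: contrapT => H; apply: nB => l; rewrite /= in_itv /= -ler_norml leNgt.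
  by apply/negP => hl; apply: H; exists l.
have [n1 _] := big l hl.
have n0 : 0 < n by exact: lt_le_trans n1.
have all_le k : `|y 0 k| <= n.
  by case: (leP `|y 0 k| 1) => [h|/big[] //]; exact: le_trans n1.
have [t0 t1] := transition_base (emb y); rewrite e0 e1 -/n in t0 t1.
have ft : fiber_coord (transition (emb y)) = 0.
  by rewrite /transition fiber_point_of emb_fiber mul0r.
have [y' yE] := fiber0_emb ft; have [f0 f1 _ _] := embE y'.
exists y'.
  apply: forall_ord2; rewrite /= in_itv /= -ler_norml.
    by rewrite -f0 -yE t0 normrM normfV (gtr0_norm n0) ler_pdivrMr // mul1r.
  by rewrite -f1 -yE t1 normrM normrN normfV (gtr0_norm n0) ler_pdivrMr // mul1r.
apply/(chart_eqP (i, _) (~~ i, _)).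
have -> : glued (i, emb y) (~~ i, emb y') = (base_coord (emb y) != 0) && (emb y' == transition (emb y)).
  by rewrite /glued; case: i.
by rewrite yE eqxx andbT base_coord_eq0 e0 e1 gt_eqF.
Qed.

Lemma smooth_cst k (W : set 'rV[R]_k) (r : R) : smooth_on W (cst r).
Proof.
move=> p; elim: p r => [|p IH] r /=; split => //; try by move=> t _; exact: cst_continuous.
move=> i; split; first by move=> t _; exact: derivable_cst.
rewrite (_ : partial i (cst r) = cst 0) //.
by apply/funext => t; rewrite /partial derive_cst.
Qed.

Lemma smooth_coordinate k (W : set 'rV[R]_k) l : smooth_on W (@coordinate R k l).
Proof.
move=> [|p] /=; split => //; try by move=> t _; exact: coord_continuous.
move=> i; split; first by move=> t _; have [] := is_derive_coordinate t (delta_mx 0 i) l.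
rewrite (_ : partial i _ = cst ((delta_mx 0 i : 'rV[R]_k) 0 l)); first exact: smooth_cst.
by apply/funext => t; rewrite /partial (@derive_val _ _ _ _ _ _ _ (is_derive_coordinate t (delta_mx 0 i) l)).
Qed.

Lemma emb_coordinate (l : 'I_4) : (fun y : 'rV[R]_2 => emb y 0 l) =
  [:: @coordinate R 2 0; @coordinate R 2 1; cst 0; cst 0]`_l.
Proof. by move: l; apply: forall_ord4; apply/funext => y; rewrite mxE. Qed.

Lemma base2_continuous : continuous (@base2 R).
Proof.
move=> x A /nbhs_ballP[d /= d0 Ad]; apply/nbhs_ballP; exists d => //= x' [_ xx'].
by apply: Ad; split=> // i l; rewrite (ord1 i) !mxE; exact: xx'.
Qed.

Lemma base2K (y : 'rV[R]_2) : base2 (emb y) = y.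
Proof. by apply/rowP; apply: forall_ord2; rewrite !mxE. Qed.

Lemma zero_section_submanifold : AH_submanifold 2 (zero_section R).
Proof.
move=> i x /zero_sectionE x0; exists setT, (@emb R); split; last first.
  by have [y ->] := fiber0_emb x0; exists y.
split; first exact: openT.
- move=> l; rewrite emb_coordinate; move: l; apply: forall_ord4 => /=;
    [exact: smooth_coordinate|exact: smooth_coordinate|exact: smooth_cst|exact: smooth_cst].
- move=> t _; apply: inj_row_free => v vT.
  have T k (l : 'I_2) : tangent_mx (@emb R) t k (widen_ord (isT : (2 <= 4)%N) l) = (l == k)%:R.
    rewrite mxE emb_coordinate /partial.
    rewrite (_ : _`_ _ = @coordinate R 2 l); last by move: l; apply: forall_ord2.
    by rewrite (@derive_val _ _ _ _ _ _ _ (is_derive_coordinate t (delta_mx 0 k) l)) mxE eqxx.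
  apply/rowP => l; have := congr1 (fun M : 'rV[R]_4 => M 0 (widen_ord (isT : (2 <= 4)%N) l)) vT.
  rewrite !mxE (bigD1 l) //= T eqxx mulr1 big1 ?addr0 // => k kl.
  by rewrite T eq_sym (negbTE kl) mulr0.
- exists setT; split; first exact: openT.
    rewrite setIT; apply/seteqP; split=> [_ [y _ <-]|z /zero_sectionE z0].
      by apply/zero_sectionE; exact: emb_fiber.
    by have [y ->] := fiber0_emb z0; exists y.
  exists (@base2 R); split; last by move=> t _; exact: base2K.
  by apply: continuous_subspaceT => z; exact: base2_continuous.
Qed.

Lemma normal_part_tangent k n (g : 'rV[R]_n -> 'M[R]_n) (phi : 'rV[R]_k -> 'rV[R]_n) t
    (w : 'rV[R]_k) : induced_metric g phi t \in unitmx ->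
  normal_part g phi t (w *m tangent_mx phi t) = 0.
Proof.
move=> U; rewrite /normal_part.
rewrite (_ : w *m tangent_mx phi t *m g (phi t) *m (tangent_mx phi t)^T =
  w *m induced_metric g phi t); last by rewrite /induced_metric !mulmxA.
by rewrite mulmxK // subrr.
Qed.

Variables (m : R) (a b c : R -> R).
Hypotheses (hm : 0 < m) (habc : AH_profile m a b c).

(* The first-order term of g in u is -4 m Re(u dz^2) / (1 + |z|^2)^2, traceless on TSigma. *)
Lemma zero_section_minimal : AH_minimal a b c 2 (zero_section R).
Proof.
move=> i W phi [Wo phis phifree [U [_ phiU _]]] t Wt.
have W0 s : W s -> fiber_coord (phi s) = 0.
  move=> Ws; apply/(zero_sectionE i); have : (phi @` W) (phi s) by exists s.
  by rewrite phiU => -[].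
set G := AH_metric a b c; set x := phi t.
have x0 : fiber_coord x = 0 by exact: W0.
have q0 : conf_factor x != 0 by rewrite gt_eqF // conf_factor_gt0.
have m0 : m != 0 by rewrite gt_eqF.
have GE := fun i j => AH_metric_zero_section hm habc i j x0.
pose la := 4 * m ^+ 2 / conf_factor x ^+ 2.
have la0 : la != 0 by rewrite !mulf_neq0 ?pnatr_eq0 ?expf_neq0 ?invr_eq0 // expf_neq0.
pose dg (k : R) := diag_mx (\row_l (if (1 < (l : 'I_4))%N then 1 else k)) : 'M[R]_4.
have GD : G x = dg la.
  by apply/matrixP => j l; rewrite GE !mxE mulrb mulr_natl; case: eqVneq => [->|].
have dgM k k' : dg k *m dg k' = dg (k * k').
  rewrite /dg mulmx_diag; congr diag_mx; apply/rowP => l; rewrite !mxE.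
  by case: ifP => _ //; rewrite mulr1.
have dg1 : dg 1 = 1%:M.
  by apply/matrixP => j l; rewrite !mxE; case: ifP => _; rewrite mulrb.
have GV : invmx (G x) = dg la^-1.
  have H : G x *m dg la^-1 = 1%:M by rewrite GD dgM divff.
  have [UG _] := mulmx1_unit H.
  by rewrite -[RHS](mulKmx UG) H mulmx1.
have GS : G x = dg (2 * m / conf_factor x) *m (dg (2 * m / conf_factor x))^T.
  rewrite tr_diag_mx dgM GD; congr dg; rewrite /la; field.
  exact: q0.
have Eu : dg (2 * m / conf_factor x) \in unitmx.
  have : G x \in unitmx.
    have H : G x *m dg la^-1 = 1%:M by rewrite GD dgM divff.
    by have [] := mulmx1_unit H.
  by rewrite GS unitmx_mul => /andP[].
(* An abstract T keeps later [mxE] rewrites from unfolding [tangent_mx]. *)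
have [T TE] : {T : 'M[R]_(2, 4) | tangent_mx phi t = T} by exists (tangent_mx phi t).
have Tf : row_free T by rewrite -TE; exact: phifree.
have T23 := fiber_zero_tangent Wo Wt W0; rewrite TE in T23.
have indU : induced_metric G phi t \in unitmx.
  rewrite (induced_metric_gram GS); apply: gram_unit; rewrite TE.
  apply: inj_row_free => v; rewrite mulmxA => /(congr1 (mulmx^~ (invmx (dg (2 * m / conf_factor x))))).
  by rewrite mulmxK // mul0mx => /eqP; rewrite mulmx_free_eq0 // => /eqP.
pose b2 := widen_ord (isT : (2 <= 4)%N).
have b20 : b2 0 = 0 by exact: val_inj.
have b21 : b2 1 = 1 by exact: val_inj.
pose T0 : 'M[R]_2 := \matrix_(j, l) T j (b2 l).
have T0E : T0 \in unitmx.
  rewrite -row_free_unit; apply: inj_row_free => v vT.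
  apply/eqP; rewrite -(mulmx_free_eq0 _ Tf); apply/eqP/rowP.
  have H l : (v *m T) 0 (b2 l) = 0.
    have := congr1 (fun M : 'rV[R]_2 => M 0 l) vT; rewrite !mxE => E0; apply: etrans E0.
    by apply: eq_bigr => j _; rewrite mxE.
  apply: forall_ord4; rewrite [RHS]mxE; [by rewrite -b20|by rewrite -b21| |];
    by rewrite mxE big1 // => j _; have [h2 h3] := T23 j; rewrite ?h2 ?h3 mulr0.
set P := invmx (induced_metric G phi t).
have indE : induced_metric G phi t = la *: (T0 *m T0^T).
  apply/matrixP => j k; rewrite /induced_metric TE GD !mxE sum4.
  have [j2 j3] := T23 j; have [k2 k3] := T23 k.
  rewrite mul_mx_diag !mxE j2 j3 !mul0r !addr0 big_ord_recr big_ord_recr big_ord0 /= add0r !mxE.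
  rewrite (_ : b2 _ = 0); last exact: val_inj.
  rewrite (_ : b2 _ = 1); last exact: val_inj.
  ring.
(* The induced metric is la T0 T0^T, so the inverse metric pushed to the base directions is la^-1
   times the identity, whatever the parametrization. *)
have TPT : T0^T *m P *m T0 = la^-1%:M.
  have E : P = la^-1 *: (invmx T0^T *m invmx T0).
    have H : induced_metric G phi t *m (la^-1 *: (invmx T0^T *m invmx T0)) = 1%:M.
      rewrite indE -scalemxAl -scalemxAr scalerA divff // scale1r -mulmxA mulKVmx ?unitmx_tr //.
      by rewrite mulmxV.
    by rewrite -[RHS](mulKmx indU) H mulmx1.
  rewrite E -scalemxAr -scalemxAl mulKVmx ?unitmx_tr // mulVmx //.
  by rewrite scalemx1.
rewrite mean_curvature_normal_part.
set V := \sum_i \sum_j _.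
(* The fibre components of phi vanish on W, so only Christoffel symbols contribute here, and their
   trace is computed by [TPT]. *)
have Vz (l : 'I_4) : (1 < l)%N -> V 0 l = 0.
  move=> l1.
  have phl s : W s -> phi s 0 l = 0.
    move=> /W0/eqP; rewrite fiber_coord_eq0 => /andP[/eqP h2 /eqP h3].
    by move: l l1; apply: forall_ord4.
  have ph1 j s : W s -> partial j (fun s => phi s 0 l) s = 0.
    move=> Ws; rewrite /partial (@near_eq_derive _ _ _ _ (cst 0)) ?derive_cst //.
    by apply: filterS (open_nbhs_nbhs (conj Wo Ws)) => s' /phl.
  have ph2 j k : partial j (partial k (fun s => phi s 0 l)) t = 0.
    rewrite /partial (@near_eq_derive _ _ _ _ (cst 0)) ?derive_cst //.
    by apply: filterS (open_nbhs_nbhs (conj Wo Wt)) => s' /(ph1 k).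
  have VE : V 0 l = \sum_p \sum_q christoffel G x l p q * (T^T *m P *m T) p q.
    rewrite /V summxE.
    transitivity (\sum_j \sum_k \sum_p \sum_q christoffel G x l p q * (T j p * P j k * T k q)).
      apply: eq_bigr => j _; rewrite summxE; apply: eq_bigr => k _.
      rewrite !mxE ph2 add0r mulr_sumr; apply: eq_bigr => p _.
      rewrite mulr_sumr; apply: eq_bigr => q _; rewrite -/x TE -/P; ring.
    under eq_bigr => j _ do rewrite exchange_big /=.
    rewrite exchange_big /=; apply: eq_bigr => p _.
    under eq_bigr => j _ do rewrite exchange_big /=.
    rewrite exchange_big /=; apply: eq_bigr => q _.
    rewrite mxE mulr_sumr exchange_big /=; apply: eq_bigr => k _.
    rewrite mxE mulr_suml mulr_sumr; apply: eq_bigr => j _; rewrite mxE; ring.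
  have D0 (p q : 'I_2) : (T^T *m P *m T) (b2 p) (b2 q) = la^-1 *+ (p == q).
    have := congr1 (fun M : 'M[R]_2 => M p q) TPT; rewrite [RHS]mxE => <-.
    rewrite !mxE; apply: eq_bigr => k _; rewrite !mxE; congr (_ * _).
    by apply: eq_bigr => j _; rewrite !mxE.
  have Dl (p q : 'I_4) : (1 < p)%N -> (T^T *m P *m T) p q = 0.
    move=> p1; rewrite mxE big1 // => k _; rewrite mxE big1 ?mul0r // => j _.
    rewrite mxE; have [h2 h3] := T23 j.
    by move: p p1; apply: forall_ord4 => // _; rewrite ?h2 ?h3 mul0r.
  have Dr (p q : 'I_4) : (1 < q)%N -> (T^T *m P *m T) p q = 0.
    move=> q1; rewrite mxE big1 // => k _; have [h2 h3] := T23 k.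
    by move: q q1; apply: forall_ord4 => // _; rewrite ?h2 ?h3 mulr0.
  have D00 : (T^T *m P *m T) 0 0 = la^-1 by have := D0 0 0; rewrite b20.
  have D01 : (T^T *m P *m T) 0 1 = 0 by have := D0 0 1; rewrite b20 b21.
  have D10 : (T^T *m P *m T) 1 0 = 0 by have := D0 1 0; rewrite b20 b21.
  have D11 : (T^T *m P *m T) 1 1 = la^-1 by have := D0 1 1; rewrite b21.
  have Gam (p : 'I_4) : ~~ (1 < p)%N ->
      christoffel G x l p p = 2^-1 * (4 / conf_factor x ^+ 2 * (base_sign R p * (l == 2%:R)%:R) * m).
    move=> p1; rewrite /christoffel; congr (_ * _); rewrite (bigD1 l) //= big1 => [|s sl].
      rewrite GV mxE eqxx mxE l1 mul1r addr0.
      have -> : partial p (fun y => G y l p) x = 0.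
        by apply: (AH_metric_tangent_derivative hm habc).
      rewrite add0r sub0r /partial.
      by rewrite (@derive_val _ _ _ _ _ _ _ (AH_metric_normal_derivative hm habc x0 l1 p1)) opprK.
    by rewrite GV mxE eq_sym (negbTE sl) mulr0n mul0r.
  (* What remains is la^-1 times the sum of the two diagonal Christoffel symbols of the base, which
     [base_sign] makes opposite. *)
  rewrite VE; move: (christoffel G x l) Gam => Ch Gam.
  rewrite !sum4 !(Dl 2%:R) // !(Dl 3%:R) // !(Dr _ 2%:R) // !(Dr _ 3%:R) // D00 D01 D10 D11.
  rewrite (Gam 0) // (Gam 1) // /base_sign /=; field.
  by rewrite la0 q0.
(* Having no fibre components, V is a combination of the rows of T, because their base block T0 is
   invertible; so V is tangent. *)
have VT : V = (base2 V *m invmx T0) *m T.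
  have H l : V 0 (b2 l) = ((base2 V *m invmx T0) *m T) 0 (b2 l).
    have := mulmxKV T0E (base2 V) => E.
    have := congr1 (fun M : 'rV[R]_2 => M 0 l) E; rewrite [RHS]mxE => <-.
    by rewrite [LHS]mxE [RHS]mxE; apply: eq_bigr => j _; rewrite [T0 _ _]mxE.
  apply/rowP; apply: forall_ord4; [by rewrite -b20|by rewrite -b21| |]; rewrite Vz //;
    by rewrite mxE big1 // => j _; have [h2 h3] := T23 j; rewrite ?h2 ?h3 mulr0.
by rewrite VT -TE; exact: normal_part_tangent.
Qed.

End ZeroSectionMinimal.

Theorem theorem3p7 (R : realType) (m : R) (a b c : R -> R) (hm : 0 < m)
    (habc : AH_profile m a b c) :
  (forall N : set (AH R),
     compact_minimal_submanifold a b c 2 N <-> N = zero_section R) /\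
  ~ (exists N : set (AH R), compact_minimal_submanifold a b c 3 N).
Proof.
split; last by case=> N; exact: no_minimal3 hm habc.
move=> N; split=> [|->]; first exact: minimal2_zero_section hm habc.
split.
- by exists (chart false (emb 0)), false, (emb 0); rewrite emb_fiber.
- exact: zero_section_compact.
- exact: zero_section_submanifold.
- exact: zero_section_minimal hm habc.
Qed.
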